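(* Let $\sigma\colon(\mathcal M,L)\to(\mathcal B,\tilde L)$ be a pseudo-Finsler submersion such that for every $v\in\mathcal A$ the vertical space at $\pi(v)$ is $g_v$-non-degenerate. For each admissible $v$ at $p$, each vertical $w$ and each $g_v$-horizontal $x$ at $p$ (with $L(v)g_v(w,w)\neq g_v(v,w)^2$, resp. $L(v)g_v(x,x)\ne g_v(v,x)^2$, so that the flag curvatures are defined), \begin{align*} K_v(w)={}&K^\top_v(w)+\frac{g_v((\nabla_v\mathbf T)^v_ww-(\nabla_w(\mathbf T+\mathbf A))^v_vw,v)}{L(v)g_v(w,w)-g_v(v,w)^2}\\ &+\frac{-g_v(\mathbf A^v_{(\mathbf T+\mathbf A)^v_vw}w,v)+g_v(\mathbf T^v_ww,(\mathbf T+\mathbf A)^v_vv)-g_v((\mathbf T+\mathbf A)^v_vw,\mathbf T^v_wv)}{L(v)g_v(w,w)-g_v(v,w)^2}, \end{align*} and \begin{align*} K_v(x)={}&K^\top_v(x)+K^\bot_v(x)+\frac{g_v((\nabla_v\mathbf A)^v_xx-(\nabla_x(\mathbf T+\mathbf A))^v_vx,v)}{L(v)g_v(x,x)-g_v(v,x)^2}\\ &+\frac{-g_v(\mathbf T^v_{(\mathbf T+\mathbf A)^v_vx}x,v)+g_v(\mathbf A^v_xx,(\mathbf T+\mathbf A)^v_vv)-g_v((\mathbf T+\mathbf A)^v_vx,\mathbf A^v_xv)}{L(v)g_v(x,x)-g_v(v,x)^2}. \end{align*}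
   Context: **Metrics.** A pseudo-Finsler metric on $\mathcal M$ (with projection $\pi\colon T\mathcal M\to\mathcal M$) is a smooth $L\colon\mathcal A\to\mathbb R$, $\mathcal A\subset T\mathcal M\setminus\mathbf 0$ open and invariant under positive scalar multiplication, with $L(\lambda v)=\lambda^2L(v)$ for $\lambda>0$ and with non-degenerate fundamental tensor $g_v(e,h)=\frac12\frac{\partial^2}{\partial s\partial t}L(v+se+th)|_{s=t=0}$. Elements of $\mathcal A$ are admissible. **Anisotropic calculus.** An anisotropic tensor $T$ assigns smoothly to $v\in\mathcal A$ a tensor $T_v$ (or $T^v$) on $T_{\pi(v)}\mathcal M$; an anisotropic vector field $\mathcal X$ assigns $\mathcal X_v\in T_{\pi(v)}\mathcal M$. $T_V$ is the ordinary tensor $(T_V)_q=T_{V_q}$ for an admissible local vector field $V$. Fiber derivative: $(\dot\partial T)_v(e)=\frac{d}{dt}T_{v+te}|_{t=0}$. An anisotropic connection assigns to vector fields $E,H$ an anisotropic vector field $\nabla_EH$, $v\mapsto\nabla^v_EH$, $C^\infty$-linear in $E$, additive and satisfying the Leibniz rule in $H$. For anisotropic vector fields $\nabla^v_e\mathcal X=\nabla^v_e(\mathcal X_V)-(\dot\partial\mathcal X)_v(\nabla^v_eV)$, and for functions $f$ on $\mathcal A$, $(\nabla_ef)(v)=e(f(V))-(\dot\partial f)_v(\nabla^v_eV)$, for any admissible local extension $V$ of $v$ (independent of the choice); covariant derivatives of other anisotropic tensors are defined by the product rule. The Levi-Civita–Chern connection $\nabla$ of $(\mathcal M,L)$ is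 the unique anisotropic connection with $\nabla^v_EH-\nabla^v_HE=[E,H]_{\pi(v)}$ and $\nabla g=0$. Its curvature is $R_v(E,H)B=\nabla^v_E\nabla_HB-\nabla^v_H\nabla_EB-\nabla^v_{[E,H]}B$. **Submersions.** Let $\sigma\colon\mathcal M\to\mathcal B$ be a surjective map with surjective differential, $\mathcal V_p=\ker d\sigma_p$ (vertical vectors). An admissible $v\in T_p\mathcal M$ is horizontal if $g_v(v,w)=0$ for all $w\in\mathcal V_p$. $\sigma\colon(\mathcal M,L)\to(\mathcal B,\tilde L)$ is a pseudo-Finsler submersion if the restriction of $L$ to the tangent spaces of the fibers is a pseudo-Finsler metric on each fiber, and $L(v)=\tilde L(d\sigma(v))$ for every horizontal $v$. A vector is $g_v$-horizontal if it is $g_v$-orthogonal to $\mathcal V_p$. **O'Neill tensors.** For admissible $v\in T_p\mathcal M$, write $e=e^\top_v+e^\bot_v$ with $e^\top_v\in\mathcal V_p$ and $e^\bot_v$ $g_v$-horizontal; $E^\top,E^\bot$ are the anisotropic vector fields $v\mapsto(E_v)^\top_v$, $v\mapsto(E_v)^\bot_v$. Put $\chi^v_he=(\nabla^v_hE^\bot)^\top_v+(\nabla^v_hE^\top)^\bot_v$ for any extension $E$ of $e$ (tensorial), and $\mathbf T^v_be=\chi^v_{b^\top_v}e$, $\mathbf A^v_be=\chi^v_{b^\bot_v}e$. **Curvatures.** For $b,e,h\in T_p\mathcal M$ with extensions $B,E,H$, $R^\top_v(b,e)h=\big(\nabla^v_b(\nabla_EH^\top)^\top-\nabla^v_e(\nabla_BH^\top)^\top-\nabla^v_{[B,E]}H^\top\big)^\top_v$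 and $R^\bot_v(b,e)h=\big(\nabla^v_b(\nabla_EH^\bot)^\bot-\nabla^v_e(\nabla_BH^\bot)^\bot-\nabla^v_{[B,E]}H^\bot\big)^\bot_v$ (anisotropic tensors). The flag curvature is $K_v(e)=\dfrac{g_v(R_v(v,e)e,v)}{L(v)g_v(e,e)-g_v(v,e)^2}$, and $K^\top_v(e)$, $K^\bot_v(e)$ are defined by the same formula with $R$ replaced by $R^\top$, $R^\bot$ respectively. *)

(* Defs.v *)
From HB Require Import structures.
From mathcomp Require Import all_boot all_order all_algebra.
From mathcomp Require Import all_classical all_reals all_analysis.

Set Implicit Arguments.
Unset Strict Implicit.
Unset Printing Implicit Defensive.
Import Order.TTheory GRing.Theory Num.Theory.
Import numFieldNormedType.Exports.
Local Open Scope classical_set_scope.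
Local Open Scope ring_scope.

(* C^oo on an open set U: all iterated directional derivatives exist and are
   differentiable at every point of U.  The values of f off U are irrelevant. *)
Definition iter_derive (R : realType) (V W : normedModType R)
    (s : seq V) (f : V -> W) : V -> W :=
  foldr (fun u (g : V -> W) x => 'D_u g x) f s.

Definition smooth_on (R : realType) (V W : normedModType R)
    (U : set V) (f : V -> W) : Prop :=
  forall (s : seq V) (x : V), U x -> differentiable (iter_derive s f) x.

(* A smooth n-manifold.  The atlas is indexed by the points of M: chart p is a
   chart around p.  There is no loss of generality, since choosing for each
   point a chart of a given atlas yields such a family with the same maximal
   atlas.  chart p is meaningful on chart_dom p, and chart_inv p on its image. *)
Record manifold (R : realType) (n : nat) := Manifold {
  carrier :> topologicalType;
  chart_dom : carrier -> set carrier;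
  chart : carrier -> carrier -> 'rV[R]_n;
  chart_inv : carrier -> 'rV[R]_n -> carrier;
  manifold_hausdorff : hausdorff_space carrier;
  manifold_second_countable : @second_countable carrier;
  chart_dom_self : forall p, chart_dom p p;
  chart_dom_open : forall p, open (chart_dom p);
  chart_image_open : forall p, open (chart p @` chart_dom p);
  chartK : forall p q, chart_dom p q -> chart_inv p (chart p q) = q;
  chart_continuous : forall p q, chart_dom p q -> {for q, continuous (chart p)};
  chart_inv_continuous : forall p x, (chart p @` chart_dom p) x ->
    {for x, continuous (chart_inv p)};
  chart_transition : forall p q,
    smooth_on (chart p @` (chart_dom p `&` chart_dom q))
              (chart q \o chart_inv p)
}.

Section Manifolds.
Context {R : realType}.

(* T_pM is 'rV_n: a tangent vector at p is given by its coordinates in the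
   preferred chart p.  The vector of T_qM with coordinates u in the preferred
   chart at q has coordinates [tcoord a q u] in the chart a; conversely
   [tvec a q y] is the vector of T_qM with coordinates y in the chart a.  In
   particular, for e in T_pM, [tvec p ^~ e] is the local vector field extending
   e with constant coordinates in the chart p. *)
Definition tcoord n (M : manifold R n) (a q : M) (u : 'rV[R]_n) : 'rV[R]_n :=
  'D_u (chart a \o chart_inv q) (chart q q).

Definition tvec n (M : manifold R n) (a q : M) (y : 'rV[R]_n) : 'rV[R]_n :=
  'D_y (chart q \o chart_inv a) (chart a q).

(* Vector fields and functions may be local: they are total functions of which
   only the values on a given open set matter. *)
Definition vfield n (M : manifold R n) := M -> 'rV[R]_n.

(* Subsets of TM, functions on (subsets of) TM, and anisotropic vector fields
   are curried: they take a base point q, then a vector of T_qM. *)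
Definition tset n (M : manifold R n) := M -> set 'rV[R]_n.
Definition tfun n (M : manifold R n) := M -> 'rV[R]_n -> R.
Definition avfield n (M : manifold R n) := M -> 'rV[R]_n -> 'rV[R]_n.

Definition vfield_rep n (M : manifold R n) (a : M) (E : vfield M)
    (x : 'rV[R]_n) : 'rV[R]_n :=
  let q := chart_inv a x in tcoord a q (E q).

Definition smooth_fun n (M : manifold R n) (U : set M) (f : M -> R) : Prop :=
  forall a : M, smooth_on (chart a @` (chart_dom a `&` U)) (f \o chart_inv a).

Definition smooth_vfield n (M : manifold R n) (U : set M) (E : vfield M)
  : Prop :=
  forall a : M, smooth_on (chart a @` (chart_dom a `&` U)) (vfield_rep a E).

(* The chart of TM induced by the chart a, restricted to A and to U. *)
Definition tset_rep n (M : manifold R n) (A : tset M) (U : set M) (a : M)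
  : set ('rV[R]_n * 'rV[R]_n) :=
  [set z | (chart a @` (chart_dom a `&` U)) z.1 /\
           let q := chart_inv a z.1 in A q (tvec a q z.2)].

Definition open_tset n (M : manifold R n) (A : tset M) : Prop :=
  forall a : M, open (tset_rep A setT a).

Definition smooth_tfun n (M : manifold R n) (A : tset M) (f : tfun M) : Prop :=
  forall a : M, smooth_on (tset_rep A setT a)
    (fun z => let q := chart_inv a z.1 in f q (tvec a q z.2)).

Definition smooth_avfield n (M : manifold R n) (A : tset M) (U : set M)
    (X : avfield M) : Prop :=
  forall a : M, smooth_on (tset_rep A U a)
    (fun z => let q := chart_inv a z.1 in tcoord a q (X q (tvec a q z.2))).

Definition smooth_map m n (M : manifold R m) (B : manifold R n) (s : M -> B)
  : Prop :=
  continuous s /\ forall (a : M) (b : B),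
    smooth_on (chart a @` (chart_dom a `&` s @^-1` chart_dom b))
              (chart b \o s \o chart_inv a).

Definition tangent_map m n (M : manifold R m) (B : manifold R n) (s : M -> B)
    (p : M) (u : 'rV[R]_m) : 'rV[R]_n :=
  'D_u (chart (s p) \o s \o chart_inv p) (chart p p).

Definition vder n (M : manifold R n) (e : 'rV[R]_n) (f : M -> R) (p : M) : R :=
  'D_e (f \o chart_inv p) (chart p p).

Definition lie_bracket n (M : manifold R n) (E H : vfield M) : vfield M :=
  fun p => 'D_(E p) (vfield_rep p H) (chart p p)
         - 'D_(H p) (vfield_rep p E) (chart p p).

End Manifolds.

Section Finsler.
Context {R : realType} {n : nat} {M : manifold R n}.
Implicit Types (A : tset M) (L : tfun M) (p : M) (v e b h : 'rV[R]_n).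

Definition fund_tensor L p v e h : R :=
  2^-1 * derive1 (fun s : R =>
            derive1 (fun t : R => L p (v + s *: e + t *: h)) 0) 0.

Definition nondegenerate_on (W : set 'rV[R]_n)
    (g : 'rV[R]_n -> 'rV[R]_n -> R) : Prop :=
  forall e, W e -> (forall h, W h -> g e h = 0) -> e = 0.

Record pseudo_finsler A L : Prop := PseudoFinsler {
  adm_open : open_tset A;
  adm_neq0 : forall p v, A p v -> v != 0;
  adm_cone : forall p v (l : R), A p v -> 0 < l -> A p (l *: v);
  finsler_smooth : smooth_tfun A L;
  finsler_homogeneous : forall p v (l : R), A p v -> 0 < l ->
    L p (l *: v) = l ^+ 2 * L p v;
  finsler_nondegenerate : forall p v, A p v ->
    nondegenerate_on setT (fund_tensor L p v)
}.

(* [nabla E H p v] is nabla^v_E H.  Connections act on local vector fields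
   (smooth on some open set U); taking for f the indicator of a smaller open set
   in the Leibniz rule shows that nabla^v_E H only depends on the germ of H. *)
Record anisotropic_connection A (nabla : vfield M -> vfield M -> avfield M)
  : Prop := AnisotropicConnection {
  conn_smooth : forall (U : set M) (E H : vfield M), open U ->
    smooth_vfield U E -> smooth_vfield U H ->
    smooth_avfield A U (nabla E H);
  conn_addl : forall (U : set M) (E E' H : vfield M) p v, open U ->
    smooth_vfield U E -> smooth_vfield U E' -> smooth_vfield U H ->
    U p -> A p v ->
    nabla (fun q => E q + E' q) H p v = nabla E H p v + nabla E' H p v;
  conn_scalel : forall (U : set M) (f : M -> R) (E H : vfield M) p v, open U ->
    smooth_fun U f -> smooth_vfield U E -> smooth_vfield U H ->
    U p -> A p v ->
    nabla (fun q => f q *: E q) H p v = f p *: nabla E H p v;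
  conn_addr : forall (U : set M) (E H H' : vfield M) p v, open U ->
    smooth_vfield U E -> smooth_vfield U H -> smooth_vfield U H' ->
    U p -> A p v ->
    nabla E (fun q => H q + H' q) p v = nabla E H p v + nabla E H' p v;
  conn_leibniz : forall (U : set M) (f : M -> R) (E H : vfield M) p v, open U ->
    smooth_fun U f -> smooth_vfield U E -> smooth_vfield U H ->
    U p -> A p v ->
    nabla E (fun q => f q *: H q) p v =
      f p *: nabla E H p v + vder (E p) f p *: H p
}.

Section Calculus.
Variable nabla : vfield M -> vfield M -> avfield M.

(* The covariant derivatives of an anisotropic vector field and of a function
   on A, at v in T_pM, computed with the admissible local extension
   V = [tvec p ^~ v] of v.  All extensions of vectors below are taken of this
   form; the resulting tensors do not depend on that choice. *)
Definition cov (E : vfield M) (X : avfield M) : avfield M := fun p v =>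
  let V : vfield M := tvec p ^~ v in
  nabla E (fun q => X q (V q)) p v - 'D_(nabla E V p v) (X p) v.

Definition cov_fun (E : vfield M) (f : tfun M) : tfun M := fun p v =>
  let V : vfield M := tvec p ^~ v in
  vder (E p) (fun q => f q (V q)) p - 'D_(nabla E V p v) (f p) v.

(* (nabla_e g)_v(b, h) *)
Definition cov_metric L p v e b h : R :=
  let E : vfield M := tvec p ^~ e in
  let B : vfield M := tvec p ^~ b in
  let H : vfield M := tvec p ^~ h in
  cov_fun E (fun q w => fund_tensor L q w (B q) (H q)) p v
  - fund_tensor L p v (nabla E B p v) h
  - fund_tensor L p v b (nabla E H p v).

(* (nabla_h T)^v_b e, for an anisotropic tensor T^v_b e *)
Definition cov_tensor (T : M -> 'rV[R]_n -> 'rV[R]_n -> 'rV[R]_n -> 'rV[R]_n)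
    p v h b e : 'rV[R]_n :=
  let H : vfield M := tvec p ^~ h in
  let B : vfield M := tvec p ^~ b in
  let E : vfield M := tvec p ^~ e in
  cov H (fun q w => T q w (B q) (E q)) p v
  - T p v (nabla H B p v) e
  - T p v b (nabla H E p v).

Record levi_civita_chern A L : Prop := LeviCivitaChern {
  lc_connection : anisotropic_connection A nabla;
  lc_torsion_free : forall (U : set M) (E H : vfield M) p v, open U ->
    smooth_vfield U E -> smooth_vfield U H -> U p -> A p v ->
    nabla E H p v - nabla H E p v = lie_bracket E H p;
  lc_metric : forall p v e b h, A p v -> cov_metric L p v e b h = 0
}.

(* R_v(b, e)h *)
Definition curvature p v b e h : 'rV[R]_n :=
  let B : vfield M := tvec p ^~ b in
  let E : vfield M := tvec p ^~ e in
  let H : vfield M := tvec p ^~ h in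
  cov B (nabla E H) p v - cov E (nabla B H) p v
  - nabla (lie_bracket B E) H p v.

(* For Pr the pointwise projection onto the vertical (resp. g_v-horizontal)
   space, R^top_v(b, e)h (resp. R^bot_v(b, e)h). *)
Definition proj_curvature
    (Pr : M -> 'rV[R]_n -> 'rV[R]_n -> 'rV[R]_n) p v b e h : 'rV[R]_n :=
  let B : vfield M := tvec p ^~ b in
  let E : vfield M := tvec p ^~ e in
  let H : vfield M := tvec p ^~ h in
  let PH : avfield M := fun q w => Pr q w (H q) in
  Pr p v (cov B (fun q w => Pr q w (cov E PH q w)) p v
          - cov E (fun q w => Pr q w (cov B PH q w)) p v
          - cov (lie_bracket B E) PH p v).

End Calculus.

(* g_v(Rm_v(v, e)e, v) / (L(v) g_v(e, e) - g_v(v, e)^2) *)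
Definition flag_denom L p v e : R :=
  L p v * fund_tensor L p v e e - fund_tensor L p v v e ^+ 2.

Definition flag_curvature L
    (Rm : M -> 'rV[R]_n -> 'rV[R]_n -> 'rV[R]_n -> 'rV[R]_n -> 'rV[R]_n)
    p v e : R :=
  fund_tensor L p v (Rm p v v e e) v / flag_denom L p v e.

End Finsler.

Section Submersions.
Context {R : realType} {m n : nat} {M : manifold R m} {B : manifold R n}.
Implicit Types (p : M) (v e b h w : 'rV[R]_m).
Variable sigma : M -> B.

Definition vertical p : set 'rV[R]_m := [set w | tangent_map sigma p w = 0].

Definition g_horizontal (L : tfun M) p v : set 'rV[R]_m :=
  [set x | forall w, vertical p w -> fund_tensor L p v x w = 0].

(* The restriction of L to the admissible vectors tangent to the fibers inherits
   smoothness, homogeneity and the openness of its conic domain, and its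
   fundamental tensor at v is the restriction of g_v to the vertical space:
   [subm_fibers] is what remains of it being a pseudo-Finsler metric. *)
Record pseudo_finsler_submersion (A : tset M) (L : tfun M)
    (A' : tset B) (L' : tfun B) : Prop := PseudoFinslerSubmersion {
  subm_smooth : smooth_map sigma;
  subm_surj : forall y, exists p, sigma p = y;
  subm_dsurj : forall p (y : 'rV[R]_n), exists u, tangent_map sigma p u = y;
  subm_fibers : forall p v, A p v -> vertical p v ->
    nondegenerate_on (vertical p) (fund_tensor L p v);
  subm_metric : forall p v, A p v -> g_horizontal L p v v ->
    A' (sigma p) (tangent_map sigma p v) /\
    L p v = L' (sigma p) (tangent_map sigma p v)
}.

Section ONeill.
Variables (L : tfun M) (nabla : vfield M -> vfield M -> avfield M).

Definition vpart p v e : 'rV[R]_m :=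
  get [set w | vertical p w /\ g_horizontal L p v (e - w)].

Definition hpart p v e : 'rV[R]_m := e - vpart p v e.

(* chi^v_h e *)
Definition chi p v h e : 'rV[R]_m :=
  let H : vfield M := tvec p ^~ h in
  let E : vfield M := tvec p ^~ e in
  vpart p v (cov nabla H (fun q w => hpart q w (E q)) p v)
  + hpart p v (cov nabla H (fun q w => vpart q w (E q)) p v).

Definition oneillT p v b e : 'rV[R]_m := chi p v (vpart p v b) e.
Definition oneillA p v b e : 'rV[R]_m := chi p v (hpart p v b) e.

End ONeill.
End Submersions.

(* Main.v *)
Require Import Defs.
From HB Require Import structures.
From mathcomp Require Import all_boot all_order all_algebra.
From mathcomp Require Import all_classical all_reals all_analysis.
From mathcomp Require Import ring lra.

Set Implicit Arguments.
Unset Strict Implicit.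
Unset Printing Implicit Defensive.
Import Order.TTheory GRing.Theory Num.Theory.
Import numFieldNormedType.Exports.
Local Open Scope classical_set_scope.
Local Open Scope ring_scope.

(* The geometry is transported to the chart of TM induced by the chart at p,
   with row vectors as coordinates.  There nabla is given by matrices
   C = chr z e with (nabla_e h)_z = h *m C for fields e, h with constant
   coordinates, the covariant derivative of an anisotropic field F along e is
   dF(e, - y *m C) + F *m C, and the vertical projection is an explicit smooth
   matrix P.  Writing Q = 1 - P, the O'Neill tensor chi = T + A is
   (Q - P) (nabla P), so nabla is a connection preserving the splitting plus
   chi, and comparing curvatures gives
     R(b,e)h = R^top(b,e)h + R^bot(b,e)h + (nabla_b chi)_e h - (nabla_e chi)_b h
               - chi_b chi_e h + chi_e chi_b h.
   P is g-symmetric and nabla g = 0, so chi is g-skew, which turns the last two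
   terms into those of the statement.  Finally T_b = chi_(P b) gives
   (nabla_v T)_w w = (nabla_v chi)_w w + chi_(chi_v w) w for w vertical, and
   symmetrically for A and x horizontal.  R^bot vanishes on vertical vectors
   because these extend to vertical fields independent of the direction. *)

(** * Smooth maps *)

(** Formulas at p alone are not enough. At a point q the definitions use the preferred chart of q
    and extensions constant in that chart, and a curvature differentiates the result again, in q and
    in the direction. So each object is represented by one smooth function on an open part of the
    fixed chart of TM at p, valid at all nearby points and admissible directions. Passing from the
    chart at q to the chart at p creates derivatives of the coordinates of the extensions; they
    cancel between the two terms of a covariant derivative, or because [P *m Q = 0]. Matrices act on
    rows from the right, so composed operators appear in reversed order. The two flag curvature
    formulas are one identity with P and Q exchanged. They differ only because the vertical space is
    the same for all directions at a point while the horizontal space varies with the direction: a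
    vertical w extends to a field that is vertical in every direction, whereas a horizontal x need
    not extend to one horizontal in every direction, and so K^top_v(x) stays. *)

Section SmoothBasics.
Context {R : realType}.
Implicit Types V W : normedModType R.

Lemma near_eq_differentiable V W (f g : V -> W) x :
  (\near x, f x = g x) -> differentiable f x -> differentiable g x.
Proof.
move=> fg /diff_locallyP[dc df].
have fgx : f x = g x by exact: (nbhs_singleton fg).
have E : g \o shift x = cst (g x) + 'd f x +o_ 0 id.
  apply/eqaddoP => e e0; have /eqaddoP/(_ _ e0) := df.
  apply: filter_app.
  have : \forall h \near 0, f (h + x) = g (h + x).
    by move: fg; rewrite (near_shift 0) /=; apply: filterS => h /=; rewrite subr0.
  by apply: filterS => h /= E1; rewrite !fctE /= E1 fgx.
have H : 'd g x = 'd f x :> (V -> W) by exact: diff_unique.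
by apply/diff_locallyP; rewrite H.
Qed.

Lemma iter_derive_rcons V W s u (f : V -> W) :
  iter_derive (rcons s u) f = iter_derive s ('D_u f).
Proof. by rewrite /iter_derive -cats1 foldr_cat. Qed.

Lemma eq_on_near V W (U : set V) (f g : V -> W) x : open U -> U x ->
  {in U, f =1 g} -> \near x, f x = g x.
Proof.
move=> oU Ux fg; have : nbhs x U by exact: open_nbhs_nbhs.
by apply: filterS => y Uy; apply: fg; rewrite inE.
Qed.

Lemma eq_on_derive V W (U : set V) (f g : V -> W) u : open U ->
  {in U, f =1 g} -> {in U, 'D_u f =1 'D_u g}.
Proof.
move=> oU fg x; rewrite inE => Ux.
exact/near_eq_derive/(eq_on_near oU Ux fg).
Qed.

Lemma eq_on_iter_derive V W (U : set V) (f g : V -> W) s : open U ->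
  {in U, f =1 g} -> {in U, iter_derive s f =1 iter_derive s g}.
Proof. by move=> oU fg; elim: s => // u s IH; exact: eq_on_derive. Qed.

Lemma smooth_on_differentiable V W (U : set V) (f : V -> W) x :
  smooth_on U f -> U x -> differentiable f x.
Proof. exact (fun sf Ux => sf [::] x Ux). Qed.

Lemma smooth_on_derivable V W (U : set V) (f : V -> W) x u :
  smooth_on U f -> U x -> derivable f x u.
Proof. by move=> sf Ux; exact/diff_derivable/(smooth_on_differentiable sf). Qed.

Lemma smooth_on_derive V W (U : set V) (f : V -> W) u :
  smooth_on U f -> smooth_on U ('D_u f).
Proof. by move=> sf s x Ux; rewrite -iter_derive_rcons; exact: sf. Qed.

Lemma smooth_on_subset V W (U U' : set V) (f : V -> W) :
  U `<=` U' -> smooth_on U' f -> smooth_on U f.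
Proof. by move=> UU sf s x /UU; exact: sf. Qed.

Lemma eq_smooth_on V W (U : set V) (f g : V -> W) : open U ->
  {in U, f =1 g} -> smooth_on U f -> smooth_on U g.
Proof.
move=> oU fg sf s x Ux; have H := eq_on_near oU Ux (eq_on_iter_derive s oU fg).
exact: near_eq_differentiable H (sf s x Ux).
Qed.

(** A class closed under directional derivatives consists of smooth functions; closure is asked only
    up to equality on U, since formulas for derivatives fail elsewhere. The induction removes the
    last direction of [s], the one differentiated first, so that the closure property applies to [f]
    itself. *)
Lemma smooth_on_coind V W (U : set V) (P : (V -> W) -> Prop) : open U ->
  (forall f, P f -> (forall x, U x -> differentiable f x) /\
     forall u, exists2 g, P g & {in U, 'D_u f =1 g}) ->
  forall f, P f -> smooth_on U f.
Proof.
move=> oU H f Pf s; elim/last_ind: s f Pf => [|s u IH] f Pf x Ux.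
  by have [+ _] := H f Pf; exact.
have [_ /(_ u)[g Pg fg]] := H f Pf.
have gf : {in U, g =1 'D_u f} by move=> y /fg.
rewrite iter_derive_rcons.
exact: near_eq_differentiable (eq_on_near oU Ux (eq_on_iter_derive s oU gf))
  (IH g Pg x Ux).
Qed.

Lemma differentiable_fD V W (f g : V -> W) x : differentiable f x ->
  differentiable g x -> differentiable (fun y => f y + g y) x.
Proof. exact: differentiableD. Qed.

Lemma smooth_on_cst V W (U : set V) (c : W) : open U ->
  smooth_on U (fun _ : V => c).
Proof.
move=> oU; apply: (@smooth_on_coind _ _ _ (fun f => exists c, f = fun=> c)) => //.
  move=> _ [{}c ->]; split=> [x _|u]; first exact: differentiable_cst.
  by exists (fun=> 0); [exists 0|move=> x _; exact: derive_cst].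
by exists c.
Qed.

Lemma smooth_on_add V W (U : set V) (f g : V -> W) : open U ->
  smooth_on U f -> smooth_on U g -> smooth_on U (fun x => f x + g x).
Proof.
move=> oU sf sg; apply: (@smooth_on_coind _ _ _ (fun h => exists f g,
  [/\ smooth_on U f, smooth_on U g & h = fun x => f x + g x])) => //.
  move=> _ [{sf}f [{sg}g [sf sg ->]]]; split=> [x Ux|u].
    by apply: differentiable_fD; apply: smooth_on_differentiable Ux.
  exists (fun x => 'D_u f x + 'D_u g x).
    by exists ('D_u f), ('D_u g); split=> //; apply: smooth_on_derive.
  move=> x; rewrite inE => Ux; rewrite -[X in derive X]/(f + g).
  by rewrite deriveD//; apply: smooth_on_derivable Ux.
by exists f, g.
Qed.

Lemma smooth_on_sum V W (U : set V) I (r : seq I) (f : I -> V -> W) : open U ->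
  (forall i, smooth_on U (f i)) -> smooth_on U (fun x => \sum_(i <- r) f i x).
Proof.
move=> oU sf; elim: r => [|i r IH].
  by under eq_fun do rewrite big_nil; exact: smooth_on_cst.
by under eq_fun do rewrite big_cons; exact: smooth_on_add.
Qed.

Lemma derive_linear_comp V W W' (l : {linear W -> W'}) (f : V -> W) x u :
  continuous l -> differentiable f x ->
  'D_u (fun y => l (f y)) x = l ('D_u f x).
Proof.
move=> cl df; have dl : differentiable l (f x) by exact: linear_differentiable.
rewrite -[X in derive X]/(l \o f) deriveE; last exact: differentiable_comp.
by rewrite diff_comp //= diff_lin // deriveE.
Qed.

Lemma smooth_on_linear_comp V W W' (U : set V) (l : {linear W -> W'})
    (f : V -> W) : open U -> continuous l ->
  smooth_on U f -> smooth_on U (fun x => l (f x)).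
Proof.
move=> oU cl sf; apply: (@smooth_on_coind _ _ _ (fun h =>
  exists2 f, smooth_on U f & h = fun x => l (f x))) => //.
  move=> _ [{sf}f sf ->]; split=> [x Ux|u].
    apply: (@differentiable_comp _ _ _ _ f l).
      exact: smooth_on_differentiable Ux.
    exact: linear_differentiable.
  exists (fun x => l ('D_u f x)).
    by exists ('D_u f) => //; exact: smooth_on_derive.
  move=> x; rewrite inE => Ux; apply: derive_linear_comp => //.
  exact: smooth_on_differentiable Ux.
by exists f.
Qed.

Lemma derive_pair V W W' (f : V -> W) (g : V -> W') x u :
  differentiable f x -> differentiable g x ->
  'D_u (fun y => (f y, g y)) x = ('D_u f x, 'D_u g x).
Proof.
move=> df dg; rewrite deriveE; last exact: differentiable_pair.
by rewrite diff_pair // !deriveE.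
Qed.

Lemma smooth_on_pair V W W' (U : set V) (f : V -> W) (g : V -> W') : open U ->
  smooth_on U f -> smooth_on U g -> smooth_on U (fun x => (f x, g x)).
Proof.
move=> oU sf sg; apply: (@smooth_on_coind _ _ _ (fun h => exists f g,
  [/\ smooth_on U f, smooth_on U g & h = fun x => (f x, g x)])) => //.
  move=> _ [{sf}f [{sg}g [sf sg ->]]]; split=> [x Ux|u].
    by apply: differentiable_pair; apply: smooth_on_differentiable Ux.
  exists (fun x => ('D_u f x, 'D_u g x)).
    by exists ('D_u f), ('D_u g); split=> //; apply: smooth_on_derive.
  move=> x; rewrite inE => Ux.
  by apply: derive_pair; apply: smooth_on_differentiable Ux.
by exists f, g.
Qed.

Lemma smooth_on_id V (U : set V) : open U -> smooth_on U (fun x : V => x).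
Proof.
move=> oU; apply: (@smooth_on_coind _ _ _ (fun h => h = (fun x => x) \/
   exists c, h = fun=> c)); [by []| |by left].
move=> h [->|[c ->]]; split=> [x Ux|u].
- exact: ex_diff.
- exists (fun=> u); first by right; exists u.
  by move=> x _; exact: derive_id.
- exact: differentiable_cst.
- by exists (fun=> 0); [right; exists 0|move=> x _; exact: derive_cst].
Qed.

(** By the chain rule, the derivative of f o g takes f in a direction that moves with the point,
    whereas [smooth_on] only allows fixed directions. Finitely many coordinates turn it into a
    combination of the derivatives of f along the fixed [b i], with smooth coefficients. *)
Definition finite_coordinates V := exists (I : finType) (b : I -> V)
  (c : I -> {linear V -> R}),
  (forall i, continuous (c i)) /\ forall v, v = \sum_i c i v *: b i.

End SmoothBasics.

(** * Real-valued smooth functions: products, inverses and compositions *)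

Section SmoothScalar.
Context {R : realType}.
Implicit Types V W : normedModType R.

(* The partial derivatives of a function of this class are again in the class,
   so smoothness of all its members follows at once by [smooth_on_coind]. *)
Inductive smooth_alg V (U : set V) : (V -> R) -> Prop :=
| SmoothBase f : smooth_on U f -> smooth_alg U f
| SmoothAdd f g : smooth_alg U f -> smooth_alg U g ->
    smooth_alg U (fun x => f x + g x)
| SmoothMul f g : smooth_alg U f -> smooth_alg U g ->
    smooth_alg U (fun x => f x * g x)
| SmoothInv f : smooth_alg U f -> (forall x, U x -> f x != 0) ->
    smooth_alg U (fun x => (f x)^-1)
| SmoothComp V' (U' : set V') (f : V' -> R) (g : V -> V') :
    finite_coordinates V' -> smooth_on U' f -> smooth_on U g ->
    (forall x, U x -> U' (g x)) -> smooth_alg U (fun x => f (g x)).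

Lemma derive_comp V V' W (f : V' -> W) (g : V -> V') x u :
  differentiable g x -> differentiable f (g x) ->
  'D_u (fun y => f (g y)) x = 'D_('D_u g x) f (g x).
Proof.
move=> dg df; rewrite -[X in derive X]/(f \o g).
rewrite deriveE; last exact: differentiable_comp.
by rewrite diff_comp //= !deriveE.
Qed.

Lemma smooth_alg_sum V (U : set V) I (r : seq I) (f : I -> V -> R) : open U ->
  (forall i, smooth_alg U (f i)) -> smooth_alg U (fun x => \sum_(i <- r) f i x).
Proof.
move=> oU sf; elim: r => [|i r IH].
  under eq_fun do rewrite big_nil.
  by apply: SmoothBase; exact: smooth_on_cst.
by under eq_fun do rewrite big_cons; exact: SmoothAdd.
Qed.

Lemma deriveE_sum V W (f : V -> W) x I (r : seq I) (c : I -> R) (b : I -> V) :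
  differentiable f x ->
  'D_(\sum_(i <- r) c i *: b i) f x = \sum_(i <- r) c i *: 'D_(b i) f x.
Proof.
move=> df; rewrite deriveE // linear_sum; apply: eq_bigr => i _.
by rewrite linearZ deriveE.
Qed.

Lemma smooth_alg_diff V (U : set V) f x : smooth_alg U f -> U x ->
  differentiable f x.
Proof.
move=> sf Ux; elim: sf => {f}.
- by move=> f sf; exact: smooth_on_differentiable Ux.
- by move=> f g _ df _ dg; exact: differentiable_fD.
- by move=> f g _ df _ dg; exact: differentiableM.
- by move=> f _ df f0; apply: differentiableV => //; exact: f0.
- move=> V' U' f g _ sf sg gU; apply: (@differentiable_comp _ _ _ _ g f).
    exact: smooth_on_differentiable Ux.
  by apply: smooth_on_differentiable sf _; exact: gU.
Qed.

Lemma smooth_alg_derive V (U : set V) f u : open U -> smooth_alg U f ->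
  exists2 g, smooth_alg U g & {in U, 'D_u f =1 g}.
Proof.
move=> oU; elim=> {f}.
- move=> f sf; exists ('D_u f) => //.
  by apply: SmoothBase; exact: smooth_on_derive.
- move=> f g sf [f' sf' ff'] sg [g' sg' gg'].
  exists (fun x => f' x + g' x); first exact: SmoothAdd.
  move=> x Ux; rewrite -ff' // -gg' // -[X in derive X]/(f + g).
  rewrite inE in Ux.
  by rewrite deriveD //; apply: diff_derivable; apply: smooth_alg_diff Ux.
- move=> f g sf [f' sf' ff'] sg [g' sg' gg'].
  exists (fun x => f x * g' x + g x * f' x).
    by apply: SmoothAdd; apply: SmoothMul.
  move=> x Ux; rewrite -ff' // -gg' // -[X in derive X]/(f * g).
  rewrite inE in Ux.
  by rewrite deriveM //; apply: diff_derivable; apply: smooth_alg_diff Ux.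
- move=> f sf [f' sf' ff'] f0.
  exists (fun x => (-1) * ((f x)^-1 * ((f x)^-1 * f' x))).
    apply: SmoothMul; first by apply: SmoothBase; exact: smooth_on_cst.
    by do 2! [apply: SmoothMul; first exact: SmoothInv].
  move=> x Ux; rewrite -ff' //; rewrite inE in Ux.
  rewrite deriveV //; [|exact: f0|]; last first.
    by apply: diff_derivable; apply: smooth_alg_diff Ux.
  rewrite -[LHS]/((- (f x) ^- 2) * 'D_u f x) expr2 invfM.
  by rewrite mulN1r mulNr mulrA.
- move=> V' U' f g fV sf sg gU; have [I [b [c [cc cb]]]] := fV.
  exists (fun x => \sum_i c i ('D_u g x) * 'D_(b i) f (g x)).
    apply: smooth_alg_sum => // i; apply: SmoothMul.
      apply: SmoothBase; apply: smooth_on_linear_comp => //.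
      exact: smooth_on_derive.
    exact: (SmoothComp fV (smooth_on_derive (b i) sf) sg gU).
  move=> x; rewrite inE => Ux.
  have df : differentiable f (g x).
    by apply: smooth_on_differentiable sf _; exact: gU.
  rewrite (derive_comp (f := f) (g := g)) //.
    2: exact: smooth_on_differentiable Ux.
  by rewrite {1}(cb (derive g x u)) deriveE_sum.
Qed.

Lemma smooth_algP V (U : set V) f : open U -> smooth_alg U f -> smooth_on U f.
Proof.
move=> oU; apply: smooth_on_coind => // {}f sf; split=> [x Ux|u].
  exact: smooth_alg_diff Ux.
exact: smooth_alg_derive.
Qed.

Lemma smooth_on_mul V (U : set V) (f g : V -> R) : open U ->
  smooth_on U f -> smooth_on U g -> smooth_on U (fun x => f x * g x).
Proof.
by move=> oU sf sg; apply: smooth_algP => //; apply: SmoothMul; apply: SmoothBase.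
Qed.

Lemma smooth_on_inv V (U : set V) (f : V -> R) : open U ->
  (forall x, U x -> f x != 0) -> smooth_on U f -> smooth_on U (fun x => (f x)^-1).
Proof.
by move=> oU f0 sf; apply: smooth_algP => //; apply: SmoothInv => //; apply: SmoothBase.
Qed.

Lemma smooth_on_prod V (U : set V) I (r : seq I) (f : I -> V -> R) : open U ->
  (forall i, smooth_on U (f i)) -> smooth_on U (fun x => \prod_(i <- r) f i x).
Proof.
move=> oU sf; elim: r => [|i r IH].
  by under eq_fun do rewrite big_nil; exact: smooth_on_cst.
by under eq_fun do rewrite big_cons; exact: smooth_on_mul.
Qed.

Section Matrices.
Variables k l : nat.

Lemma derive_mxE V (F : V -> 'M[R]_(k, l)) x u i j :
  differentiable F x -> ('D_u F x) i j = 'D_u (fun y => F y i j) x.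
Proof. by move=> dF; rewrite derive_mx ?mxE //; exact: diff_derivable. Qed.

Definition mxcoord (i : 'I_k) (j : 'I_l) (A : 'M[R]_(k, l)) : R := A i j.

Lemma mxcoord_linear i j : linear (mxcoord i j).
Proof. by move=> a A B; rewrite /mxcoord !mxE. Qed.

HB.instance Definition _ i j := GRing.isLinear.Build R 'M[R]_(k, l) R _
  (mxcoord i j) (mxcoord_linear i j).

Lemma mxcoord_continuous i j : continuous (mxcoord i j).
Proof. exact: coord_continuous. Qed.

Lemma finite_coordinates_mx : finite_coordinates 'M[R]_(k, l).
Proof.
exists ('I_k * 'I_l)%type, (fun ij => delta_mx ij.1 ij.2),
  (fun ij => mxcoord ij.1 ij.2); split=> [i|A].
  exact: mxcoord_continuous.
by rewrite {1}(matrix_sum_delta A) pair_big.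
Qed.

Lemma smooth_on_mxE V (U : set V) (F : V -> 'M[R]_(k, l)) i j : open U ->
  smooth_on U F -> smooth_on U (fun x => F x i j).
Proof.
by move=> oU sF; apply: (smooth_on_linear_comp oU (@mxcoord_continuous i j) sF).
Qed.

Lemma smooth_onZl V W (U : set V) (f : V -> R) (w : W) : open U ->
  smooth_on U f -> smooth_on U (fun x => f x *: w).
Proof.
move=> oU sf; apply: (@smooth_on_coind _ V W U (fun h =>
  exists2 f : V -> R, smooth_on U f & h = fun x => f x *: w)) => //; last first.
  by exists f.
move=> _ [{sf}f sf ->]; split=> [x Ux|u].
  by apply: differentiableZl; apply: smooth_on_differentiable Ux.
exists (fun x => 'D_u f x *: w).
  by exists ('D_u f) => //; exact: smooth_on_derive.
move=> x; rewrite inE => Ux.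
have df : differentiable f x by exact: smooth_on_differentiable Ux.
by rewrite deriveE; [rewrite diffZl // deriveE|exact: differentiableZl].
Qed.

Lemma smooth_on_mx V (U : set V) (F : V -> 'M[R]_(k, l)) : open U ->
  (forall i j, smooth_on U (fun x => F x i j)) -> smooth_on U F.
Proof.
move=> oU sF; under [F]eq_fun do rewrite [F _]matrix_sum_delta.
apply: smooth_on_sum => // i; apply: smooth_on_sum => // j.
exact: smooth_onZl.
Qed.

End Matrices.
End SmoothScalar.

Section Projections.
Context {R : realType}.
Implicit Types V W : normedModType R.

Lemma continuous_fst V W : continuous (fst : V * W -> V).
Proof. by move=> x; exact: cvg_fst. Qed.

Lemma continuous_snd V W : continuous (snd : V * W -> W).
Proof. by move=> x; exact: cvg_snd. Qed.

Lemma differentiable_fst V W (z : V * W) : differentiable (fst : V * W -> V) z.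
Proof. exact: (linear_differentiable _ (@continuous_fst V W)). Qed.

End Projections.

(** * Symmetry of second derivatives *)

Section Schwarz.
Context {R : realType} {V : normedModType R}.

Lemma is_derive_line (W : normedModType R) (f : V -> W) (u w : V) (s : R) :
  differentiable f (w + s *: u) ->
  is_derive s 1 (fun s => f (w + s *: u)) (derive f (w + s *: u) u).
Proof.
move=> df; have dl : differentiable (fun s : R => w + s *: u) s.
  by apply: differentiable_fD; [exact: differentiable_cst|exact: differentiableZl].
split.
  apply: diff_derivable.
  exact: (@differentiable_comp _ _ _ _ (fun s : R => w + s *: u) f).
rewrite (derive_comp (f := f) (g := fun s : R => w + s *: u)) //; congr (derive f _ _).
rewrite -[X in derive X]/(cst w + ( *:%R^~ u)).
have ds : is_diff s ( *:%R^~ u : R -> V) ( *:%R^~ u) by exact: is_diff_scalel.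
rewrite deriveD; [|exact: derivable_cst|by apply: diff_derivable].
by rewrite derive_cst add0r deriveE // diff_val scale1r.
Qed.

Lemma nbhs_plane (A : set V) (x u v : V) : nbhs x A ->
  exists2 d : R, 0 < d &
    forall s t, `|s| < d -> `|t| < d -> A (x + s *: u + t *: v).
Proof.
(* The summand 1 keeps [c] positive when u = v = 0 and makes the final bound strict. *)
move=> /nbhs_normP[r /= r0 rA]; set c := `|u| + `|v| + 1.
have c0 : 0 < c by rewrite ltr_wpDl // addr_ge0.
exists (r / c); first by rewrite divr_gt0.
move=> s t sd td; apply: rA; rewrite /ball_ /= -addrA opprD addNKr.
rewrite normrN; apply: le_lt_trans (ler_normD _ _) _; rewrite !normrZ.
apply: (@le_lt_trans _ _ (r / c * (`|u| + `|v|))).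
  by rewrite mulrDr lerD // ler_wpM2r // ltW.
rewrite -[ltRHS](divfK (lt0r_neq0 c0)) ltr_pM2l ?divr_gt0 //.
by rewrite ltrDl.
Qed.

(* By the mean value theorem applied in each variable; the quotient is symmetric
   in u and v, which gives [derive_schwarz]. *)
Lemma second_difference (U : set V) (f : V -> R) (x u v : V) (e : R) :
  open U -> smooth_on U f -> U x -> 0 < e ->
  exists2 d : R, 0 < d & forall h, 0 < h -> h < d ->
    `|(f (x + h *: u + h *: v) - f (x + h *: u) - f (x + h *: v) + f x) / h ^+ 2
      - 'D_v ('D_u f) x| < e.
Proof.
move=> oU sf Ux e0; set g := 'D_v ('D_u f).
have cg : {for x, continuous g}.
  apply: differentiable_continuous; apply: smooth_on_differentiable Ux.
  by do 2! apply: smooth_on_derive.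
have nA : nbhs x [set y | U y /\ `|g y - g x| < e].
  apply: filterI; first exact: open_nbhs_nbhs.
  have nB : nbhs (g x) [set r | `|r - g x| < e].
    have := nbhsx_ballx (g x) e e0; apply: filterS => r.
    by rewrite /ball /= distrC.
  exact: (cg _ nB).
have [d d0 dA] := nbhs_plane u v nA.
exists d => // h h0 hd.
have A s t : 0 <= s <= h -> 0 <= t <= h -> U (x + s *: u + t *: v) /\
    `|g (x + s *: u + t *: v) - g x| < e.
  move=> /andP[s0 sh] /andP[t0 th]; by apply: dA; rewrite ger0_norm // (le_lt_trans _ hd).
have hh : 0 <= h <= h by rewrite ltW //=.
have h00 : 0 <= (0 : R) <= h by rewrite lexx ltW.
(* The increment of [phi] over [0, h] is the second difference; [phi' c] is in turn the increment
   over [0, h] of [psi], whose derivative is [g]. *)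
pose phi s := f (x + h *: v + s *: u) - f (x + s *: u).
pose phi' s := derive f (x + h *: v + s *: u) u - derive f (x + s *: u) u.
have dphi s : 0 <= s <= h -> is_derive s 1 phi (phi' s).
  move=> sh; apply: is_deriveB; apply: is_derive_line.
    rewrite addrAC; apply: smooth_on_differentiable sf _.
    by have [] := A _ _ sh hh.
  apply: smooth_on_differentiable sf _.
  by have [] := A _ _ sh h00; rewrite scale0r addr0.
have cphi : {within `[0, h], continuous phi}.
  apply: derivable_within_continuous => s; rewrite in_itv /= => sh.
  by have [] := dphi _ sh.
have [|c ch Ec] := @MVT _ phi phi' 0 h h0 _ cphi.
  by move=> s; rewrite in_itv /= => /andP[s0 sh]; apply: dphi; rewrite !ltW.
have c0h : 0 <= c <= h by move: ch; rewrite in_itv /= => /andP[? ?]; rewrite !ltW.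
pose psi t := derive f (x + c *: u + t *: v) u.
have dpsi t : 0 <= t <= h -> is_derive t 1 psi (g (x + c *: u + t *: v)).
  move=> th; apply: (@is_derive_line _ (fun y => derive f y u)).
  apply: (smooth_on_differentiable (smooth_on_derive u sf)).
  by have [] := A _ _ c0h th.
have cpsi : {within `[0, h], continuous psi}.
  apply: derivable_within_continuous => s; rewrite in_itv /= => sh.
  by have [] := dpsi _ sh.
have [|b bh Eb] :=
  @MVT _ psi (fun t => g (x + c *: u + t *: v)) 0 h h0 _ cpsi.
  by move=> s; rewrite in_itv /= => /andP[s0 sh]; apply: dpsi; rewrite !ltW.
have b0h : 0 <= b <= h by move: bh; rewrite in_itv /= => /andP[? ?]; rewrite !ltW.
have [_] := A _ _ c0h b0h.
suff -> : g (x + c *: u + b *: v) = (f (x + h *: u + h *: v) - f (x + h *: u)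
    - f (x + h *: v) + f x) / h ^+ 2 by [].
have hn0 : h != 0 by rewrite gt_eqF.
apply: (@mulIf _ (h ^+ 2)); first by rewrite expf_neq0.
rewrite divfK ?expf_neq0 // expr2 mulrA.
rewrite subr0 in Eb; rewrite -Eb.
rewrite subr0 in Ec; rewrite /psi scale0r addr0.
rewrite [x + c *: u + h *: v]addrAC -Ec /phi !scale0r !addr0.
by rewrite [x + h *: v + _]addrAC; ring.
Qed.

Lemma dist_le_halves (a b c e : R) :
  `|a - b| < e / 2 -> `|a - c| < e / 2 -> `|b - c| <= e.
Proof.
move=> H1 H2; have -> : b - c = (a - c) - (a - b) by ring.
by rewrite (le_trans (ler_normB _ _)) // [e]splitr ltW // ltrD.
Qed.

Lemma derive_schwarz (U : set V) (f : V -> R) (x u v : V) :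
  open U -> smooth_on U f -> U x -> 'D_v ('D_u f) x = 'D_u ('D_v f) x.
Proof.
move=> oU sf Ux; apply/eqP; rewrite -subr_eq0 -normr_le0.
apply/ler_addgt0Pr => e e0; rewrite add0r.
have e20 : 0 < e / 2 by rewrite divr_gt0.
have [d d0 Hd] := second_difference u v oU sf Ux e20.
have [d' d0' Hd'] := second_difference v u oU sf Ux e20.
pose h := Num.min d d' / 2.
have m0 : 0 < Num.min d d' by rewrite lt_min d0.
have h0 : 0 < h by rewrite divr_gt0.
have hm : h < Num.min d d' by rewrite /h ltr_pdivrMr // ltr_pMr // ltr1n.
have {Hd} := Hd h h0 (lt_le_trans hm _); rewrite ge_min lexx => /(_ isT) H1.
have {Hd'} := Hd' h h0 (lt_le_trans hm _).
rewrite ge_min lexx orbT => /(_ isT).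
rewrite [x + h *: v + _]addrAC [_ - f (x + h *: v) - _]addrAC => H2.
exact: dist_le_halves H1 H2.
Qed.

End Schwarz.

(** * Smooth matrix-valued functions and their product rules *)

Section SmoothMatrices.
Context {R : realType}.
Implicit Types V W : normedModType R.

Lemma finite_coordinates_pair V W :
  finite_coordinates V -> finite_coordinates W -> finite_coordinates (V * W)%type.
Proof.
move=> [I [b [c [cc cb]]]] [J [b' [c' [cc' cb']]]].
exists (I + J)%type, (fun k => match k with inl i => (b i, 0) | inr j => (0, b' j) end).
exists (fun k => match k return {linear (V * W)%type -> R} with
  | inl i => c i \o fst | inr j => c' j \o snd end).
split=> [[i|j] z|[v w]] /=.
- by apply: (@continuous_comp _ _ _ fst (c i)); [exact: continuous_fst|exact: cc].
- by apply: (@continuous_comp _ _ _ snd (c' j)); [exact: continuous_snd|exact: cc'].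
rewrite big_sumType /=.
apply: injective_projections.
  rewrite [RHS](raddfD (fst : {linear (V * W)%type -> V})).
  rewrite !(raddf_sum (fst : {linear (V * W)%type -> V})) /= {1}[v]cb.
  by rewrite [X in _ + X]big1 ?addr0 // => j _; rewrite scaler0.
rewrite [RHS](raddfD (snd : {linear (V * W)%type -> W})).
rewrite !(raddf_sum (snd : {linear (V * W)%type -> W})) /= {1}[w]cb'.
by rewrite [X in X + _]big1 ?add0r // => j _; rewrite scaler0.
Qed.

Lemma smooth_on_comp V V' (U : set V) (U' : set V') k l
    (F : V' -> 'M[R]_(k, l)) (g : V -> V') :
  finite_coordinates V' -> open U -> open U' -> smooth_on U' F -> smooth_on U g ->
  (forall x, U x -> U' (g x)) -> smooth_on U (fun x => F (g x)).
Proof.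
move=> fV oU oU' sF sg gU; apply: smooth_on_mx => // i j; apply: smooth_algP => //.
exact: (SmoothComp (f := fun x => F x i j) fV (smooth_on_mxE i j oU' sF) sg gU).
Qed.

Lemma smooth_on_scale V (U : set V) k l (f : V -> R) (F : V -> 'M[R]_(k, l)) :
  open U -> smooth_on U f -> smooth_on U F -> smooth_on U (fun x => f x *: F x).
Proof.
move=> oU sf sF; apply: smooth_on_mx => // i j.
under eq_fun do rewrite mxE; apply: smooth_on_mul => //; exact: smooth_on_mxE.
Qed.

Lemma smooth_on_mulmx V (U : set V) k l r (F : V -> 'M[R]_(k, l))
    (G : V -> 'M[R]_(l, r)) :
  open U -> smooth_on U F -> smooth_on U G -> smooth_on U (fun x => F x *m G x).
Proof.
move=> oU sF sG; apply: smooth_on_mx => // i j.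
under eq_fun do rewrite mxE; apply: smooth_on_sum => // t.
by apply: smooth_on_mul => //; exact: smooth_on_mxE.
Qed.

Lemma smooth_on_opp V W (U : set V) (f : V -> W) :
  open U -> smooth_on U f -> smooth_on U (fun x => - f x).
Proof.
move=> oU sf; pose l : {linear W -> W} := -%R.
by apply: (@smooth_on_linear_comp _ _ _ _ _ l) => // x; exact: opp_continuous.
Qed.

Lemma smooth_on_sub V W (U : set V) (f g : V -> W) :
  open U -> smooth_on U f -> smooth_on U g -> smooth_on U (fun x => f x - g x).
Proof. by move=> oU sf sg; apply: smooth_on_add => //; exact: smooth_on_opp. Qed.

Lemma smooth_on_tr V (U : set V) k l (F : V -> 'M[R]_(k, l)) :
  open U -> smooth_on U F -> smooth_on U (fun x => (F x)^T).
Proof.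
move=> oU sF; apply: smooth_on_mx => // i j.
under eq_fun do rewrite mxE; exact: smooth_on_mxE.
Qed.

Lemma smooth_on_det V (U : set V) k (F : V -> 'M[R]_k) :
  open U -> smooth_on U F -> smooth_on U (fun x => \det (F x)).
Proof.
move=> oU sF; rewrite /determinant; apply: smooth_on_sum => // s.
apply: smooth_on_mul => //; first exact: smooth_on_cst.
by apply: smooth_on_prod => // i; exact: smooth_on_mxE.
Qed.

(** Cramer's rule: on invertible matrices [invmx] is the adjugate divided by the determinant.
    Elsewhere it takes a default value, so the two functions are compared on U only. *)
Lemma smooth_on_invmx V (U : set V) k (F : V -> 'M[R]_k) :
  open U -> (forall x, U x -> F x \in unitmx) ->
  smooth_on U F -> smooth_on U (fun x => invmx (F x)).
Proof.
move=> oU uF sF; apply: (@eq_smooth_on _ _ _ _ (fun x => (\det (F x))^-1 *: \adj (F x))) => //.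
  by move=> x; rewrite inE => Ux; rewrite /invmx uF.
apply: smooth_on_scale => //.
  apply: smooth_on_inv => //; last exact: smooth_on_det.
  by move=> x Ux; have := uF x Ux; rewrite unitmxE unitfE.
apply: smooth_on_mx => // i j; under eq_fun do rewrite mxE /cofactor.
apply: smooth_on_mul => //; first exact: smooth_on_cst.
apply: smooth_on_det => //; apply: smooth_on_mx => // s t.
under eq_fun do rewrite !mxE; exact: smooth_on_mxE.
Qed.

(** Needed because covariant derivatives differentiate along horizontal lifts, which vary with the
    point; the direction is expanded in coordinates. *)
Lemma smooth_on_derive_along V (U : set V) k l (F : V -> 'M[R]_(k, l)) (h : V -> V) :
  finite_coordinates V -> open U -> smooth_on U F -> smooth_on U h ->
  smooth_on U (fun x => derive F x (h x)).
Proof.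
move=> [I [b [c [cc cb]]]] oU sF sh.
apply: (@eq_smooth_on _ _ _ _ (fun x => \sum_i c i (h x) *: derive F x (b i))) => //.
  move=> x; rewrite inE => Ux; rewrite [in RHS](cb (h x)) deriveE_sum //.
  exact: smooth_on_differentiable Ux.
apply: smooth_on_sum => // i; apply: smooth_on_scale => //.
  exact: smooth_on_linear_comp.
exact: smooth_on_derive.
Qed.

Lemma derive_schwarz_mx V (U : set V) k l (F : V -> 'M[R]_(k, l)) x u v :
  open U -> smooth_on U F -> U x -> 'D_v ('D_u F) x = 'D_u ('D_v F) x.
Proof.
move=> oU sF Ux; apply/matrixP => i j.
have aux w w' : (derive (fun y => derive F y w) x w') i j =
    derive (fun y => derive (fun y => F y i j) y w) x w'.
  rewrite derive_mxE; last exact: (smooth_on_differentiable (smooth_on_derive w sF)).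
  apply: near_eq_derive; apply: (eq_on_near oU Ux) => y; rewrite inE => Uy.
  by rewrite derive_mxE //; exact: smooth_on_differentiable Uy.
rewrite [LHS]aux [RHS]aux; apply: (@derive_schwarz _ _ U) => //.
exact: smooth_on_mxE.
Qed.

Lemma derive_fD V W (f g : V -> W) x u : differentiable f x -> differentiable g x ->
  derive (fun y => f y + g y) x u = derive f x u + derive g x u.
Proof. by move=> df dg; apply: deriveD; exact: diff_derivable. Qed.

Lemma derive_fB V W (f g : V -> W) x u : differentiable f x -> differentiable g x ->
  derive (fun y => f y - g y) x u = derive f x u - derive g x u.
Proof. by move=> df dg; apply: deriveB; exact: diff_derivable. Qed.

Lemma derive_fsum V W I (r : seq I) (f : I -> V -> W) x u :
  (forall i, differentiable (f i) x) ->
  differentiable (fun y => \sum_(i <- r) f i y) x /\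
  derive (fun y => \sum_(i <- r) f i y) x u = \sum_(i <- r) derive (f i) x u.
Proof.
move=> df; elim: r => [|i r [d1 d2]].
  rewrite (_ : (fun y => _) = cst 0); last by apply/funext => y; rewrite big_nil.
  by split; [exact: differentiable_cst|rewrite big_nil [LHS]derive_cst].
rewrite (_ : (fun y => _) = (fun y => f i y + \sum_(i <- r) f i y)); last first.
  by apply/funext => y; rewrite big_cons.
split; first exact: differentiable_fD.
by rewrite big_cons derive_fD // d2.
Qed.

Lemma differentiable_mx V k l (F : V -> 'M[R]_(k, l)) x :
  (forall i j, differentiable (fun y => F y i j) x) -> differentiable F x.
Proof.
move=> dF; rewrite (_ : F = fun y => \sum_i \sum_j F y i j *: delta_mx i j); last first.
  by apply/funext => y; exact: matrix_sum_delta.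
have [] // := @derive_fsum V 'M[R]_(k, l) _ (index_enum 'I_k)
  (fun i y => \sum_j F y i j *: delta_mx i j) x 0.
move=> i; have [] // := @derive_fsum V 'M[R]_(k, l) _ (index_enum 'I_l)
  (fun j y => F y i j *: delta_mx i j) x 0.
by move=> j; exact: differentiableZl.
Qed.

Lemma differentiable_mxE V k l (F : V -> 'M[R]_(k, l)) x i j :
  differentiable F x -> differentiable (fun y => F y i j) x.
Proof.
move=> dF; apply: (@differentiable_comp _ _ _ _ F (fun A => A i j)) => //.
exact: differentiable_coord.
Qed.

Lemma derive_fM V (f g : V -> R) x u : differentiable f x -> differentiable g x ->
  derive (fun y => f y * g y) x u = derive f x u * g x + f x * derive g x u.
Proof.
move=> df dg; rewrite [LHS](deriveM (f := f) (g := g)); [|exact: diff_derivable..].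
by rewrite addrC; congr (_ + _); rewrite [LHS]mulrC.
Qed.

Lemma differentiable_mulmx V k l r (F : V -> 'M[R]_(k, l)) (G : V -> 'M[R]_(l, r)) x :
  differentiable F x -> differentiable G x -> differentiable (fun y => F y *m G y) x.
Proof.
move=> dF dG; apply: differentiable_mx => i j; under eq_fun do rewrite mxE.
have [] // := @derive_fsum V R _ (index_enum 'I_l) (fun t y => F y i t * G y t j) x 0.
by move=> t; apply: differentiableM; exact: differentiable_mxE.
Qed.

Lemma derive_mulmx V k l r (F : V -> 'M[R]_(k, l)) (G : V -> 'M[R]_(l, r)) x u :
  differentiable F x -> differentiable G x ->
  derive (fun y => F y *m G y) x u = derive F x u *m G x + F x *m derive G x u.
Proof.
move=> dF dG; apply/matrixP => i j; rewrite derive_mxE; last exact: differentiable_mulmx.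
rewrite !mxE -big_split /=; under eq_fun do rewrite mxE.
have [|_ ->] := @derive_fsum V R _ (index_enum 'I_l) (fun t y => F y i t * G y t j) x u.
  by move=> t; apply: differentiableM; exact: differentiable_mxE.
apply: eq_bigr => t _; rewrite derive_fM ?derive_mxE //; exact: differentiable_mxE.
Qed.

Lemma derive_tr V k l (F : V -> 'M[R]_(k, l)) x u : differentiable F x ->
  derive (fun y => (F y)^T) x u = (derive F x u)^T.
Proof.
move=> dF; have dT : differentiable (fun y => (F y)^T) x.
  apply: differentiable_mx => i j; under eq_fun do rewrite mxE.
  exact: differentiable_mxE.
apply/matrixP => i j; rewrite derive_mxE // mxE derive_mxE //.
by under eq_fun do rewrite mxE.
Qed.

End SmoothMatrices.

(** * Charts *)

Section Charts.
Context {R : realType} {n : nat} {M : manifold R n}.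
Implicit Types (a b c p q : M) (U : set M) (x y u : 'rV[R]_n).

Lemma chart_image_dom a U x : (chart a @` (chart_dom a `&` U)) x ->
  [/\ chart_dom a (chart_inv a x), U (chart_inv a x) & chart a (chart_inv a x) = x].
Proof. by move=> [q [aq Uq] <-]; rewrite chartK. Qed.

Lemma chart_imageI a U q : chart_dom a q -> U q ->
  (chart a @` (chart_dom a `&` U)) (chart a q).
Proof. by move=> aq Uq; exists q. Qed.

Lemma open_chart_image a U : open U -> open (chart a @` (chart_dom a `&` U)).
Proof.
move=> oU; rewrite openE => _ [q [aq Uq] <-]; rewrite /interior.
have Iq : (chart a @` chart_dom a) (chart a q) by exists q.
have nU : nbhs (chart_inv a (chart a q)) U.
  by rewrite chartK //; exact: open_nbhs_nbhs.
have nI : nbhs (chart a q) (chart a @` chart_dom a).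
  by apply: open_nbhs_nbhs; split=> //; exact: chart_image_open.
have nJ : nbhs (chart a q) (chart_inv a @^-1` U).
  exact: chart_inv_continuous Iq _ nU.
apply: filterS (filterI nI nJ) => x [[r ar <-]] /=; rewrite chartK // => Ur.
by exists r.
Qed.

Lemma near_chart_image a U q : open U -> chart_dom a q -> U q ->
  \forall x \near chart a q, (chart a @` (chart_dom a `&` U)) x.
Proof.
move=> oU aq Uq; apply: open_nbhs_nbhs.
by split; [exact: open_chart_image|exact: chart_imageI].
Qed.

Lemma near_chart a q (P : set 'rV[R]_n) : chart_dom a q ->
  nbhs (chart a q) P -> nbhs q [set r | P (chart a r)].
Proof. by move=> aq; exact: chart_continuous. Qed.

Lemma differentiable_transition a b q : chart_dom a q -> chart_dom b q ->
  differentiable (chart b \o chart_inv a) (chart a q).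
Proof.
move=> aq bq; apply: (smooth_on_differentiable (@chart_transition _ _ M a b)).
exact: chart_imageI.
Qed.

(** The chain rule for a transition map. With [a] or [b] the preferred chart of q it gives
    [derive_tcoord] and [derive_tvec]; with [f] itself a chart, these show that [tcoord] and [tvec]
    are inverse to each other. *)
Lemma derive_chart_change (W : normedModType R) (f : M -> W) a b q u :
  chart_dom a q -> chart_dom b q ->
  differentiable (f \o chart_inv b) (chart b q) ->
  derive (f \o chart_inv b) (chart b q)
    (derive (chart b \o chart_inv a) (chart a q) u)
  = derive (f \o chart_inv a) (chart a q) u.
Proof.
move=> aq bq df; have E : (chart b \o chart_inv a) (chart a q) = chart b q.
  by rewrite /= chartK.
rewrite -{1}E -(derive_comp (f := f \o chart_inv b)); last by rewrite E.
  apply: near_eq_derive.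
  have := near_chart_image (chart_dom_open b) aq bq.
  by apply: filterS => x /chart_image_dom[_ bx _]; rewrite /= chartK.
exact: differentiable_transition.
Qed.

Lemma tcoordE a q u : tcoord a q u = derive (chart a \o chart_inv q) (chart q q) u.
Proof. by []. Qed.

Lemma tvecE a q y : tvec a q y = derive (chart q \o chart_inv a) (chart a q) y.
Proof. by []. Qed.

Lemma derive_transition_id a q u : chart_dom a q ->
  derive (chart a \o chart_inv a) (chart a q) u = u.
Proof.
move=> aq; rewrite -[RHS](derive_id (chart a q) u); apply: near_eq_derive.
have := near_chart_image (chart_dom_open a) aq aq.
by apply: filterS => x /chart_image_dom[_ _ E].
Qed.

Lemma derive_tcoord (W : normedModType R) (f : M -> W) a q u : chart_dom a q ->
  differentiable (f \o chart_inv a) (chart a q) ->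
  derive (f \o chart_inv a) (chart a q) (tcoord a q u)
  = derive (f \o chart_inv q) (chart q q) u.
Proof. by move=> aq; apply: derive_chart_change => //; exact: chart_dom_self. Qed.

Lemma derive_tvec (W : normedModType R) (f : M -> W) a q y : chart_dom a q ->
  differentiable (f \o chart_inv q) (chart q q) ->
  derive (f \o chart_inv q) (chart q q) (tvec a q y)
  = derive (f \o chart_inv a) (chart a q) y.
Proof. by move=> aq; apply: derive_chart_change => //; exact: chart_dom_self. Qed.

Lemma tvecK a q y : chart_dom a q -> tcoord a q (tvec a q y) = y.
Proof.
move=> aq; rewrite tcoordE derive_tvec ?derive_transition_id //.
by apply: differentiable_transition => //; exact: chart_dom_self.
Qed.

Lemma tcoordK a q u : chart_dom a q -> tvec a q (tcoord a q u) = u.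
Proof.
move=> aq; rewrite tvecE derive_tcoord.
- by rewrite derive_transition_id //; exact: chart_dom_self.
- by [].
- by apply: differentiable_transition => //; exact: chart_dom_self.
Qed.

Lemma tcoord_self p u : tcoord p p u = u.
Proof. by rewrite tcoordE derive_transition_id //; exact: chart_dom_self. Qed.

Lemma tvec_self p u : tvec p p u = u.
Proof. by rewrite tvecE derive_transition_id //; exact: chart_dom_self. Qed.

(** A differential is linear by construction, while [tcoord] is a directional derivative and agrees
    with it only where the transition map is differentiable; [aq] restricts the map to such
    points. *)
Definition tcoord_lin a q (aq : chart_dom a q) : {linear 'rV[R]_n -> 'rV[R]_n} :=
  'd (chart a \o chart_inv q) (chart q q).

Lemma tcoord_linE a q (aq : chart_dom a q) u : tcoord_lin aq u = tcoord a q u.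
Proof.
rewrite tcoordE deriveE //.
by apply: differentiable_transition => //; exact: chart_dom_self.
Qed.

Lemma tcoord_lin_continuous a q (aq : chart_dom a q) : continuous (tcoord_lin aq).
Proof.
apply: diff_continuous.
by apply: differentiable_transition => //; exact: chart_dom_self.
Qed.

Definition tvec_lin a q (aq : chart_dom a q) : {linear 'rV[R]_n -> 'rV[R]_n} :=
  'd (chart q \o chart_inv a) (chart a q).

Lemma tvec_linE a q (aq : chart_dom a q) u : tvec_lin aq u = tvec a q u.
Proof.
rewrite tvecE deriveE //.
by apply: differentiable_transition => //; exact: chart_dom_self.
Qed.

Lemma tvec_lin_continuous a q (aq : chart_dom a q) : continuous (tvec_lin aq).
Proof.
apply: diff_continuous.
by apply: differentiable_transition => //; exact: chart_dom_self.
Qed.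

Lemma tcoordD a q u u' : chart_dom a q ->
  tcoord a q (u + u') = tcoord a q u + tcoord a q u'.
Proof. by move=> aq; rewrite -!(tcoord_linE aq) linearD. Qed.

Lemma tcoordZ a q (k : R) u : chart_dom a q -> tcoord a q (k *: u) = k *: tcoord a q u.
Proof. by move=> aq; rewrite -!(tcoord_linE aq) linearZ. Qed.

Lemma tcoordB a q u u' : chart_dom a q ->
  tcoord a q (u - u') = tcoord a q u - tcoord a q u'.
Proof. by move=> aq; rewrite -!(tcoord_linE aq) linearB. Qed.

Lemma tvecD a q u u' : chart_dom a q ->
  tvec a q (u + u') = tvec a q u + tvec a q u'.
Proof. by move=> aq; rewrite -!(tvec_linE aq) linearD. Qed.

Lemma tvecZ a q (k : R) u : chart_dom a q -> tvec a q (k *: u) = k *: tvec a q u.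
Proof. by move=> aq; rewrite -!(tvec_linE aq) linearZ. Qed.

Lemma tvec_sum a q I (r : seq I) (f : I -> 'rV[R]_n) : chart_dom a q ->
  tvec a q (\sum_(i <- r) f i) = \sum_(i <- r) tvec a q (f i).
Proof.
by move=> aq; rewrite -(tvec_linE aq) linear_sum; apply: eq_bigr => i _; rewrite tvec_linE.
Qed.

Lemma tcoord_sum a q I (r : seq I) (f : I -> 'rV[R]_n) : chart_dom a q ->
  tcoord a q (\sum_(i <- r) f i) = \sum_(i <- r) tcoord a q (f i).
Proof.
by move=> aq; rewrite -(tcoord_linE aq) linear_sum; apply: eq_bigr => i _; rewrite tcoord_linE.
Qed.

Lemma tvec0 a q : tvec a q 0 = 0.
Proof. by rewrite tvecE derive0. Qed.

Lemma tcoord0 a q : tcoord a q 0 = 0.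
Proof. by rewrite tcoordE derive0. Qed.

(** One chart suffices: the coordinates in another chart a are the derivative of the transition map
    along the coordinates in p, precomposed with the inverse transition. *)
Lemma smooth_vfield_chart p U (E : vfield M) : open U -> U `<=` chart_dom p ->
  smooth_on (chart p @` (chart_dom p `&` U)) (vfield_rep p E) -> smooth_vfield U E.
Proof.
move=> oU Up sE a.
have oa : open (chart a @` (chart_dom a `&` U)) by exact: open_chart_image.
have opa : open (chart p @` (chart_dom p `&` (U `&` chart_dom a))).
  by apply: open_chart_image; apply: openI => //; exact: chart_dom_open.
have sE' : smooth_on (chart p @` (chart_dom p `&` (U `&` chart_dom a))) (vfield_rep p E).
  by apply: smooth_on_subset sE => _ [q [pq [Uq _]] <-]; exact: chart_imageI.
have st : smooth_on (chart p @` (chart_dom p `&` (U `&` chart_dom a)))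
    (chart a \o chart_inv p).
  apply: smooth_on_subset (@chart_transition _ _ M p a) => _ [q [pq [Uq aq]] <-].
  exact: chart_imageI.
have sD := smooth_on_derive_along (@finite_coordinates_mx R 1 n) opa st sE'.
pose F x := derive (chart a \o chart_inv p) x (vfield_rep p E x).
apply: (@eq_smooth_on _ _ _ _ (F \o (chart p \o chart_inv a)) _ oa).
  rewrite /F => x; rewrite inE => /chart_image_dom[ax Ux xE].
  rewrite /vfield_rep /= chartK; last exact: Up.
  set q := chart_inv a x in ax Ux xE *.
  rewrite derive_tcoord //; first exact: Up.
  by apply: differentiable_transition => //; exact: Up.
apply: (smooth_on_comp _ _ _ sD) => //; first exact: finite_coordinates_mx.
  apply: smooth_on_subset (@chart_transition _ _ M a p) => _ [q [aq Uq] <-].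
  by apply: chart_imageI => //; exact: Up.
move=> _ [q [aq Uq] <-] /=; rewrite chartK //.
by apply: chart_imageI => //; exact: Up.
Qed.

Lemma smooth_fun_chart p U (f : M -> R) : open U -> U `<=` chart_dom p ->
  smooth_on (chart p @` (chart_dom p `&` U)) (f \o chart_inv p) -> smooth_fun U f.
Proof.
move=> oU Up sf a.
have oa : open (chart a @` (chart_dom a `&` U)) by exact: open_chart_image.
apply: (@eq_smooth_on _ _ _ _ (fun x => (f \o chart_inv p) ((chart p \o chart_inv a) x))) => //.
  move=> x; rewrite inE => /chart_image_dom[ax Ux xE].
  by rewrite /= chartK //; exact: Up.
apply: smooth_algP => //; apply: (SmoothComp (f := f \o chart_inv p)) sf _ _.
- exact: finite_coordinates_mx.
- apply: smooth_on_subset (@chart_transition _ _ M a p) => _ [q [aq Uq] <-].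
  by apply: chart_imageI => //; exact: Up.
- move=> _ [q [aq Uq] <-] /=; rewrite chartK //.
  by apply: chart_imageI => //; exact: Up.
Qed.

Lemma vfield_rep_const p y x : (chart p @` chart_dom p) x ->
  vfield_rep p (tvec p ^~ y) x = y.
Proof. by move=> [q pq <-]; rewrite /vfield_rep /= chartK // tvecK. Qed.

Lemma smooth_const_field p y : smooth_vfield (chart_dom p) (tvec p ^~ y : vfield M).
Proof.
apply: (@smooth_vfield_chart p) => //; first exact: chart_dom_open.
have oI : open (chart p @` (chart_dom p `&` chart_dom p)).
  by apply: open_chart_image; exact: chart_dom_open.
apply: (@eq_smooth_on _ _ _ _ (fun=> y)) => //; last exact: smooth_on_cst.
by move=> x; rewrite inE setIid => Ix; rewrite vfield_rep_const.
Qed.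

Lemma smooth_vfield_subset U U' (E : vfield M) : U `<=` U' ->
  smooth_vfield U' E -> smooth_vfield U E.
Proof.
move=> UU sE a; apply: smooth_on_subset (sE a) => _ [q [aq Uq] <-].
by apply: chart_imageI => //; exact: UU.
Qed.

(** The bracket at q is computed in the chart at q, where these fields are no longer constant. Their
    coordinates are first derivatives of the transition map, so the bracket is a difference of mixed
    second derivatives, and vanishes by symmetry. *)
Lemma lie_bracket_const p (e h : 'rV[R]_n) q : chart_dom p q ->
  lie_bracket (tvec p ^~ e : vfield M) (tvec p ^~ h) q = 0.
Proof.
move=> pq; have oI : open (chart p @` (chart_dom p `&` chart_dom q)).
  by apply: open_chart_image; exact: chart_dom_open.
pose f := chart q \o chart_inv p.
have qq := chart_dom_self q.
have sf : smooth_on (chart p @` (chart_dom p `&` chart_dom q)) f by exact: chart_transition.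
have aux u w : derive (vfield_rep q (tvec p ^~ u : vfield M)) (chart q q) (tvec p q w)
    = derive (fun x => derive f x u) (chart p q) w.
  pose k r := derive f (chart p r) u.
  have dk : differentiable (k \o chart_inv q) (chart q q).
    apply: (@differentiable_comp _ _ _ _ (chart p \o chart_inv q) (fun x => derive f x u)).
      exact: differentiable_transition.
    rewrite /= chartK //; apply: (smooth_on_differentiable (smooth_on_derive u sf)).
    exact: chart_imageI.
  have E1 : \forall x \near chart q q,
      vfield_rep q (tvec p ^~ u : vfield M) x = (k \o chart_inv q) x.
    have := near_chart_image (chart_dom_open p) qq pq.
    apply: filterS => x /chart_image_dom[qx px xE].
    rewrite /vfield_rep tcoordE; apply: (derive_tvec (f := chart q)) => //.
    by apply: differentiable_transition => //; exact: chart_dom_self.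
  have E2 : \forall x \near chart p q, (k \o chart_inv p) x = derive f x u.
    have := near_chart_image (chart_dom_open q) pq qq.
    by apply: filterS => x /chart_image_dom[_ _ xE]; rewrite /k /= xE.
  transitivity (derive (k \o chart_inv q) (chart q q) (tvec p q w)).
    exact: (near_eq_derive _ E1).
  transitivity (derive (k \o chart_inv p) (chart p q) w).
    exact: (derive_tvec _ pq dk).
  exact: (near_eq_derive _ E2).
rewrite /lie_bracket [X in X - _]aux [X in _ - X]aux.
rewrite (derive_schwarz_mx h e oI sf) ?subrr //; exact: chart_imageI.
Qed.

End Charts.

Arguments open_chart_image {R n M} a {U}.
Arguments smooth_const_field {R n M} p y.

Section Fields.
Context {R : realType} {n : nat} {M : manifold R n}.
Implicit Types (a p q : M) (U : set M) (E H : vfield M).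

Lemma smooth_vfield0 U : open U -> smooth_vfield U (fun _ : M => 0).
Proof.
move=> oU a; have oa : open (chart a @` (chart_dom a `&` U)) by exact: open_chart_image.
apply: (@eq_smooth_on _ _ _ _ (fun=> 0) _ oa); last exact: smooth_on_cst.
by move=> x _; rewrite /vfield_rep tcoord0.
Qed.

Lemma smooth_vfieldD U E H : open U -> smooth_vfield U E -> smooth_vfield U H ->
  smooth_vfield U (fun q => E q + H q).
Proof.
move=> oU sE sH a; have oa : open (chart a @` (chart_dom a `&` U)) by exact: open_chart_image.
apply: (@eq_smooth_on _ _ _ _ (fun x => vfield_rep a E x + vfield_rep a H x) _ oa).
  by move=> x; rewrite inE => /chart_image_dom[ax _ _]; rewrite /vfield_rep tcoordD.
exact: (smooth_on_add oa (sE a) (sH a)).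
Qed.

Lemma smooth_vfieldZ U f E : open U -> smooth_fun U f -> smooth_vfield U E ->
  smooth_vfield U (fun q => f q *: E q).
Proof.
move=> oU sf sE a; have oa : open (chart a @` (chart_dom a `&` U)) by exact: open_chart_image.
apply: (@eq_smooth_on _ _ _ _ (fun x => (f \o chart_inv a) x *: vfield_rep a E x) _ oa).
  by move=> x; rewrite inE => /chart_image_dom[ax _ _]; rewrite /vfield_rep tcoordZ.
exact: (smooth_on_scale oa (sf a) (sE a)).
Qed.

Lemma smooth_vfield_sum U I (r : seq I) (f : I -> M -> R) (F : I -> vfield M) :
  open U -> (forall i, smooth_fun U (f i)) -> (forall i, smooth_vfield U (F i)) ->
  smooth_vfield U (fun q => \sum_(i <- r) f i q *: F i q).
Proof.
move=> oU sf sF; elim: r => [|i r IH].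
  by under eq_fun do rewrite big_nil; exact: smooth_vfield0.
under eq_fun do rewrite big_cons.
exact: (smooth_vfieldD oU (smooth_vfieldZ oU (sf i) (sF i)) IH).
Qed.

Lemma eq_smooth_vfield U E H : open U -> (forall q, U q -> E q = H q) ->
  smooth_vfield U E -> smooth_vfield U H.
Proof.
move=> oU EH sE a; have oa : open (chart a @` (chart_dom a `&` U)) by exact: open_chart_image.
apply: (eq_smooth_on oa _ (sE a)) => x; rewrite inE => /chart_image_dom[ax Ux _].
by rewrite /vfield_rep EH.
Qed.

Lemma smooth_fun_one U (f : M -> R) : open U -> (forall q, U q -> f q = 1) ->
  smooth_fun U f.
Proof.
move=> oU f1 a; have oa : open (chart a @` (chart_dom a `&` U)) by exact: open_chart_image.
apply: (@eq_smooth_on _ _ _ _ (fun=> 1 : R) _ oa); last exact: smooth_on_cst.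
by move=> x; rewrite inE => /chart_image_dom[ax Ux _]; rewrite /= f1.
Qed.

End Fields.

(** * Connections in a chart *)

Section Connection.
Context {R : realType} {n : nat} {M : manifold R n}.
Implicit Types (a q : M) (U : set M) (E H : vfield M).
Variables (A : tset M) (nabla : vfield M -> vfield M -> avfield M).
Hypothesis conn : anisotropic_connection A nabla.

(* Both locality lemmas multiply by the indicator f of U, which is smooth on U
   and makes f E and f E' equal everywhere. *)
Lemma nabla_locall U E E' H q u : open U -> smooth_vfield U E ->
  smooth_vfield U H -> U q -> A q u -> (forall r, U r -> E r = E' r) ->
  nabla E H q u = nabla E' H q u.
Proof.
move=> oU sE sH Uq Aq EE; pose f r : R := (r \in U)%:R.
have f1 r : U r -> f r = 1 by move=> Ur; rewrite /f mem_set.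
have sf := smooth_fun_one oU f1.
have sE' := eq_smooth_vfield oU EE sE.
have C := conn_scalel conn oU sf sE sH Uq Aq.
have C' := conn_scalel conn oU sf sE' sH Uq Aq.
rewrite -[LHS]scale1r -[RHS]scale1r -(f1 q Uq) -C -C'.
congr (nabla _ _ _ _); apply/funext => r.
by rewrite /f; case: (boolP (r \in U)) => [|_]; [rewrite inE => /EE->|rewrite !scale0r].
Qed.

Lemma nabla_localr U E H H' q u : open U -> smooth_vfield U E ->
  smooth_vfield U H -> U q -> A q u -> (forall r, U r -> H r = H' r) ->
  nabla E H q u = nabla E H' q u.
Proof.
move=> oU sE sH Uq Aq EE; pose f r : R := (r \in U)%:R.
have f1 r : U r -> f r = 1 by move=> Ur; rewrite /f mem_set.
have sf := smooth_fun_one oU f1.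
have sH' := eq_smooth_vfield oU EE sH.
have C := conn_leibniz conn oU sf sE sH Uq Aq.
have C' := conn_leibniz conn oU sf sE sH' Uq Aq.
have v0 : vder (E q) f q = 0.
  rewrite -[RHS](derive_cst (1 : R) (chart q q) (E q)); apply: near_eq_derive.
  have := near_chart_image oU (chart_dom_self q) Uq.
  by apply: filterS => x /chart_image_dom[_ Ux _]; rewrite /= f1.
rewrite v0 !scale0r !addr0 (f1 q Uq) !scale1r in C C'.
rewrite -C -C'; congr (nabla _ _ _ _); apply/funext => r.
by rewrite /f; case: (boolP (r \in U)) => [|_]; [rewrite inE => /EE->|rewrite !scale0r].
Qed.

Lemma nabla_suml U I (r : seq I) (f : I -> M -> R) (F : I -> vfield M) H q u :
  open U -> (forall i, smooth_fun U (f i)) -> (forall i, smooth_vfield U (F i)) ->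
  smooth_vfield U H -> U q -> A q u ->
  nabla (fun q => \sum_(i <- r) f i q *: F i q) H q u =
  \sum_(i <- r) f i q *: nabla (F i) H q u.
Proof.
move=> oU sf sF sH Uq Aq; elim: r => [|i r IH].
  have s0 : smooth_fun U (fun=> 0 : R).
    by move=> a; apply: smooth_on_cst; exact: open_chart_image.
  have C := conn_scalel conn oU s0 (smooth_vfield0 oU) sH Uq Aq.
  rewrite big_nil -[RHS](scale0r (nabla (fun=> 0) H q u)) -[RHS]C.
  by congr (nabla _ _ _ _); apply/funext => x; rewrite big_nil scaler0.
under [X in nabla X]eq_fun do rewrite big_cons.
rewrite (conn_addl conn oU _ _ sH Uq Aq).
- by rewrite (conn_scalel conn oU (sf i) (sF i) sH Uq Aq) big_cons IH.
- exact: (smooth_vfieldZ oU (sf i) (sF i)).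
- exact: (smooth_vfield_sum r oU sf sF).
Qed.

Lemma nabla_sumr U I (r : seq I) (f : I -> M -> R) (F : I -> vfield M) E q u :
  open U -> (forall i, smooth_fun U (f i)) -> (forall i, smooth_vfield U (F i)) ->
  smooth_vfield U E -> U q -> A q u ->
  nabla E (fun q => \sum_(i <- r) f i q *: F i q) q u =
  \sum_(i <- r) (f i q *: nabla E (F i) q u + vder (E q) (f i) q *: F i q).
Proof.
move=> oU sf sF sE Uq Aq; elim: r => [|i r IH].
  have s0 : smooth_fun U (fun=> 0 : R).
    by move=> a; apply: smooth_on_cst; exact: open_chart_image.
  have C : nabla E (fun=> (0 : R) *: 0) q u = 0.
    apply: etrans (conn_leibniz conn oU s0 sE (smooth_vfield0 oU) Uq Aq) _.
    by rewrite scale0r scaler0 addr0.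
  rewrite big_nil -[RHS]C.
  by congr (nabla _ _ _ _); apply/funext => x; rewrite big_nil scaler0.
under [X in nabla _ X]eq_fun do rewrite big_cons.
rewrite (conn_addr conn oU sE _ _ Uq Aq).
- by rewrite (conn_leibniz conn oU (sf i) sE (sF i) Uq Aq) big_cons IH.
- exact: (smooth_vfieldZ oU (sf i) (sF i)).
- exact: (smooth_vfield_sum r oU sf sF).
Qed.

Variable p : M.

Definition christoffel (z : 'rV[R]_n * 'rV[R]_n) (i j : 'I_n) : 'rV[R]_n :=
  let q := chart_inv p z.1 in
  tcoord p q (nabla (tvec p ^~ (delta_mx 0 i)) (tvec p ^~ (delta_mx 0 j)) q
    (tvec p q z.2)).

(* [h *m chr z e] is the value at z of nabla_e h for fields e, h with constant
   coordinates in the chart p. *)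
Definition chr (z : 'rV[R]_n * 'rV[R]_n) (e : 'rV[R]_n) : 'M[R]_n :=
  \sum_i e 0 i *: \matrix_j christoffel z i j.

Lemma chr_linear z : linear (chr z).
Proof.
move=> k e e'; rewrite /chr scaler_sumr -big_split /=; apply: eq_bigr => i _.
by rewrite !mxE scalerDl scalerA.
Qed.

HB.instance Definition _ z := GRing.isLinear.Build R 'rV[R]_n 'M[R]_n _
  (chr z) (chr_linear z).

Lemma mul_chrE z (e h : 'rV[R]_n) : h *m chr z e =
  \sum_i e 0 i *: \sum_j h 0 j *: christoffel z i j.
Proof.
rewrite /chr mulmx_sumr; apply: eq_bigr => i _; rewrite -scalemxAr.
congr (_ *: _); rewrite mulmx_sum_row; apply: eq_bigr => j _; congr (_ *: _).
by apply/rowP => k; rewrite !mxE.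
Qed.

(** Both fields are expanded in the coordinate frame [d]. The expansions hold on U only, whence the
    two locality lemmas; the Leibniz rule produces the derivative of the coordinates of H. *)
Lemma nabla_chart U E H q u : open U -> U `<=` chart_dom p ->
  smooth_vfield U E -> smooth_vfield U H -> U q -> A q u ->
  tcoord p q (nabla E H q u) =
    derive (vfield_rep p H) (chart p q) (tcoord p q (E q))
    + tcoord p q (H q) *m chr (chart p q, tcoord p q u) (tcoord p q (E q)).
Proof.
move=> oU Up sE sH Uq Aq; have pq := Up q Uq.
pose d i : vfield M := tvec p ^~ (delta_mx 0 i).
have sd i : smooth_vfield U (d i).
  by apply: smooth_vfield_subset Up _; exact: smooth_const_field.
have oI : open (chart p @` (chart_dom p `&` U)) by exact: open_chart_image.
have Iq : (chart p @` (chart_dom p `&` U)) (chart p q) by exact: chart_imageI.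
pose co (F : vfield M) i r : R := (tcoord p r (F r)) 0 i.
have dec F r : U r -> F r = \sum_i co F i r *: d i r.
  move=> Ur; rewrite -[LHS](tcoordK _ (Up r Ur)).
  rewrite {1}[tcoord p r (F r)]row_sum_delta tvec_sum; last exact: Up.
  by apply: eq_bigr => i _; rewrite tvecZ //; exact: Up.
have sco F i : smooth_vfield U F -> smooth_fun U (co F i).
  move=> sF; apply: (@smooth_fun_chart _ _ _ p) => //.
  exact: (smooth_on_mxE 0 i oI (sF p)).
have vd F i j : smooth_vfield U F -> vder (d i q) (co F j) q =
    (derive (vfield_rep p F) (chart p q) (delta_mx 0 i)) 0 j.
  move=> sF; rewrite derive_mxE; last exact: (smooth_on_differentiable (sF p)).
  apply: (derive_tvec (f := co F j)) => //.
  have := sco F j sF q; move=> /smooth_on_differentiable; apply.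
  by apply: chart_imageI => //; exact: chart_dom_self.
rewrite (nabla_locall oU sE sH Uq Aq (dec E)).
rewrite (nabla_suml _ oU (fun i => sco E i sE) sd sH Uq Aq).
rewrite tcoord_sum // mul_chrE.
rewrite [X in derive _ _ X]row_sum_delta deriveE_sum; last first.
  exact: (smooth_on_differentiable (sH p)).
rewrite -big_split /=; apply: eq_bigr => i _.
rewrite tcoordZ // -scalerDr; congr (_ *: _).
rewrite (nabla_localr oU (sd i) sH Uq Aq (dec H)).
rewrite (nabla_sumr _ oU (fun i => sco H i sH) sd (sd i) Uq Aq).
rewrite tcoord_sum // [X in X + _]row_sum_delta -big_split /=.
apply: eq_bigr => j _; rewrite (tcoordD _ _ pq) 2!(tcoordZ _ _ pq) (vd H i j sH).
have -> : tcoord p q (d j q) = delta_mx 0 j by exact: tvecK.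
have -> : tcoord p q (nabla (d i) (d j) q u) =
    christoffel (chart p q, tcoord p q u) i j.
  by rewrite /christoffel /= (chartK pq) (tcoordK _ pq).
by rewrite [LHS]addrC.
Qed.

End Connection.

(** * Anisotropic fields and covariant derivatives in the chart of TM at p *)

Section TangentChart.
Context {R : realType} {n : nat} {M : manifold R n}.
Implicit Types (a q : M) (U : set M) (E H : vfield M).
Local Notation Z := ('rV[R]_n * 'rV[R]_n)%type.
Variables (A : tset M) (p : M) (U0 : set M).
Hypothesis (A_open : open_tset A) (U0_open : open U0) (U0p : U0 `<=` chart_dom p).

Let O : set Z := tset_rep A U0 p.
Definition tpt q (u : 'rV[R]_n) : Z := (chart p q, tcoord p q u).

Lemma finite_coordinates_tangent : finite_coordinates Z.
Proof. by apply: finite_coordinates_pair; exact: finite_coordinates_mx. Qed.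

Lemma tset_rep_tpt q u : U0 q -> A q u -> O (tpt q u).
Proof.
move=> Uq Aq; have pq := U0p Uq; split=> /=; first exact: chart_imageI.
by rewrite (chartK pq) (tcoordK _ pq).
Qed.

Lemma tset_repP (z : Z) : O z ->
  exists q u, [/\ U0 q, A q u & z = tpt q u].
Proof.
case: z => x y [/= /chart_image_dom[px Ux xE] Ax].
exists (chart_inv p x), (tvec p (chart_inv p x) y); split=> //.
by rewrite /tpt xE tvecK.
Qed.

Lemma open_tset_rep : open O.
Proof.
have oI := open_chart_image p U0_open.
have -> : O = tset_rep A setT p `&` (fst @^-1` (chart p @` (chart_dom p `&` U0))).
  apply/seteqP; split=> z.
    move=> [Iz Az]; split=> //; split=> //.
    by case: Iz => q [pq _] <-; exact: chart_imageI.
  by move=> [[_ Az] Iz]; split.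
apply: openI; first exact: A_open.
by apply: open_comp oI => z _; exact: continuous_fst.
Qed.

(** Coordinates are those of the chart p at every q of [U0], not those of the chart at q, so that F
    can be differentiated in the base point. Nothing is said at non-admissible vectors, where X is
    arbitrary. *)
Definition avrep (X : avfield M) (F : Z -> 'rV[R]_n) : Prop :=
  forall q u, U0 q -> A q u -> tcoord p q (X q u) = F (tpt q u).

Variable nabla : vfield M -> vfield M -> avfield M.
Hypothesis conn : anisotropic_connection A nabla.
Local Notation chr := (chr nabla p).

Lemma smooth_christoffel i j : smooth_on O (fun z => christoffel nabla p z i j).
Proof.
have dp := chart_dom_open p.
have sc k : smooth_vfield (chart_dom p) (tvec p ^~ (delta_mx 0 k) : vfield M).
  exact: smooth_const_field.
have sa : smooth_avfield A (chart_dom p)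
    (nabla (tvec p ^~ (delta_mx 0 i)) (tvec p ^~ (delta_mx 0 j))).
  exact: conn_smooth.
apply: (smooth_on_subset _ (sa p)) => -[x y] [/= [q [pq _] <-] Az].
by split=> //; exists q.
Qed.

Lemma smooth_chr (e : Z -> 'rV[R]_n) : smooth_on O e ->
  smooth_on O (fun z => chr z (e z)).
Proof.
move=> se; have oO := open_tset_rep.
apply: (smooth_on_sum _ oO) => i; apply: (smooth_on_scale oO).
  exact: (smooth_on_mxE 0 i oO se).
apply: (smooth_on_mx oO) => j k; under eq_fun do rewrite mxE.
exact: (smooth_on_mxE 0 k oO (smooth_christoffel i j)).
Qed.

(* The horizontal lift of e at z for the nonlinear connection of nabla. *)
Definition hlift (z : Z) (e : 'rV[R]_n) : Z := (e, - (z.2 *m chr z e)).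

Lemma hlift_linear z : linear (hlift z).
Proof.
move=> k e e'; apply: injective_projections => //=.
by rewrite linearP mulmxDr opprD -scalemxAr scalerN.
Qed.

HB.instance Definition _ z := GRing.isLinear.Build R 'rV[R]_n Z _
  (hlift z) (hlift_linear z).

Lemma smooth_hlift (e : Z -> 'rV[R]_n) : smooth_on O e ->
  smooth_on O (fun z => hlift z (e z)).
Proof.
move=> se; have oO := open_tset_rep.
apply: (smooth_on_pair oO se); apply: (smooth_on_opp oO).
apply: (smooth_on_mulmx oO _ (smooth_chr se)).
have l : continuous (snd : Z -> 'rV[R]_n) by exact: continuous_snd.
exact: (smooth_on_linear_comp oO l (smooth_on_id oO)).
Qed.

(** The constant-coordinate extension V of an admissible vector is admissible only near its base
    point. X is controlled along V only there, and openness of that set lets the connection axioms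
    apply on it. *)
Lemma open_admissible_ext (V : vfield M) U : open U -> U `<=` U0 ->
  smooth_vfield U V -> open [set r | U r /\ A r (V r)].
Proof.
move=> oU UU sV; rewrite openE => r [Ur Ar]; rewrite /interior.
have Ur0 := UU r Ur; have pr := U0p Ur0.
have dV : differentiable (vfield_rep p V) (chart p r).
  exact: (smooth_on_differentiable (sV p) (chart_imageI pr Ur)).
have dg : differentiable (fun x => (x, vfield_rep p V x)) (chart p r).
  by apply: differentiable_pair dV; exact: ex_diff.
have E r' : chart_dom p r' -> (chart p r', vfield_rep p V (chart p r')) = tpt r' (V r').
  by move=> pr'; rewrite /vfield_rep /= (chartK pr').
have nO : nbhs (chart p r, vfield_rep p V (chart p r)) O.
  apply: open_nbhs_nbhs; split; first exact: open_tset_rep.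
  by rewrite E //; exact: tset_rep_tpt.
have nx : nbhs (chart p r) [set x | O (x, vfield_rep p V x)].
  exact: (differentiable_continuous dg) nO.
have nr := near_chart pr nx.
have nU : nbhs r U by exact: open_nbhs_nbhs.
apply: filterS (filterI nU nr) => r' [/= Ur' Or']; split=> //.
have pr' : chart_dom p r' by exact/U0p/UU.
move: Or'; rewrite E // => -[_ /=].
by rewrite (chartK pr') (tcoordK _ pr').
Qed.

Lemma avrep_along X F V U : avrep X F -> open U -> U `<=` U0 ->
  (forall r, U r -> A r (V r)) -> forall x,
  (chart p @` (chart_dom p `&` U)) x ->
  vfield_rep p (fun r => X r (V r)) x = F (x, vfield_rep p V x).
Proof.
move=> XF oU UU UA _ [r [pr Ur] <-]; rewrite /vfield_rep /= (chartK pr).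
by rewrite (XF r (V r) (UU r Ur) (UA r Ur)).
Qed.

Lemma smooth_avfield_along X F V U : avrep X F -> smooth_on O F -> open U ->
  U `<=` U0 -> smooth_vfield U V -> (forall r, U r -> A r (V r)) ->
  smooth_vfield U (fun r => X r (V r)).
Proof.
move=> XF sF oU UU sV UA; have Up : U `<=` chart_dom p by move=> r /UU /U0p.
have oI := open_chart_image p oU.
apply: (smooth_vfield_chart oU Up).
apply: (@eq_smooth_on _ _ _ _ (fun x => F (x, vfield_rep p V x)) _ oI).
  by move=> x; rewrite inE => Ix; rewrite (avrep_along XF oU UU UA Ix).
apply: (smooth_on_comp finite_coordinates_tangent oI open_tset_rep sF).
  exact: (smooth_on_pair oI (smooth_on_id oI) (sV p)).
move=> _ [r [pr Ur] <-]; rewrite /vfield_rep (chartK pr).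
exact: (tset_rep_tpt (UU r Ur) (UA r Ur)).
Qed.

(** On the fibre over q the two systems of coordinates differ by the fixed linear map [tcoord p q],
    which commutes with differentiation in the direction. *)
Lemma derive_fiber X F q u k : avrep X F -> smooth_on O F -> U0 q -> A q u ->
  tcoord p q (derive (X q) u k) = derive F (tpt q u) (0, tcoord p q k).
Proof.
move=> XF sF Uq Aq; have pq := U0p Uq.
have Oz := tset_rep_tpt Uq Aq.
have dF := smooth_on_differentiable sF Oz.
pose g w : Z := (chart p q, tcoord_lin pq w).
have gE w : g w = tpt q w by rewrite /g tcoord_linE.
have dt : differentiable (tcoord_lin pq) u.
  by apply: linear_differentiable; exact: tcoord_lin_continuous.
have dg : differentiable g u.
  by apply: differentiable_pair dt; exact: differentiable_cst.
have dFg : differentiable (fun w => F (g w)) u.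
  by apply: (@differentiable_comp _ _ _ _ g F) => //; rewrite gE.
have Dg : derive g u k = (0, tcoord p q k).
  rewrite /g derive_pair; [|exact: differentiable_cst|exact: dt].
  have -> : derive (fun=> chart p q) u k = 0 by exact: derive_cst.
  have -> // : derive (tcoord_lin pq) u k = tcoord p q k.
  rewrite deriveE // diff_lin; first exact: tcoord_linE.
  exact: tcoord_lin_continuous.
have near_g : nbhs u [set w | A q w].
  have nO : nbhs (g u) O.
    by rewrite gE; apply: open_nbhs_nbhs; split=> //; exact: open_tset_rep.
  have nw : nbhs u (g @^-1` O) by exact: (differentiable_continuous dg) nO.
  apply: filterS nw => w; rewrite /preimage /= gE.
  by move=> -[_ /=]; rewrite (chartK pq) (tcoordK _ pq).
have -> : derive (X q) u k = derive (fun w => tvec_lin pq (F (g w))) u k.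
  apply: near_eq_derive; apply: filterS near_g => w Aw.
  by rewrite gE tvec_linE -(XF q w Uq Aw) (tcoordK _ pq).
rewrite (derive_linear_comp _ (@tvec_lin_continuous _ _ _ _ _ pq) dFg).
rewrite tvec_linE (tvecK _ pq) (derive_comp (f := F) (g := g) _ dg); last by rewrite gE.
by rewrite gE Dg.
Qed.

(** The derivative [D] of the coordinates of the extension V enters both terms of [cov]: as F'(e, D)
    in the first and as F'(0, D + y C) in the second, y being the coordinates of u. It cancels and
    leaves the horizontal lift (e, - y C). This is the independence of the covariant derivative from
    the extension. *)
Lemma cov_chart X F E U q u : avrep X F -> smooth_on O F -> open U ->
  U `<=` U0 -> smooth_vfield U E -> U q -> A q u ->
  tcoord p q (cov nabla E X q u) =
    derive F (tpt q u) (hlift (tpt q u) (tcoord p q (E q)))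
    + F (tpt q u) *m chr (tpt q u) (tcoord p q (E q)).
Proof.
move=> XF sF oU UU sE Uq Aq; set e := tcoord p q (E q); set z := tpt q u.
pose V : vfield M := tvec q ^~ u.
have sV : smooth_vfield (chart_dom q) V by exact: smooth_const_field.
pose U1 := U `&` chart_dom q.
have oU1 : open U1 by apply: openI => //; exact: chart_dom_open.
have U1U0 : U1 `<=` U0 by move=> r [/UU].
have sV1 : smooth_vfield U1 V by apply: smooth_vfield_subset sV => r [].
pose W : set M := [set r | U1 r /\ A r (V r)].
have oW : open W := open_admissible_ext oU1 U1U0 sV1.
have WU0 : W `<=` U0 by move=> r [/U1U0].
have Wp : W `<=` chart_dom p by move=> r /WU0 /U0p.
have WA r : W r -> A r (V r) by move=> [].
have sVW : smooth_vfield W V by apply: smooth_vfield_subset sV1 => r [].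
have sEW : smooth_vfield W E by apply: smooth_vfield_subset sE => r [[]].
have Vq : V q = u by exact: tvec_self.
have Wq : W q by split; [split=> //; exact: chart_dom_self|rewrite Vq].
have pq := Wp q Wq; have Uq0 := WU0 q Wq.
have sXV := smooth_avfield_along XF sF oW WU0 sVW WA.
have oI := open_chart_image p oW.
have Iq : (chart p @` (chart_dom p `&` W)) (chart p q) by exact: chart_imageI.
have Vz : vfield_rep p V (chart p q) = tcoord p q u.
  by rewrite /vfield_rep (chartK pq) Vq.
have dV : differentiable (vfield_rep p V) (chart p q).
  exact: (smooth_on_differentiable (sVW p) Iq).
have dF : differentiable F z by exact: (smooth_on_differentiable sF (tset_rep_tpt Uq0 Aq)).
pose D := derive (vfield_rep p V) (chart p q) e.
have N1 : tcoord p q (nabla E V q u) = D + z.2 *m chr z e.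
  by rewrite (nabla_chart conn oW Wp sEW sVW Wq Aq) Vq.
have N2 : tcoord p q (nabla E (fun r => X r (V r)) q u) =
    derive F z (e, D) + F z *m chr z e.
  rewrite (nabla_chart conn oW Wp sEW sXV Wq Aq) Vq (XF q u Uq0 Aq); congr (_ + _).
  pose g x : Z := (x, vfield_rep p V x).
  have gz : g (chart p q) = z by rewrite /g Vz.
  have dg : differentiable g (chart p q).
    by apply: differentiable_pair dV; exact: ex_diff.
  have Dg : derive g (chart p q) e = (e, D).
    by rewrite /g derive_pair; [rewrite derive_id|exact: ex_diff|exact: dV].
  transitivity (derive (fun x => F (g x)) (chart p q) e).
    apply: near_eq_derive; have nI := near_chart_image oW pq Wq.
    by apply: filterS nI => x Ix; rewrite (avrep_along XF oW WU0 WA Ix).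
  rewrite (derive_comp (f := F) (g := g) _ dg); last by rewrite gz.
  by rewrite gz Dg.
rewrite /cov (tcoordB _ _ pq) N2 (derive_fiber _ XF sF Uq0 Aq) N1.
rewrite addrAC; congr (_ + _); rewrite !deriveE // -linearB; congr ('d F z _).
apply: injective_projections => /=; first by rewrite subr0.
by rewrite opprD addNKr.
Qed.

(** Restricted to the point p, where metric compatibility is read off; there the extension of u has
    constant coordinates in the chart p, and no derivative of it appears. *)
Lemma cov_fun_chart (f : tfun M) (phi : Z -> R) E U u :
  (forall q w, U0 q -> A q w -> f q w = phi (tpt q w)) -> smooth_on O phi ->
  open U -> U `<=` U0 -> smooth_vfield U E -> U p -> A p u ->
  cov_fun nabla E f p u = derive phi (tpt p u) (hlift (tpt p u) (E p)).
Proof.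
move=> fphi sphi oU UU sE Up Ap; set z := tpt p u.
have pp := chart_dom_self p; have Up0 := UU p Up.
have zE : z = (chart p p, u) by rewrite /z /tpt tcoord_self.
have dphi : differentiable phi z.
  exact: (smooth_on_differentiable sphi (tset_rep_tpt Up0 Ap)).
have nO : nbhs z O.
  apply: open_nbhs_nbhs; split; first exact: open_tset_rep.
  exact: tset_rep_tpt.
have D1 : vder (E p) (fun q => f q (tvec p q u)) p = derive phi z (E p, 0).
  pose g x : Z := (x, u).
  have gz : g (chart p p) = z by rewrite zE.
  have dg : differentiable g (chart p p).
    by apply: differentiable_pair; [exact: ex_diff|exact: differentiable_cst].
  have Dg : derive g (chart p p) (E p) = (E p, 0).
    rewrite /g derive_pair; [|exact: ex_diff|exact: differentiable_cst].
    have -> : derive (fun=> u) (chart p p) (E p) = 0 by exact: derive_cst.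
    by rewrite derive_id.
  transitivity (derive (fun x => phi (g x)) (chart p p) (E p)).
    rewrite /vder; apply: near_eq_derive.
    have nx : nbhs (chart p p) [set x | O (g x)].
      by apply: (differentiable_continuous dg); rewrite gz.
    apply: filterS nx => x [/= /chart_image_dom[px Ux xE] Ax].
    by rewrite /= (fphi _ _ Ux Ax) /tpt xE (tvecK _ px).
  rewrite (derive_comp (f := phi) (g := g) _ dg); last by rewrite gz.
  by rewrite gz Dg.
have D2 k : derive (f p) u k = derive phi z (0, k).
  pose g w : Z := (chart p p, w).
  have gz : g u = z by rewrite zE.
  have dg : differentiable g u.
    by apply: differentiable_pair; [exact: differentiable_cst|exact: ex_diff].
  have Dg : derive g u k = (0, k).
    rewrite /g derive_pair; [|exact: differentiable_cst|exact: ex_diff].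
    have -> : derive (fun=> chart p p) u k = 0 by exact: derive_cst.
    by rewrite derive_id.
  transitivity (derive (fun w => phi (g w)) u k).
    apply: near_eq_derive.
    have nx : nbhs u [set w | O (g w)].
      by apply: (differentiable_continuous dg); rewrite gz.
    apply: filterS nx => w [_ /=]; rewrite (chartK pp) tvec_self => Aw.
    by rewrite (fphi _ _ Up0 Aw) /tpt tcoord_self.
  rewrite (derive_comp (f := phi) (g := g) _ dg); last by rewrite gz.
  by rewrite gz Dg.
have N : nabla E (tvec p ^~ u : vfield M) p u = u *m chr z (E p).
  have Udom : U `<=` chart_dom p by move=> r /UU /U0p.
  have sV : smooth_vfield U (tvec p ^~ u : vfield M).
    by apply: smooth_vfield_subset Udom _; exact: smooth_const_field.
  have := nabla_chart conn oU Udom sE sV Up Ap; rewrite !tcoord_self tvec_self.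
  move=> ->; rewrite -/(tpt p u); rewrite -[RHS]add0r -/z zE; congr (_ + _).
  rewrite -[RHS](derive_cst u (chart p p) (E p)); apply: near_eq_derive.
  have nI := near_chart_image (chart_dom_open p) pp pp.
  apply: filterS nI => x; rewrite setIid => Ix.
  exact: vfield_rep_const.
rewrite /cov_fun D1 D2 N !deriveE // -linearB; congr ('d phi z _).
apply: injective_projections => /=; first by rewrite subr0.
by rewrite sub0r tcoord_self.
Qed.

End TangentChart.

Lemma row_inj_unitmx (F : fieldType) k (A : 'M[F]_k) :
  (forall u : 'rV_k, u *m A = 0 -> u = 0) -> A \in unitmx.
Proof.
move=> inj; rewrite -row_free_unit -kermx_eq0; apply/eqP/row_matrixP => i.
rewrite row0; apply: inj; apply/sub_kermxP; exact: row_sub.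
Qed.

Lemma derive1_line (R : realType) (V W : normedModType R) (f : V -> W) w k :
  derive1 (fun t : R => f (w + t *: k)) 0 = derive f w k.
Proof.
rewrite /derive1 /derive; set d := (fun _ : R => _); set d' := (fun _ : R => _).
suff -> : d = d' by [].
by apply/funext => h; rewrite /d /d' /= addr0 scale0r addr0 [w + _]addrC.
Qed.

(* Keeps failing unifications from unfolding these constants to limits. *)
Local Opaque derive tcoord tvec.

Lemma pair0_sum (R : realType) (V : normedModType R) n (y : 'rV[R]_n) :
  (0 : V, y) = \sum_j y 0 j *: (0, delta_mx 0 j).
Proof.
apply: injective_projections.
  rewrite (raddf_sum (fst : {linear (V * 'rV[R]_n)%type -> V})) /=.
  by rewrite big1 // => j _; rewrite scaler0.
rewrite (raddf_sum (snd : {linear (V * 'rV[R]_n)%type -> 'rV[R]_n})) /=.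
exact: row_sum_delta.
Qed.

(** * The metric and the vertical projection in a chart *)

Section BilinearForm.
Context {R : realType} {n : nat}.
Implicit Types (G X : 'M[R]_n) (a b : 'rV[R]_n).

Definition bform G a b : R := (a *m G *m b^T) 0 0.

Lemma bformDl G a a' b : bform G (a + a') b = bform G a b + bform G a' b.
Proof. by rewrite /bform !mulmxDl mxE. Qed.

Lemma bformNl G a b : bform G (- a) b = - bform G a b.
Proof. by rewrite /bform !mulNmx mxE. Qed.

Lemma bformBl G a a' b : bform G (a - a') b = bform G a b - bform G a' b.
Proof. by rewrite bformDl bformNl. Qed.

Lemma bform_mulr G X a b : bform G a (b *m X) = bform (G *m X^T) a b.
Proof. by rewrite /bform trmx_mul !mulmxA. Qed.

Lemma bform_mull G X a b : bform G (a *m X) b = bform (X *m G) a b.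
Proof. by rewrite /bform !mulmxA. Qed.

End BilinearForm.

(** * The fundamental tensor as a matrix *)

Section Gram.
Context {R : realType} {n : nat} {M : manifold R n}.
Local Notation Z := ('rV[R]_n * 'rV[R]_n)%type.
Variables (A : tset M) (L : tfun M) (p : M) (U0 : set M).
Hypotheses (finsler : pseudo_finsler A L) (U0_open : open U0).
Hypothesis U0p : U0 `<=` chart_dom p.
Let O : set Z := tset_rep A U0 p.

Definition tfun_rep (z : Z) : R := let q := chart_inv p z.1 in L q (tvec p q z.2).

Let oO : open O.
Proof. exact: (open_tset_rep (adm_open finsler) U0_open). Qed.

Lemma smooth_tfun_rep : smooth_on O tfun_rep.
Proof.
have sL : smooth_tfun A L := finsler_smooth finsler.
apply: (smooth_on_subset _ (sL p)) => -[x y] [/= [q [pq _] <-] Az].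
by split=> //; exists q.
Qed.

Definition gram (z : Z) : 'M[R]_n := \matrix_(i, j)
  (2^-1 * derive (fun z => derive tfun_rep z (0, delta_mx 0 j)) z (0, delta_mx 0 i)).

Lemma smooth_gram : smooth_on O gram.
Proof.
apply: (smooth_on_mx oO) => i j; under eq_fun do rewrite mxE.
apply: (smooth_on_mul oO); first exact: smooth_on_cst.
exact: (smooth_on_derive _ (smooth_on_derive _ smooth_tfun_rep)).
Qed.

Lemma gram_sym z : O z -> (gram z)^T = gram z.
Proof.
move=> Oz; apply/matrixP => i j; rewrite [LHS]mxE [LHS]mxE [RHS]mxE.
exact: (congr1 ( *%R 2^-1)
  (derive_schwarz (0, delta_mx 0 i) (0, delta_mx 0 j) oO smooth_tfun_rep Oz)).
Qed.

(** [tvec p q] is linear, so affine lines in the fibre over q are affine lines of the chart, and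
    both derivatives of L become derivatives of [tfun_rep]; bilinearity then reduces to basis
    directions. *)
Lemma fund_tensor_chart q u e h : U0 q -> A q u ->
  fund_tensor L q u e h =
  bform (gram (tpt p q u)) (tcoord p q e) (tcoord p q h).
Proof.
move=> Uq Aq; have pq := U0p Uq; set z := tpt p q u.
have Oz : O z by exact: (tset_rep_tpt U0p).
set e' := tcoord p q e; set h' := tcoord p q h.
have T s t : tvec p q (tcoord p q u + s *: e' + t *: h') = u + s *: e + t *: h.
  have Te := etrans (tvecZ s e' pq) (congr1 ( *:%R s) (tcoordK e pq)).
  have Th := etrans (tvecZ t h' pq) (congr1 ( *:%R t) (tcoordK h pq)).
  have Tue := etrans (tvecD _ _ pq) (congr2 +%R (tcoordK u pq) Te).
  exact: (etrans (tvecD _ _ pq) (congr2 +%R Tue Th)).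
have E s t : L q (u + s *: e + t *: h) =
    tfun_rep (z + s *: (0, e') + t *: (0, h')).
  rewrite /tfun_rep /= !scaler0 !addr0 (chartK pq).
  by rewrite T.
have D1 : (fun s : R => derive1 (fun t : R => L q (u + s *: e + t *: h)) 0) =
    (fun s : R => derive tfun_rep (z + s *: (0, e')) (0, h')).
  apply/funext => s; rewrite -derive1_line; congr (derive1 _ 0).
  by apply/funext => t; exact: E.
rewrite /fund_tensor D1 (derive1_line (fun w => derive tfun_rep w (0, h'))).
have D2 : derive (fun w => derive tfun_rep w (0, h')) z (0, e') =
    derive (fun w => \sum_j h' 0 j *: derive tfun_rep w (0, delta_mx 0 j)) z (0, e').
  apply: near_eq_derive; have nO : nbhs z O by exact: open_nbhs_nbhs.
  apply: filterS nO => w Ow; rewrite [X in derive _ _ X]pair0_sum deriveE_sum //.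
  exact: (smooth_on_differentiable smooth_tfun_rep Ow).
have dj j : differentiable (fun w => derive tfun_rep w (0, delta_mx 0 j)) z.
  exact: (smooth_on_differentiable (smooth_on_derive _ smooth_tfun_rep) Oz).
have [|_ S] := @derive_fsum R Z R 'I_n (index_enum _)
    (fun j w => h' 0 j *: derive tfun_rep w (0, delta_mx 0 j)) z (0, e').
  by move=> j; exact: differentiableZ.
rewrite D2 S /bform mxE mulr_sumr; apply: eq_bigr => j _; rewrite !mxE.
rewrite deriveZ; last exact: diff_derivable.
rewrite [X in derive _ _ X]pair0_sum deriveE_sum; last exact: dj.
rewrite mulrCA -[LHS]/(h' 0 j * _) mulrC; congr (_ * _).
rewrite mulr_sumr; apply: eq_bigr => i _; rewrite mxE.
by rewrite -[X in _ * X]/(e' 0 i * _) mulrCA.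
Qed.

Lemma gram_unit z : O z -> gram z \in unitmx.
Proof.
move=> Oz; have [q [u [Uq Aq zE]]] := tset_repP Oz.
have pq := U0p Uq.
apply: row_inj_unitmx => e eG.
suff : tvec p q e = 0 by move=> E; rewrite -(tvecK e pq) E tcoord0.
apply: (finsler_nondegenerate finsler Aq) => // h _.
by rewrite fund_tensor_chart // -zE (tvecK _ pq) /bform eG mul0mx mxE.
Qed.

End Gram.

(** * The submersion in charts and the matrices of the vertical and horizontal projections *)

Section Submersion.
Context {R : realType} {m n : nat} {M : manifold R m} {B : manifold R n}.
Local Notation Z := ('rV[R]_m * 'rV[R]_m)%type.
Variables (A : tset M) (L : tfun M) (A' : tset B) (L' : tfun B) (sigma : M -> B) (p : M).
Hypotheses (finsler : pseudo_finsler A L)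
  (subm : pseudo_finsler_submersion sigma A L A' L')
  (vert_nondeg : forall p v, A p v ->
     nondegenerate_on (vertical sigma p) (fund_tensor L p v)).

Definition subm_dom : set M := chart_dom p `&` sigma @^-1` chart_dom (sigma p).
Local Notation U0 := subm_dom.
Let O : set Z := tset_rep A U0 p.

Lemma open_subm_dom : open U0.
Proof.
apply: openI; first exact: chart_dom_open.
by apply: open_comp (chart_dom_open (sigma p)) => z _; exact: (subm_smooth subm).1.
Qed.

Lemma subm_dom_self : U0 p.
Proof. by split; exact: chart_dom_self. Qed.

Lemma subm_dom_chart : U0 `<=` chart_dom p.
Proof. by move=> q []. Qed.

Definition subm_rep : 'rV[R]_m -> 'rV[R]_n := chart (sigma p) \o sigma \o chart_inv p.

Lemma smooth_subm_rep : smooth_on (chart p @` (chart_dom p `&` U0)) subm_rep.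
Proof.
apply: (smooth_on_subset _ ((subm_smooth subm).2 p (sigma p))).
by move=> _ [q [pq [_ sq]] <-]; exists q.
Qed.

Definition subm_jac (x : 'rV[R]_m) : 'M[R]_(m, n) :=
  \matrix_i derive subm_rep x (delta_mx 0 i).

Lemma mul_subm_jac q (e : 'rV[R]_m) : U0 q ->
  e *m subm_jac (chart p q) = derive subm_rep (chart p q) e.
Proof.
move=> Uq; rewrite [in RHS](row_sum_delta e) deriveE_sum; last first.
  apply: (smooth_on_differentiable smooth_subm_rep).
  by apply: chart_imageI => //; exact: subm_dom_chart.
by rewrite mulmx_sum_row; apply: eq_bigr => i _; rewrite rowK.
Qed.

Lemma tangent_map_chart q (e : 'rV[R]_m) : U0 q ->
  tangent_map sigma q e =
  tvec (sigma p) (sigma q) (tcoord p q e *m subm_jac (chart p q)).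
Proof.
move=> Uq; have pq := subm_dom_chart Uq; have sq : chart_dom (sigma p) (sigma q) by case: Uq.
have Ix : (chart p @` (chart_dom p `&` U0)) (chart p q) by exact: chart_imageI.
have ds : differentiable subm_rep (chart p q).
  exact: (smooth_on_differentiable smooth_subm_rep Ix).
have dc : differentiable (chart (sigma q) \o chart_inv (sigma p)) (chart (sigma p) (sigma q)).
  by apply: differentiable_transition => //; exact: chart_dom_self.
have sE : subm_rep (chart p q) = chart (sigma p) (sigma q).
  by rewrite /subm_rep /= (chartK pq).
pose f x := (chart (sigma q) \o chart_inv (sigma p)) (subm_rep x).
have nI := near_chart_image open_subm_dom pq Uq.
have fE : \forall x \near chart p q, f x = ((chart (sigma q) \o sigma) \o chart_inv p) x.
  apply: filterS nI => x /chart_image_dom[px [_ sx] _].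
  by rewrite /f /subm_rep /= (chartK sx).
have df : differentiable f (chart p q).
  by apply: (@differentiable_comp _ _ _ _ subm_rep _ (chart p q) ds); rewrite sE.
have dg := near_eq_differentiable fE df.
rewrite (mul_subm_jac _ Uq) tvecE -sE.
rewrite -(derive_comp (f := chart (sigma q) \o chart_inv (sigma p)) (g := subm_rep)
  (tcoord p q e) ds); last by rewrite sE.
rewrite (near_eq_derive (tcoord p q e) fE).
by rewrite (derive_tcoord (f := chart (sigma q) \o sigma) e pq dg).
Qed.

Lemma vertical_chart q (e : 'rV[R]_m) : U0 q ->
  vertical sigma q e <-> tcoord p q e *m subm_jac (chart p q) = 0.
Proof.
move=> Uq; have sq : chart_dom (sigma p) (sigma q) by case: Uq.
rewrite /vertical /mkset tangent_map_chart //; split=> [E|->]; last exact: tvec0.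
by rewrite -(tvecK (tcoord p q e *m _) sq) E tcoord0.
Qed.

Lemma subm_jac_surj q (y : 'rV[R]_n) : U0 q ->
  exists e : 'rV[R]_m, e *m subm_jac (chart p q) = y.
Proof.
move=> Uq; have sq : chart_dom (sigma p) (sigma q) by case: Uq.
have [e eE] := @subm_dsurj _ _ _ _ _ _ _ _ _ _ subm q (tvec (sigma p) (sigma q) y).
exists (tcoord p q e).
by rewrite -(tvecK (_ *m _) sq) -tangent_map_chart // eE tvecK.
Qed.

Local Notation gram := (gram L p).
Local Notation S z := (subm_jac z.1).

(** The dual metric on the annihilator of the vertical space: the columns of [S z] are the
    differentials of the coordinates of sigma. *)
Definition cogram (z : Z) : 'M[R]_n := (S z)^T *m invmx (gram z) *m S z.

Lemma smooth_subm_jac : smooth_on O (fun z => S z).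
Proof.
have oO : open O := open_tset_rep (adm_open finsler) open_subm_dom.
have oI := open_chart_image p open_subm_dom.
apply: (smooth_on_comp (@finite_coordinates_mx _ _ _) oO oI (F := subm_jac)).
- apply: (smooth_on_mx oI) => i j; under eq_fun do rewrite mxE.
  exact: (smooth_on_mxE 0 j oI (smooth_on_derive _ smooth_subm_rep)).
- have l : continuous (fst : Z -> 'rV[R]_m) by exact: continuous_fst.
  exact: (smooth_on_linear_comp oO l (smooth_on_id oO)).
- by move=> z [].
Qed.

(** If y is in the kernel, the vector [e] dual to the covector given by y is vertical, and as
    [e *m G = y *m S^T] it is also g-orthogonal to all vertical vectors. Non-degeneracy on the
    vertical space gives e = 0, and surjectivity of the differential of sigma gives y = 0. *)
Lemma cogram_unit z : O z -> cogram z \in unitmx.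
Proof.
move=> Oz; have [q [u [Uq Aq zE]]] := tset_repP Oz.
have pq := subm_dom_chart Uq.
have G1 : gram z \in unitmx by exact: (gram_unit finsler open_subm_dom subm_dom_chart Oz).
apply: row_inj_unitmx => y; rewrite /cogram !mulmxA => yK.
set e := y *m _ *m _ in yK.
have e0 : tvec p q e = 0.
  apply: (vert_nondeg Aq) => [|h /(vertical_chart _ Uq) hS].
    by apply/(vertical_chart _ Uq); rewrite (tvecK _ pq) -yK zE.
  rewrite (fund_tensor_chart finsler open_subm_dom subm_dom_chart _ _ Uq Aq) -zE.
  rewrite (tvecK _ pq) /bform /e (mulmxKV G1) -mulmxA -trmx_mul zE /= hS.
  by rewrite trmx0 mulmx0 mxE.
have {}e0 : e = 0 by rewrite -(tvecK e pq) e0 tcoord0.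
have yS : y *m (S z)^T = 0 by rewrite -[LHS](mulmxKV G1) -/e e0 mul0mx.
apply/rowP => j; rewrite mxE.
have [f fS] := subm_jac_surj (delta_mx 0 j) Uq.
have : (f *m (y *m (S z)^T)^T) 0 0 = 0 by rewrite yS trmx0 mulmx0 mxE.
by rewrite trmx_mul trmxK mulmxA zE /= fS -rowE !mxE.
Qed.

(* The g-horizontal vectors are the y *m S^T *m G^-1, whence the projection. *)
Definition hproj (z : Z) : 'M[R]_m :=
  S z *m invmx (cogram z) *m (S z)^T *m invmx (gram z).
Definition vproj (z : Z) : 'M[R]_m := 1%:M - hproj z.

Lemma smooth_hproj : smooth_on O hproj.
Proof.
have oO : open O := open_tset_rep (adm_open finsler) open_subm_dom.
have sG := smooth_on_invmx oO (gram_unit finsler open_subm_dom subm_dom_chart)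
  (smooth_gram finsler open_subm_dom (p := p)).
have sS := smooth_subm_jac.
have sT := smooth_on_tr oO sS.
have sK := smooth_on_mulmx oO (smooth_on_mulmx oO sT sG) sS.
have sI := smooth_on_invmx oO cogram_unit sK.
exact: (smooth_on_mulmx oO (smooth_on_mulmx oO (smooth_on_mulmx oO sS sI) sT) sG).
Qed.

Lemma smooth_vproj : smooth_on O vproj.
Proof.
have oO : open O := open_tset_rep (adm_open finsler) open_subm_dom.
exact: (smooth_on_sub oO (smooth_on_cst _ oO) smooth_hproj).
Qed.

Lemma vproj_jac z : O z -> vproj z *m S z = 0.
Proof.
move=> Oz; rewrite mulmxBl mul1mx /hproj -!mulmxA [X in _ *m (_ *m X)]mulmxA.
by rewrite -/(cogram z) (mulVmx (cogram_unit Oz)) mulmx1 subrr.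
Qed.

Lemma hproj_idem z : O z -> hproj z *m hproj z = hproj z.
Proof.
move=> Oz; have := vproj_jac Oz; rewrite mulmxBl mul1mx => /subr0_eq E.
by rewrite {2}/hproj !mulmxA -E.
Qed.

Lemma vproj_idem z : O z -> vproj z *m vproj z = vproj z.
Proof.
by move=> Oz; rewrite mulmxBl mul1mx mulmxBr mulmx1 hproj_idem // subrr subr0.
Qed.

Lemma hproj_gram z : O z -> hproj z *m gram z = gram z *m (hproj z)^T.
Proof.
move=> Oz; have G1 : gram z \in unitmx by exact: (gram_unit finsler open_subm_dom subm_dom_chart Oz).
have Gs : (gram z)^T = gram z by exact: (gram_sym finsler open_subm_dom Oz).
have Ks : (cogram z)^T = cogram z.
  by rewrite /cogram !trmx_mul trmxK trmx_inv Gs mulmxA.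
rewrite /hproj (mulmxKV G1) !trmx_mul trmxK !trmx_inv Gs Ks (mulKVmx G1).
by rewrite mulmxA.
Qed.

Lemma vproj_gram z : O z -> vproj z *m gram z = gram z *m (vproj z)^T.
Proof.
move=> Oz; rewrite mulmxBl mul1mx (hproj_gram Oz).
by rewrite linearB /= trmx1 mulmxBr mulmx1.
Qed.

Lemma hproj_horizontal z (a h : 'rV[R]_m) : O z -> h *m S z = 0 ->
  bform (gram z) (a *m hproj z) h = 0.
Proof.
move=> Oz hS; have G1 : gram z \in unitmx.
  exact: (gram_unit finsler open_subm_dom subm_dom_chart Oz).
rewrite bform_mull /hproj (mulmxKV G1) /bform -!mulmxA -trmx_mul hS.
by rewrite trmx0 !mulmx0 mxE.
Qed.

(** [vpart] is a choice among decompositions, so nothing about its smoothness is visible. [vproj]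
    provides a decomposition, and non-degeneracy on the vertical space makes it unique; hence the
    choice is this smooth matrix. *)
Lemma vpart_chart q u (e : 'rV[R]_m) : U0 q -> A q u ->
  tcoord p q (vpart sigma L q u e) = tcoord p q e *m vproj (tpt p q u).
Proof.
move=> Uq Aq; have pq := subm_dom_chart Uq; set z := tpt p q u.
have Oz : O z by exact: (tset_rep_tpt subm_dom_chart).
have gE := fund_tensor_chart finsler open_subm_dom subm_dom_chart _ _ Uq Aq.
have G1 : gram z \in unitmx by exact: (gram_unit finsler open_subm_dom subm_dom_chart Oz).
pose w := tvec p q (tcoord p q e *m vproj z).
have wv : vertical sigma q w.
  by apply/(vertical_chart _ Uq); rewrite (tvecK _ pq) -mulmxA (vproj_jac Oz) mulmx0.
have wh : g_horizontal sigma L q u (e - w).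
  move=> h /(vertical_chart _ Uq) hS; rewrite gE (tcoordB _ _ pq) (tvecK _ pq).
  have -> : tcoord p q e - tcoord p q e *m vproj z = tcoord p q e *m hproj z.
    by rewrite mulmxBr mulmx1 opprB addrC subrK.
  exact: hproj_horizontal.
have [v0 h0] : (vertical sigma q `&` [set w | g_horizontal sigma L q u (e - w)])
    (vpart sigma L q u e).
  by apply: (@getI _ _ w).
suff d0 : vpart sigma L q u e - w = 0.
  by rewrite (subr0_eq d0) (tvecK _ pq).
have v1 := (vertical_chart _ Uq).1 v0; have w1 := (vertical_chart _ Uq).1 wv.
apply: (vert_nondeg Aq) => [|h hv].
  by apply/(vertical_chart _ Uq); rewrite (tcoordB _ _ pq) mulmxBl v1 w1 subrr.
have E1 := wh h hv; have E2 := h0 h hv.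
rewrite gE (tcoordB _ _ pq) bformBl in E1; rewrite gE (tcoordB _ _ pq) bformBl in E2.
rewrite gE (tcoordB _ _ pq) bformBl.
by rewrite -(subr0_eq E1) -(subr0_eq E2) subrr.
Qed.

Lemma hpart_chart q u (e : 'rV[R]_m) : U0 q -> A q u ->
  tcoord p q (hpart sigma L q u e) = tcoord p q e *m hproj (tpt p q u).
Proof.
move=> Uq Aq; rewrite /hpart tcoordB; last exact: subm_dom_chart.
by rewrite vpart_chart // mulmxBr mulmx1 opprB addrC subrK.
Qed.

End Submersion.

(** * Curvatures and covariant derivatives in a chart *)

Section DeriveScale.
Context {R : realType} {V : normedModType R}.

Lemma derive_fscale k l (f : V -> R) (F : V -> 'M[R]_(k, l)) x u :
  differentiable f x -> differentiable F x ->
  differentiable (fun y => f y *: F y) x /\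
  derive (fun y => f y *: F y) x u = derive f x u *: F x + f x *: derive F x u.
Proof.
move=> df dF; have dfF : differentiable (fun y => f y *: F y) x.
  apply: differentiable_mx => i j; under eq_fun do rewrite mxE.
  by apply: differentiableM => //; exact: differentiable_mxE.
split=> //; apply/matrixP => i j; rewrite derive_mxE // !mxE.
under eq_fun do rewrite mxE.
rewrite derive_fM //; last exact: differentiable_mxE.
by rewrite derive_mxE.
Qed.

(** Leibniz rule for a tensor applied to a moving argument. Linearity in that argument is assumed on
    O only and in coordinates, because chi is a directional derivative of P and Q, known to be
    linear in its argument only where these are differentiable. *)
Lemma derive_family n k l (O : set V) (Y : V -> 'rV[R]_n -> 'M[R]_(k, l))
    (c : V -> 'rV[R]_n) x u : open O -> O x ->
  (forall y, O y -> forall b, Y y b = \sum_i b 0 i *: Y y (delta_mx 0 i)) ->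
  (forall b, differentiable (Y ^~ b) x) -> differentiable c x ->
  derive (fun y => Y y (c y)) x u = derive (Y ^~ (c x)) x u + Y x (derive c x u).
Proof.
move=> oO Ox YE dY dc; have nO : nbhs x O by exact: open_nbhs_nbhs.
have dci i : differentiable (fun y => c y 0 i) x by exact: differentiable_mxE.
transitivity (derive (fun y => \sum_i c y 0 i *: Y y (delta_mx 0 i)) x u).
  by apply: near_eq_derive; apply: filterS nO => y Oy; exact: YE.
have [|_ ->] := @derive_fsum R V 'M[R]_(k, l) 'I_n (index_enum _)
    (fun i y => c y 0 i *: Y y (delta_mx 0 i)) x u.
  by move=> i; exact: (derive_fscale u (dci i) (dY _)).1.
rewrite (YE x Ox (derive c x u)).
have -> : derive (Y ^~ (c x)) x u =
    derive (fun y => \sum_i c x 0 i *: Y y (delta_mx 0 i)) x u.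
  by apply: near_eq_derive; apply: filterS nO => y Oy; exact: YE.
have [|_ ->] := @derive_fsum R V 'M[R]_(k, l) 'I_n (index_enum _)
    (fun i y => c x 0 i *: Y y (delta_mx 0 i)) x u.
  by move=> i; exact: differentiableZ.
rewrite -big_split /=; apply: eq_bigr => i _.
rewrite (derive_fscale u (dci i) (dY _)).2 [LHS]addrC derive_mxE //; congr (_ + _).
by rewrite [RHS](deriveZ (f := Y ^~ (delta_mx 0 i))) //; exact: diff_derivable (dY _).
Qed.

Lemma derive_cmul k l r (a : 'M[R]_(k, l)) (F : V -> 'M[R]_(l, r)) x u :
  differentiable F x -> derive (fun y => a *m F y) x u = a *m derive F x u.
Proof.
move=> dF; rewrite (derive_mulmx (F := fun=> a) u (differentiable_cst a x) dF).
by rewrite [X in X *m _](derive_cst a x u) mul0mx add0r.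
Qed.

End DeriveScale.

(** * Curvature, projected curvature and derivatives of tensors in coordinates *)

Section LocalCalculus.
Context {R : realType} {m : nat} {M : manifold R m}.
Local Notation Z := ('rV[R]_m * 'rV[R]_m)%type.
Variables (A : tset M) (nabla : vfield M -> vfield M -> avfield M).
Variables (p : M) (U0 : set M).
Hypotheses (A_open : open_tset A) (conn : anisotropic_connection A nabla).
Hypotheses (U0_open : open U0) (U0p : U0 `<=` chart_dom p) (U0pp : U0 p).
Let O : set Z := tset_rep A U0 p.
Local Notation rep := (avrep A p U0).
Local Notation chr := (chr nabla p).
Local Notation hlift := (hlift p nabla).

Let oO : open O := open_tset_rep A_open U0_open.

Definition const_field (e : 'rV[R]_m) : vfield M := tvec p ^~ e.

Lemma smooth_const_field_sub (e : 'rV[R]_m) : smooth_vfield U0 (const_field e).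
Proof. exact: (smooth_vfield_subset U0p (smooth_const_field p e)). Qed.

Lemma avrep_self X F v : rep X F -> A p v -> X p v = F (tpt p p v).
Proof. by move=> XF Av; rewrite -(XF p v U0pp Av) tcoord_self. Qed.

Lemma smooth_derive_hlift k l (F : Z -> 'M[R]_(k, l)) e : smooth_on O F ->
  smooth_on O (fun z => derive F z (hlift z e)).
Proof.
move=> sF.
have sN := smooth_hlift A_open U0_open conn (smooth_on_cst e oO).
exact: (smooth_on_derive_along finite_coordinates_tangent oO sF sN).
Qed.

Lemma smooth_chr_const e : smooth_on O (fun z => chr z e).
Proof. exact: (smooth_chr A_open U0_open conn (smooth_on_cst e oO)). Qed.

Lemma avrep_cov X F e : rep X F -> smooth_on O F ->
  rep (cov nabla (const_field e) X)
    (fun z => derive F z (hlift z e) + F z *m chr z e).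
Proof.
move=> XF sF q u Uq Aq.
have := cov_chart A_open U0_open U0p conn XF sF U0_open (fun _ h => h)
  (smooth_const_field_sub e) Uq Aq.
by rewrite (tvecK e (U0p Uq)).
Qed.

Lemma avrep_nabla e h :
  rep (nabla (const_field e) (const_field h)) (fun z => h *m chr z e).
Proof.
move=> q u Uq Aq; have pq := U0p Uq.
rewrite (nabla_chart conn U0_open U0p (smooth_const_field_sub e)
  (smooth_const_field_sub h) Uq Aq).
have -> : tcoord p q (const_field e q) = e by exact: tvecK.
have -> : tcoord p q (const_field h q) = h by exact: tvecK.
rewrite -[RHS]add0r; congr (_ + _).
rewrite -[RHS](derive_cst h (chart p q) e); apply: near_eq_derive.
apply: filterS (near_chart_image U0_open pq Uq) => x [r [pr _] <-].
by apply: vfield_rep_const; exists r.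
Qed.

Lemma smooth_lie_bracket_const b e :
  smooth_vfield U0 (lie_bracket (const_field b) (const_field e)).
Proof.
apply: (eq_smooth_vfield U0_open _ (smooth_vfield0 U0_open)) => q Uq.
by rewrite lie_bracket_const //; exact: U0p.
Qed.

Lemma chr0 z : chr z 0 = 0.
Proof. exact: linear0. Qed.

Lemma hlift0 z : hlift z 0 = 0.
Proof. exact: linear0. Qed.

Lemma cov_bracket X F b e v : rep X F -> smooth_on O F -> A p v ->
  cov nabla (lie_bracket (const_field b) (const_field e)) X p v = 0.
Proof.
move=> XF sF Av; have := cov_chart A_open U0_open U0p conn XF sF U0_open (fun _ h => h)
  (smooth_lie_bracket_const b e) U0pp Av.
rewrite lie_bracket_const; last exact: chart_dom_self.
by rewrite tcoord_self tcoord0 chr0 hlift0 derive0 mulmx0 addr0.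
Qed.

Lemma nabla_bracket b e h v : A p v ->
  nabla (lie_bracket (const_field b) (const_field e)) (const_field h) p v = 0.
Proof.
move=> Av; have := nabla_chart conn U0_open U0p
  (smooth_lie_bracket_const b e) (smooth_const_field_sub h) U0pp Av.
rewrite lie_bracket_const; last exact: chart_dom_self.
by rewrite tcoord_self tcoord0 chr0 derive0 mulmx0 addr0.
Qed.

Variable v : 'rV[R]_m.
Hypothesis Av : A p v.
Local Notation z0 := (tpt p p v).

Let Oz0 : O z0.
Proof. exact: (tset_rep_tpt U0p). Qed.

Definition dchr b e : 'M[R]_m := derive (fun z => chr z e) z0 (hlift z0 b).

(** The classical formula dC + [C, C], with derivatives taken along horizontal lifts. The bracket
    term disappears since the extensions commute. *)
Lemma curvature_chart b e h : curvature nabla p v b e h =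
  h *m dchr b e + h *m chr z0 e *m chr z0 b
  - (h *m dchr e b + h *m chr z0 b *m chr z0 e).
Proof.
have aux b' e' : cov nabla (const_field b') (nabla (const_field e') (const_field h)) p v =
    h *m dchr b' e' + h *m chr z0 e' *m chr z0 b'.
  have s : smooth_on O (fun z => h *m chr z e').
    exact: (smooth_on_mulmx oO (smooth_on_cst h oO) (smooth_chr_const e')).
  rewrite (avrep_self (avrep_cov b' (avrep_nabla e' h) s) Av) derive_cmul //.
  exact: (smooth_on_differentiable (smooth_chr_const e') Oz0).
rewrite -[LHS]/(cov nabla (const_field b) (nabla (const_field e) (const_field h)) p v
  - cov nabla (const_field e) (nabla (const_field b) (const_field h)) p v
  - nabla (lie_bracket (const_field b) (const_field e)) (const_field h) p v).
by rewrite !aux nabla_bracket // subr0.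
Qed.

(** The inner derivative of a projected curvature: h is extended with constant coordinates,
    projected by Y, differentiated along e and projected again. *)
Definition proj_cov (Y : Z -> 'M[R]_m) (h e : 'rV[R]_m) (z : Z) : 'rV[R]_m :=
  (h *m derive Y z (hlift z e) + h *m Y z *m chr z e) *m Y z.

Lemma smooth_proj_cov Y h e : smooth_on O Y -> smooth_on O (proj_cov Y h e).
Proof.
move=> sY; have sh := smooth_on_cst h oO.
apply: (smooth_on_mulmx oO _ sY); apply: (smooth_on_add oO).
  exact: (smooth_on_mulmx oO sh (smooth_derive_hlift e sY)).
exact: (smooth_on_mulmx oO (smooth_on_mulmx oO sh sY) (smooth_chr_const e)).
Qed.

Lemma proj_curvature_chart Pr Y b e h : smooth_on O Y ->
  (forall q u k, U0 q -> A q u -> tcoord p q (Pr q u k) = tcoord p q k *m Y (tpt p q u)) ->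
  proj_curvature nabla Pr p v b e h =
  (derive (proj_cov Y h e) z0 (hlift z0 b) + proj_cov Y h e z0 *m chr z0 b
   - (derive (proj_cov Y h b) z0 (hlift z0 e) + proj_cov Y h b z0 *m chr z0 e))
  *m Y z0.
Proof.
move=> sY PrY; pose PH : avfield M := fun q w => Pr q w (const_field h q).
have PHr : rep PH (fun z => h *m Y z).
  by move=> q u Uq Aq; rewrite PrY // (tvecK h (U0p Uq)).
have sPH : smooth_on O (fun z => h *m Y z).
  exact: (smooth_on_mulmx oO (smooth_on_cst h oO) sY).
have aux b' e' : cov nabla (const_field b')
      (fun q w => Pr q w (cov nabla (const_field e') PH q w)) p v =
    derive (proj_cov Y h e') z0 (hlift z0 b') + proj_cov Y h e' z0 *m chr z0 b'.
  have r : rep (fun q w => Pr q w (cov nabla (const_field e') PH q w)) (proj_cov Y h e').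
    move=> q u Uq Aq; rewrite PrY // (avrep_cov e' PHr sPH Uq Aq) derive_cmul //.
    by apply: (smooth_on_differentiable sY); exact: (tset_rep_tpt U0p).
  by rewrite (avrep_self (avrep_cov b' r (smooth_proj_cov h e' sY)) Av).
rewrite -[LHS]/(Pr p v (
  cov nabla (const_field b) (fun q w => Pr q w (cov nabla (const_field e) PH q w)) p v
  - cov nabla (const_field e) (fun q w => Pr q w (cov nabla (const_field b) PH q w)) p v
  - cov nabla (lie_bracket (const_field b) (const_field e)) PH p v)).
rewrite !aux (cov_bracket b e PHr sPH Av) subr0.
by rewrite -[LHS](tcoord_self p) PrY // tcoord_self.
Qed.

Lemma cov_tensor_chart (T : M -> 'rV[R]_m -> 'rV[R]_m -> 'rV[R]_m -> 'rV[R]_m)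
    (X : Z -> 'rV[R]_m -> 'M[R]_m) (Y : Z -> 'M[R]_m) h b e :
  (forall q u b e, U0 q -> A q u -> tcoord p q (T q u b e) =
     tcoord p q e *m X (tpt p q u) (tcoord p q b *m Y (tpt p q u))) ->
  smooth_on O Y ->
  (forall k : Z -> 'rV[R]_m, smooth_on O k -> smooth_on O (fun z => X z (k z))) ->
  (forall z, O z -> forall b, X z b = \sum_i b 0 i *: X z (delta_mx 0 i)) ->
  cov_tensor nabla T p v h b e =
    e *m (derive (X ^~ (b *m Y z0)) z0 (hlift z0 h)
          + X z0 (b *m derive Y z0 (hlift z0 h)))
    + e *m X z0 (b *m Y z0) *m chr z0 h
    - e *m X z0 (b *m chr z0 h *m Y z0)
    - e *m chr z0 h *m X z0 (b *m Y z0).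
Proof.
move=> TX sY sX XE; have dY := smooth_on_differentiable sY Oz0.
have sbY : smooth_on O (fun z => b *m Y z).
  exact: (smooth_on_mulmx oO (smooth_on_cst b oO) sY).
have sXY := sX _ sbY.
have sF : smooth_on O (fun z => e *m X z (b *m Y z)).
  exact: (smooth_on_mulmx oO (smooth_on_cst e oO) sXY).
have r : rep (fun q w => T q w (const_field b q) (const_field e q))
    (fun z => e *m X z (b *m Y z)).
  by move=> q u Uq Aq; rewrite TX // !(tvecK _ (U0p Uq)).
have TE b' e' : T p v b' e' = e' *m X z0 (b' *m Y z0).
  by rewrite -[LHS](tcoord_self p) TX // !tcoord_self.
rewrite -[LHS]/(
  cov nabla (const_field h) (fun q w => T q w (const_field b q) (const_field e q)) p v
  - T p v (nabla (const_field h) (const_field b) p v) e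
  - T p v b (nabla (const_field h) (const_field e) p v)).
rewrite (avrep_self (avrep_cov h r sF) Av) !(avrep_self (avrep_nabla _ _) Av) !TE.
rewrite derive_cmul; last exact: (smooth_on_differentiable sXY Oz0).
rewrite (derive_family (Y := X) (c := fun z => b *m Y z) _ oO Oz0 XE).
- by rewrite derive_cmul.
- move=> k; exact: (smooth_on_differentiable (sX _ (smooth_on_cst k oO)) Oz0).
- exact: (smooth_on_differentiable sbY Oz0).
Qed.

End LocalCalculus.

Arguments smooth_const_field_sub {R m M p U0} U0p e.

(** * The O'Neill tensors *)

Section ProjectionAlgebra.
Context {R : realType} {m : nat}.
Implicit Types (Y Yc D C G DG X : 'M[R]_m) (h : 'rV[R]_m).

(** [D] is the derivative of the projection [Y] and [X] is chi. Multiplying [D *m Y + Y *m D = D] by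
    [h = h *m Y] gives [h *m D *m Y = 0], so on the range of Y chi is the [Yc]-part of the covariant
    derivative of [h *m Y]. The names are neutral because Y is P for vertical vectors and Q for
    horizontal ones. *)
Lemma proj_shape Y Yc D C X h : Y *m Y = Y -> Yc = 1%:M - Y ->
  D *m Y + Y *m D = D ->
  X = (- D + Yc *m C) *m Y + (D + Y *m C) *m Yc -> h *m Y = h ->
  h *m X = h *m D + h *m C - h *m C *m Y /\ h *m X *m Yc = h *m X.
Proof.
move=> YY YcE DY XE hY.
have hYc : h *m Yc = 0 by rewrite YcE mulmxBr mulmx1 hY subrr.
have hDY : h *m D *m Y = 0.
  apply: (@addIr _ (h *m D)); rewrite add0r -[in RHS]DY mulmxDr !mulmxA hY.
  by rewrite addrC.
have E : h *m X = h *m D + h *m C - h *m C *m Y.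
  rewrite XE mulmxDr !mulmxA !mulmxDr !mulmxA mulmxN hYc mul0mx addr0 hY.
  by rewrite YcE mulNmx hDY oppr0 add0r mulmxBr mulmx1 mulmxDl hDY add0r.
split=> //; rewrite YcE mulmxBr mulmx1 {2}E mulmxBl mulmxDl hDY add0r.
by rewrite -(mulmxA (h *m C) Y Y) YY subrr subr0.
Qed.

(** The subtracted matrix is chi and [E] is the derivative of Q. Removing chi removes the terms
    mixing the two ranges, so the P-part of (nabla - chi) h is the projected derivative of [h *m P];
    [proj_shape_r] is the analogue for Q. *)
Lemma proj_shape_l P Q D E C : Q *m Q = Q -> P = 1%:M - Q -> E = - D ->
  C *m P - ((E + Q *m C) *m P + (D + P *m C) *m Q) *m P = (D + P *m C) *m P.
Proof.
move=> QQ PE ->; have QP : Q *m P = 0 by rewrite PE mulmxBr mulmx1 QQ subrr.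
have PP : P *m P = P by rewrite {1}PE mulmxBl mul1mx QP subr0.
rewrite mulmxDl -!(mulmxA _ P P) -!(mulmxA _ Q P) QP PP mulmx0 addr0 -mulmxBl.
congr (_ *m _); rewrite opprD opprK addrCA; congr (_ + _).
by rewrite PE mulmxBl mul1mx.
Qed.

Lemma proj_shape_r P Q D E C : Q *m Q = Q -> P = 1%:M - Q -> E = - D ->
  C *m Q - ((E + Q *m C) *m P + (D + P *m C) *m Q) *m Q = (E + Q *m C) *m Q.
Proof.
move=> QQ PE ->; have PQ : P *m Q = 0 by rewrite PE mulmxBl mul1mx QQ subrr.
rewrite mulmxDl -!(mulmxA _ Q Q) -!(mulmxA _ P Q) PQ QQ mulmx0 add0r -mulmxBl.
congr (_ *m _); rewrite opprD addrCA; congr (_ + _).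
by rewrite PE mulmxBl mul1mx opprB addrC subrK.
Qed.

(** The second derivative in the same comparison: [y] is (nabla - chi) h and [d] its derivative. The
    P- and Q-parts of y are differentiated and projected separately; the cross parts that get lost
    add up to chi. *)
Lemma proj_sum P Q D E C (y d : 'rV[R]_m) : Q *m Q = Q -> P = 1%:M - Q -> E = - D ->
  (d *m P + y *m (D + P *m C)) *m P + (d *m Q + y *m (E + Q *m C)) *m Q =
  d + y *m (C - ((E + Q *m C) *m P + (D + P *m C) *m Q)).
Proof.
move=> QQ PE ->; have PP : P *m P = P.
  by rewrite PE mulmxBl mul1mx mulmxBr mulmx1 QQ subrr subr0.
rewrite [X in X + _]mulmxDl [X in _ + X]mulmxDl addrACA; congr (_ + _).
  by rewrite -!mulmxA PP QQ -mulmxDr PE subrK mulmx1.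
rewrite -!mulmxA -mulmxDr; congr (_ *m _).
set a := D + _; set b := - D + _.
have ab : a + b = C by rewrite addrACA subrr add0r -mulmxDl PE subrK mul1mx.
have S : (a *m P + b *m Q) + (b *m P + a *m Q) = C.
  rewrite addrACA -!mulmxDl ab [b + a]addrC ab -mulmxDr PE subrK mulmx1 //.
by rewrite -[in RHS]S addrK.
Qed.

(** [N] is the covariant derivative of the endomorphism P. As P is g-symmetric and g is parallel, N
    is g-symmetric; as P is idempotent, [N *m P + P *m N = N], so N anticommutes with the
    g-symmetric reflection 1 - 2P. Now X is N times this reflection, and a product of two
    anticommuting symmetric maps is skew. *)
Lemma proj_skew P Q D C G DG X : P *m P = P -> Q = 1%:M - P ->
  D *m P + P *m D = D -> P *m G = G *m P^T ->
  D *m G + P *m DG = DG *m P^T + G *m D^T -> DG = C *m G + G *m C^T ->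
  X = (- D + Q *m C) *m P + (D + P *m C) *m Q -> X *m G = - (G *m X^T).
Proof.
move=> PP QE DP PG DPG DGE XE; pose N := D + P *m C - C *m P.
have NPE : N *m P = D *m P + P *m C *m P - C *m P.
  by rewrite /N mulmxBl mulmxDl -(mulmxA C P P) PP.
have PNE : P *m N = P *m D + P *m C - P *m C *m P.
  by rewrite /N mulmxBr mulmxDr !mulmxA PP.
have NP : P *m N = N - N *m P.
  rewrite PNE NPE /N; move: DP.
  move: (D *m P) (P *m D) (P *m C *m P) (P *m C) (C *m P) => a b c d e <-.
  by apply/matrixP => i j; rewrite !mxE; ring.
have XN : X = N - N *m P - N *m P.
  have E1 : Q *m C *m P = C *m P - P *m C *m P by rewrite QE mulmxBl mul1mx mulmxBl.
  rewrite XE mulmxDl E1 mulNmx QE mulmxBr mulmx1 mulmxDl NPE /N.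
  move: (D *m P) (P *m C *m P) (P *m C) (C *m P) => a c d e.
  by apply/matrixP => i j; rewrite !mxE; ring.
have NG : N *m G = G *m N^T.
  have E1 : N *m G = D *m G + P *m C *m G - C *m G *m P^T.
    by rewrite /N mulmxBl mulmxDl -(mulmxA C P G) PG mulmxA.
  have E2 : G *m N^T = G *m D^T + G *m C^T *m P^T - G *m P^T *m C^T.
    have -> : N^T = D^T + C^T *m P^T - P^T *m C^T.
      by rewrite -!trmx_mul -linearD -linearB.
    by rewrite mulmxBr mulmxDr !mulmxA.
  have E3 : P *m DG = P *m C *m G + G *m P^T *m C^T.
    by rewrite DGE mulmxDr !mulmxA PG.
  have E4 : DG *m P^T = C *m G *m P^T + G *m C^T *m P^T by rewrite DGE mulmxDl.
  move: DPG; rewrite E1 E2 E3 E4.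
  move: (D *m G) (P *m C *m G) (C *m G *m P^T) (G *m D^T) (G *m C^T *m P^T)
    (G *m P^T *m C^T) => a b c d e f /matrixP E.
  by apply/matrixP => i j; have := E i j; rewrite !mxE => {}E; lra.
have XP : X = - (N - P *m N - P *m N).
  by rewrite XN NP; move: (N *m P) => a; apply/matrixP => i j; rewrite !mxE; ring.
have XT : X^T = - (N^T - N^T *m P^T - N^T *m P^T).
  by rewrite XP -!trmx_mul -2!linearB; exact: raddfN.
rewrite XT mulmxN opprK !mulmxBr !mulmxA -NG -!(mulmxA N G) -PG XN !mulmxBl.
by rewrite !mulmxA.
Qed.

End ProjectionAlgebra.

Lemma frame_derivative (R : pzRingType) m n (a b c : 'rV[R]_n) (C dC V : 'M[R]_(n, m))
    (D Q : 'M[R]_m) : C *m Q = C -> V *m Q = V ->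
  (a *m C + b *m dC + c *m V + b *m C *m D) *m Q =
  a *m C + b *m ((dC + C *m D) *m Q) + c *m V.
Proof.
move=> CQ VQ; rewrite addrAC -(addrA (a *m C)) !mulmxDl.
by rewrite -(mulmxA a) -(mulmxA c) CQ VQ -!mulmxA -mulmxDr.
Qed.

Lemma bform_delta (R : realType) n (G : 'M[R]_n) i j :
  bform G (delta_mx 0 i) (delta_mx 0 j) = G i j.
Proof. by rewrite /bform trmx_delta -rowE -colE !mxE. Qed.

(** Expansion of the curvature of nabla = (nabla - chi) + chi. [Cbe] and [Xbe] are the derivatives
    along b of the matrices of nabla_e and chi_e. [K] is chi at the common value of nabla_b e and
    nabla_e b, and cancels. *)
Lemma curvature_algebra (R : comNzRingType) m (h : 'rV[R]_m)
    (Cbe Ceb Xbe Xeb Cb Ce Xb Xe K : 'M[R]_m) :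
  h *m Cbe + h *m Ce *m Cb - (h *m Ceb + h *m Cb *m Ce) =
  h *m Cbe - h *m Xbe + (h *m Ce - h *m Xe) *m (Cb - Xb)
  - (h *m Ceb - h *m Xeb + (h *m Cb - h *m Xb) *m (Ce - Xe))
  + (h *m Xbe + h *m Xe *m Cb - h *m K - h *m Cb *m Xe)
  - (h *m Xeb + h *m Xb *m Ce - h *m K - h *m Ce *m Xb)
  - h *m Xe *m Xb + h *m Xb *m Xe.
Proof.
rewrite !mulmxBl !mulmxBr.
move: (h *m Cbe) (h *m Ceb) (h *m Xbe) (h *m Xeb) (h *m K) => a1 a2 a3 a4 a5.
move: (h *m Ce *m Cb) (h *m Cb *m Ce) (h *m Xe *m Cb) (h *m Xb *m Ce)
  (h *m Ce *m Xb) (h *m Cb *m Xe) (h *m Xe *m Xb) (h *m Xb *m Xe)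
  => c1 c2 c3 c4 c5 c6 c7 c8.
by apply/rowP => i; rewrite !mxE; ring.
Qed.

Lemma cov_tensor_algebra (R : comNzRingType) m (h : 'rV[R]_m)
    (C D X Xc Xd Xp : 'M[R]_m) :
  h *m (D + Xd) + h *m X *m C - h *m Xp - h *m C *m X =
  h *m D + h *m X *m C - h *m Xc - h *m C *m X + h *m (Xd + Xc - Xp).
Proof.
rewrite mulmxBr !mulmxDr.
move: (h *m D) (h *m Xd) (h *m X *m C) (h *m Xp) (h *m C *m X) (h *m Xc)
  => a b c d e f.
by apply/rowP => i; rewrite !mxE; ring.
Qed.

(** [r] and [r'] are the terms quadratic in chi, moved to the other side of g by skewness; [q] is
    what the derivative of T (or A) has in excess of that of T + A. *)
Lemma bform_flag (R : realType) m (G : 'M[R]_m) (k d d' q r r' v : 'rV[R]_m) (s s' : R) :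
  bform G r v = - s -> bform G r' v = - s' ->
  bform G (k + d - d' - r + r') v =
  bform G k v + bform G (d + q - d') v + (- bform G q v + s - s').
Proof. by move=> E E'; rewrite !bformDl !bformNl E E'; ring. Qed.

(** * The O'Neill tensors in coordinates and the comparison of curvatures *)

Section ONeill.
Context {R : realType} {m n : nat} {M : manifold R m} {B : manifold R n}.
Local Notation Z := ('rV[R]_m * 'rV[R]_m)%type.
Variables (A : tset M) (L : tfun M) (A' : tset B) (L' : tfun B) (sigma : M -> B) (p : M).
Variable nabla : vfield M -> vfield M -> avfield M.
Hypotheses (finsler : pseudo_finsler A L)
  (subm : pseudo_finsler_submersion sigma A L A' L')
  (vert_nondeg : forall p v, A p v ->
     nondegenerate_on (vertical sigma p) (fund_tensor L p v))
  (lcc : levi_civita_chern nabla A L).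

Local Notation U0 := (subm_dom sigma p).
Let O : set Z := tset_rep A U0 p.
Local Notation P := (vproj L sigma p).
Local Notation Q := (hproj L sigma p).
Local Notation chr := (chr nabla p).
Local Notation hlift := (hlift p nabla).

Let conn : anisotropic_connection A nabla := lc_connection lcc.
Let oA : open_tset A := adm_open finsler.
Let oU0 : open U0 := open_subm_dom p subm.
Let oO : open O := open_tset_rep oA oU0.
Let U0p : U0 `<=` chart_dom p := @subm_dom_chart _ _ _ _ _ sigma p.
Let U0pp : U0 p := subm_dom_self sigma p.
Let sP : smooth_on O P := smooth_vproj finsler subm vert_nondeg.
Let sQ : smooth_on O Q := smooth_hproj finsler subm vert_nondeg.

(* chi^v_k e is e *m chi_mx z k: the nabla_k (e *m Q) and nabla_k (e *m P) of
   the definition of chi, projected by P and Q respectively. *)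
Definition chi_mx (z : Z) (k : 'rV[R]_m) : 'M[R]_m :=
  (derive Q z (hlift z k) + Q z *m chr z k) *m P z
  + (derive P z (hlift z k) + P z *m chr z k) *m Q z.

Lemma smooth_chi_mx (k : Z -> 'rV[R]_m) : smooth_on O k ->
  smooth_on O (fun z => chi_mx z (k z)).
Proof.
move=> sk; have sN := smooth_hlift oA oU0 conn sk.
have sG := smooth_chr oA oU0 conn sk.
have fZ := @finite_coordinates_tangent R m.
have aux (X Y : Z -> 'M[R]_m) : smooth_on O X -> smooth_on O Y ->
    smooth_on O (fun z => (derive X z (hlift z (k z)) + X z *m chr z (k z)) *m Y z).
  move=> sX sY; apply: (smooth_on_mulmx oO _ sY); apply: (smooth_on_add oO).
    exact: (smooth_on_derive_along fZ oO sX sN).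
  exact: (smooth_on_mulmx oO sX sG).
exact: (smooth_on_add oO (aux Q P sQ sP) (aux P Q sP sQ)).
Qed.

(** Horizontal lifts are linear everywhere, but a directional derivative is known to be linear in
    its direction only where P and Q are differentiable; hence this coordinate form, restricted to
    O. *)
Lemma chi_mx_sum z : O z -> forall b,
  chi_mx z b = \sum_i b 0 i *: chi_mx z (delta_mx 0 i).
Proof.
move=> Oz b; have dP := smooth_on_differentiable sP Oz.
have dQ := smooth_on_differentiable sQ Oz.
have dl (X : Z -> 'M[R]_m) k b1 b2 : differentiable X z ->
    derive X z (hlift z (k *: b1 + b2)) =
    k *: derive X z (hlift z b1) + derive X z (hlift z b2).
  move=> dX; have hP : hlift z (k *: b1 + b2) = k *: hlift z b1 + hlift z b2.
    exact: linearP.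
  rewrite hP (deriveE (k *: hlift z b1 + hlift z b2) dX).
  by rewrite (deriveE (hlift z b1) dX) (deriveE (hlift z b2) dX) linearP.
have aux (X Y : Z -> 'M[R]_m) k b1 b2 : differentiable X z ->
    (derive X z (hlift z (k *: b1 + b2)) + X z *m chr z (k *: b1 + b2)) *m Y z =
    k *: ((derive X z (hlift z b1) + X z *m chr z b1) *m Y z) +
    (derive X z (hlift z b2) + X z *m chr z b2) *m Y z.
  move=> dX; rewrite (dl X k b1 b2 dX).
  have -> : chr z (k *: b1 + b2) = k *: chr z b1 + chr z b2 by exact: linearP.
  by rewrite mulmxDr -scalemxAr addrACA -scalerDr mulmxDl -scalemxAl.
have lin : linear (chi_mx z).
  move=> k b1 b2; have E := congr2 +%R (aux Q P k b1 b2 dQ) (aux P Q k b1 b2 dP).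
  by apply: etrans E _; rewrite addrACA -scalerDr.
pose linM := GRing.isLinear.Build R 'rV[R]_m 'M[R]_m _ (chi_mx z) lin.
pose F : {linear 'rV[R]_m -> 'M[R]_m} := HB.pack (chi_mx z) linM.
transitivity (F (\sum_i b 0 i *: delta_mx 0 i)); first by rewrite -row_sum_delta.
by rewrite linear_sum; apply: eq_bigr => i _; rewrite linearZ.
Qed.

(** In [chi] at q, the vector e is extended with constant coordinates in the chart at q, so its
    coordinates [Er] in the chart p vary. That they may be treated as constant is the tensoriality
    of chi. *)
Lemma chi_chart q u h e : U0 q -> A q u ->
  tcoord p q (chi sigma L nabla q u h e) =
  tcoord p q e *m chi_mx (tpt p q u) (tcoord p q h).
Proof.
move=> Uq Aq; have pq := U0p Uq; set z := tpt p q u.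
set e' := tcoord p q e; set h' := tcoord p q h.
have Oz : O z by exact: (tset_rep_tpt U0p).
pose E : vfield M := tvec q ^~ e; pose H : vfield M := tvec q ^~ h.
pose U1 := U0 `&` chart_dom q.
have oU1 : open U1 by apply: openI => //; exact: chart_dom_open.
have U1p : U1 `<=` chart_dom p by move=> r [/U0p].
have U1q : U1 q by split=> //; exact: chart_dom_self.
have sE : smooth_vfield U1 E.
  by apply: smooth_vfield_subset (smooth_const_field q e) => r [].
have sH : smooth_vfield U1 H.
  by apply: smooth_vfield_subset (smooth_const_field q h) => r [].
pose O1 : set Z := tset_rep A U1 p.
have oO1 : open O1 := open_tset_rep oA oU1.
have O1O : O1 `<=` O.
  by move=> y [[r [pr [Ur _]] yE] Ay]; split=> //; exists r.
have Oz1 : O1 z by exact: (tset_rep_tpt U1p).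
pose Er := vfield_rep p E.
have Er_chart r : U1 r -> Er (chart p r) = tcoord p r (E r).
  by move=> Ur; rewrite /Er /vfield_rep (chartK (U1p r Ur)).
have Ez : Er z.1 = e'.
  apply: etrans (Er_chart q U1q) _.
  by congr (tcoord p q _); exact: tvec_self.
have Hq : tcoord p q (H q) = h' by congr (tcoord p q _); exact: tvec_self.
have dEr : differentiable Er z.1.
  by apply: (smooth_on_differentiable (sE p)); exact: chart_imageI.
have dEr1 : differentiable (fun y : Z => Er y.1) z.
  exact: (differentiable_comp (differentiable_fst z) dEr).
have sEr : smooth_on O1 (fun y : Z => Er y.1).
  have l : continuous (fst : Z -> 'rV[R]_m) by exact: continuous_fst.
  have oI := open_chart_image p oU1.
  apply: (smooth_on_comp (@finite_coordinates_mx _ _ _) oO1 oI (sE p)).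
    exact: (smooth_on_linear_comp oO1 l (smooth_on_id oO1)).
  by move=> y [].
have aux (X Y : Z -> 'M[R]_m) Pr : smooth_on O X -> X z *m Y z = 0 ->
    (forall q u k, U0 q -> A q u ->
      tcoord p q (Pr q u k) = tcoord p q k *m X (tpt p q u)) ->
    tcoord p q (cov nabla H (fun r w => Pr r w (E r)) q u) *m Y z =
    e' *m ((derive X z (hlift z h') + X z *m chr z h') *m Y z).
  move=> sX XY PrX; have sX1 := smooth_on_subset O1O sX.
  have dX := smooth_on_differentiable sX Oz.
  have r1 : avrep A p U1 (fun r w => Pr r w (E r)) (fun y => Er y.1 *m X y).
    move=> r w Ur Aw; apply: etrans (PrX r w (E r) (proj1 Ur) Aw) _.
    by rewrite -(Er_chart r Ur).
  have sF : smooth_on O1 (fun y => Er y.1 *m X y) := smooth_on_mulmx oO1 sEr sX1.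
  rewrite (cov_chart oA oU1 U1p conn r1 sF oU1 (fun _ h => h) sH U1q Aq).
  rewrite Hq Ez (derive_mulmx _ dEr1 dX) Ez.
  (* The derivative of [Er] is multiplied by [X z *m Y z], a product of complementary projections,
     and drops out. *)
  by rewrite !mulmxDl -(mulmxA _ (X z) (Y z)) XY mulmx0 add0r mulmxDr !mulmxA.
have PQ : P z *m Q z = 0.
  by rewrite mulmxBl mul1mx (hproj_idem finsler subm vert_nondeg Oz) subrr.
have QP : Q z *m P z = 0.
  by rewrite mulmxBr mulmx1 (hproj_idem finsler subm vert_nondeg Oz) subrr.
have vc r w k := @vpart_chart _ _ _ _ _ _ _ _ _ _ p finsler subm vert_nondeg r w k.
have hc r w k := @hpart_chart _ _ _ _ _ _ _ _ _ _ p finsler subm vert_nondeg r w k.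
have E1 := aux Q P (hpart sigma L) sQ QP hc.
have E2 := aux P Q (vpart sigma L) sP PQ vc.
apply: etrans (tcoordD _ _ pq) _.
apply: etrans (congr2 +%R (etrans (vc _ _ _ Uq Aq) E1) (etrans (hc _ _ _ Uq Aq) E2)) _.
by symmetry; exact: mulmxDr.
Qed.

Lemma oneillT_chart q u b e : U0 q -> A q u ->
  tcoord p q (oneillT sigma L nabla q u b e) =
  tcoord p q e *m chi_mx (tpt p q u) (tcoord p q b *m P (tpt p q u)).
Proof.
move=> Uq Aq; rewrite /oneillT chi_chart //.
by rewrite (vpart_chart finsler subm vert_nondeg).
Qed.

Lemma oneillA_chart q u b e : U0 q -> A q u ->
  tcoord p q (oneillA sigma L nabla q u b e) =
  tcoord p q e *m chi_mx (tpt p q u) (tcoord p q b *m Q (tpt p q u)).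
Proof.
move=> Uq Aq; rewrite /oneillA chi_chart //.
by rewrite (hpart_chart finsler subm vert_nondeg).
Qed.

Variables (v : 'rV[R]_m) (Av : A p v).
Local Notation z0 := (tpt p p v).
Local Notation G := (gram L p z0).
Local Notation DP k := (derive P z0 (hlift z0 k)).
Local Notation DQ k := (derive Q z0 (hlift z0 k)).
Local Notation DX h b := (derive (chi_mx^~ b) z0 (hlift z0 h)).
Local Notation dchr := (dchr nabla p v).

Let Oz0 : O z0 := tset_rep_tpt U0p U0pp Av.
Let dP : differentiable P z0 := smooth_on_differentiable sP Oz0.
Let dQ : differentiable Q z0 := smooth_on_differentiable sQ Oz0.

Lemma chi_mxD z a b : O z -> chi_mx z (a + b) = chi_mx z a + chi_mx z b.
Proof.
move=> Oz; have E := chi_mx_sum Oz.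
rewrite (E (a + b)) (E a) (E b) -big_split /=; apply: eq_bigr => i _.
by rewrite mxE scalerDl.
Qed.

Lemma chi_mx0 z : O z -> chi_mx z 0 = 0.
Proof.
move=> Oz; apply: (@addrI _ (chi_mx z 0)).
by rewrite -chi_mxD // !addr0.
Qed.

Lemma chi_mxN z a : O z -> chi_mx z (- a) = - chi_mx z a.
Proof.
by move=> Oz; apply: (@addrI _ (chi_mx z a)); rewrite -chi_mxD // !subrr chi_mx0.
Qed.

Lemma chi_mxB z a b : O z -> chi_mx z (a - b) = chi_mx z a - chi_mx z b.
Proof. by move=> Oz; rewrite chi_mxD // chi_mxN. Qed.

Lemma derive_hproj z k : O z -> derive Q z k = - derive P z k.
Proof.
move=> Oz; have dQz := smooth_on_differentiable sQ Oz.
have E : derive P z k = derive (fun=> 1%:M) z k - derive Q z k.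
  exact: (derive_fB _ (differentiable_cst _ _) dQz).
by rewrite E [X in X - _](derive_cst 1%:M z k) sub0r opprK.
Qed.

Lemma derive_idem (Y : Z -> 'M[R]_m) k : differentiable Y z0 ->
  (forall z, O z -> Y z *m Y z = Y z) ->
  derive Y z0 (hlift z0 k) *m Y z0 + Y z0 *m derive Y z0 (hlift z0 k) =
  derive Y z0 (hlift z0 k).
Proof.
move=> dY YY; rewrite -(derive_mulmx _ dY dY); apply: near_eq_derive.
have nO : nbhs z0 O by exact: open_nbhs_nbhs.
by apply: filterS nO => z Oz; exact: YY.
Qed.

Lemma chr_sym b e : b *m chr z0 e = e *m chr z0 b.
Proof.
have sb : smooth_vfield U0 (const_field p b) := smooth_const_field_sub U0p b.
have se : smooth_vfield U0 (const_field p e) := smooth_const_field_sub U0p e.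
have := lc_torsion_free lcc oU0 se sb U0pp Av.
rewrite lie_bracket_const; last exact: chart_dom_self.
rewrite (avrep_self U0pp (avrep_nabla conn oU0 U0p e b) Av).
rewrite (avrep_self U0pp (avrep_nabla conn oU0 U0p b e) Av).
exact: subr0_eq.
Qed.

Lemma fund_tensor_point a b : fund_tensor L p v a b = bform G a b.
Proof.
by rewrite (fund_tensor_chart finsler oU0 U0p _ _ U0pp Av) !tcoord_self.
Qed.

(** The condition nabla g = 0, tested on fields with constant coordinates and read entry by
    entry. *)
Lemma derive_gram k :
  derive (gram L p) z0 (hlift z0 k) = chr z0 k *m G + G *m (chr z0 k)^T.
Proof.
have sG := smooth_gram finsler oU0 (p := p).
have dG : differentiable (gram L p) z0 := smooth_on_differentiable sG Oz0.
have E b h : bform (derive (gram L p) z0 (hlift z0 k)) b h =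
    bform G (b *m chr z0 k) h + bform G b (h *m chr z0 k).
  pose phi z := bform (gram L p z) b h.
  have phiE z : phi z = (b *m gram L p z *m h^T) 0 0 by [].
  have sbG : smooth_on O (fun z => b *m gram L p z *m h^T).
    apply: (smooth_on_mulmx oO _ (smooth_on_cst _ oO)).
    exact: (smooth_on_mulmx oO (smooth_on_cst b oO) sG).
  have sphi : smooth_on O phi := smooth_on_mxE 0 0 oO sbG.
  have rphi q w : U0 q -> A q w ->
      fund_tensor L q w (const_field p b q) (const_field p h q) = phi (tpt p q w).
    move=> Uq Aq; rewrite (fund_tensor_chart finsler oU0 U0p _ _ Uq Aq).
    by rewrite (tvecK b (U0p Uq)) (tvecK h (U0p Uq)).
  have sk : smooth_vfield U0 (const_field p k) := smooth_const_field_sub U0p k.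
  have C := cov_fun_chart oA oU0 U0p conn rphi sphi oU0 (fun _ x => x)
    sk U0pp Av.
  have := lc_metric lcc k b h Av.
  rewrite -[X in X = _ -> _]/(cov_fun nabla (const_field p k)
      (fun q w => fund_tensor L q w (const_field p b q) (const_field p h q)) p v
    - fund_tensor L p v (nabla (const_field p k) (const_field p b) p v) h
    - fund_tensor L p v b (nabla (const_field p k) (const_field p h) p v)).
  rewrite C (avrep_self U0pp (avrep_nabla conn oU0 U0p k b) Av).
  rewrite (avrep_self U0pp (avrep_nabla conn oU0 U0p k h) Av) !fund_tensor_point.
  have -> : const_field p k p = k by exact: tvec_self.
  have -> : derive phi z0 (hlift z0 k) = bform (derive (gram L p) z0 (hlift z0 k)) b h.
    have dbG : differentiable (fun z => b *m gram L p z) z0.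
      exact: (differentiable_mulmx (differentiable_cst b _) dG).
    rewrite /bform -(derive_cmul b _ dG).
    have -> : derive (fun z => b *m gram L p z) z0 (hlift z0 k) *m h^T =
        derive (fun z => b *m gram L p z *m h^T) z0 (hlift z0 k).
      rewrite (derive_mulmx _ dbG (differentiable_cst _ _)).
      by rewrite [X in _ + _ *m X](derive_cst h^T z0 (hlift z0 k)) mulmx0 addr0.
    exact: (esym (derive_mxE _ 0 0 (smooth_on_differentiable sbG Oz0))).
  move=> E; lra.
apply/matrixP => i j; have := E (delta_mx 0 i) (delta_mx 0 j).
by rewrite bform_mull bform_mulr !bform_delta => ->; rewrite [RHS]mxE.
Qed.

Lemma vproj_point : P z0 = 1%:M - Q z0.
Proof. by []. Qed.

Lemma hproj_point : Q z0 = 1%:M - P z0.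
Proof. by rewrite vproj_point opprB addrC subrK. Qed.

Lemma chi_mx_vproj k : chi_mx z0 k =
  (- DP k + Q z0 *m chr z0 k) *m P z0 + (DP k + P z0 *m chr z0 k) *m Q z0.
Proof. by rewrite -(derive_hproj _ Oz0). Qed.

Lemma chi_mx_hproj k : chi_mx z0 k =
  (- DQ k + P z0 *m chr z0 k) *m Q z0 + (DQ k + Q z0 *m chr z0 k) *m P z0.
Proof. by rewrite [RHS]addrC (derive_hproj _ Oz0) opprK -(derive_hproj _ Oz0). Qed.

Lemma chi_mx_skew k a b :
  bform G (a *m chi_mx z0 k) b = - bform G a (b *m chi_mx z0 k).
Proof.
have PG z (Oz : O z) := vproj_gram finsler subm Oz.
have PP z (Oz : O z) := vproj_idem finsler subm vert_nondeg Oz.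
have dG : differentiable (gram L p) z0.
  exact: (smooth_on_differentiable (smooth_gram finsler oU0 (p := p)) Oz0).
have dT : differentiable (fun z => (P z)^T) z0.
  exact: (smooth_on_differentiable (smooth_on_tr oO sP) Oz0).
have DPG : DP k *m G + P z0 *m derive (gram L p) z0 (hlift z0 k) =
    derive (gram L p) z0 (hlift z0 k) *m (P z0)^T + G *m (DP k)^T.
  rewrite -(derive_mulmx _ dP dG) -(derive_tr _ dP) -(derive_mulmx _ dG dT).
  apply: near_eq_derive; have nO : nbhs z0 O by exact: open_nbhs_nbhs.
  by apply: filterS nO => z Oz; exact: PG.
have XG := proj_skew (PP z0 Oz0) hproj_point (derive_idem k dP PP) (PG z0 Oz0)
  DPG (derive_gram k) (chi_mx_vproj k).
by rewrite bform_mull XG bform_mulr /bform mulmxN mulNmx mxE.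
Qed.

Lemma cov_tensor_chi T (Y : Z -> 'M[R]_m) h b e :
  (forall q u b e, U0 q -> A q u -> tcoord p q (T q u b e) =
     tcoord p q e *m chi_mx (tpt p q u) (tcoord p q b *m Y (tpt p q u))) ->
  smooth_on O Y ->
  cov_tensor nabla T p v h b e =
    e *m (DX h (b *m Y z0) + chi_mx z0 (b *m derive Y z0 (hlift z0 h)))
    + e *m chi_mx z0 (b *m Y z0) *m chr z0 h
    - e *m chi_mx z0 (b *m chr z0 h *m Y z0)
    - e *m chr z0 h *m chi_mx z0 (b *m Y z0).
Proof.
move=> TY sY.
exact: (cov_tensor_chart oA conn oU0 U0p U0pp Av h b e TY sY
  smooth_chi_mx
  chi_mx_sum).
Qed.

Definition oneill q u b e := oneillT sigma L nabla q u b e + oneillA sigma L nabla q u b e.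

Lemma oneill_chart q u b e : U0 q -> A q u ->
  tcoord p q (oneill q u b e) = tcoord p q e *m chi_mx (tpt p q u) (tcoord p q b).
Proof.
move=> Uq Aq; have pq := U0p Uq; have Oz : O (tpt p q u) := tset_rep_tpt U0p Uq Aq.
apply: etrans (tcoordD _ _ pq) _.
have E1 := oneillT_chart b e Uq Aq.
have E2 := oneillA_chart b e Uq Aq.
apply: etrans (congr2 +%R E1 E2) _.
have {E1 E2} PQ1 : P (tpt p q u) + Q (tpt p q u) = 1%:M by rewrite subrK.
by rewrite -mulmxDr -(chi_mxD _ _ Oz) -mulmxDr PQ1 mulmx1.
Qed.

Lemma cov_oneill h b e : cov_tensor nabla oneill p v h b e =
  e *m DX h b + e *m chi_mx z0 b *m chr z0 h
  - e *m chi_mx z0 (b *m chr z0 h) - e *m chr z0 h *m chi_mx z0 b.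
Proof.
have TY q u b' e' : U0 q -> A q u -> tcoord p q (oneill q u b' e') =
    tcoord p q e' *m chi_mx (tpt p q u) (tcoord p q b' *m (fun=> 1%:M) (tpt p q u)).
  by move=> Uq Aq; rewrite mulmx1 oneill_chart.
have s1 : smooth_on O (fun=> 1%:M : 'M[R]_m) := smooth_on_cst _ oO.
rewrite (cov_tensor_chi h b e TY s1) !mulmx1.
have -> : derive (fun=> 1%:M : 'M[R]_m) z0 (hlift z0 h) = 0 by exact: derive_cst.
by rewrite mulmx0 chi_mx0 // addr0.
Qed.

(* The correction comes from T_b = chi_(b Y), differentiated at h = h Y. *)
Lemma cov_tensor_fixed T (Y : Z -> 'M[R]_m) h k :
  (forall q u b e, U0 q -> A q u -> tcoord p q (T q u b e) =
     tcoord p q e *m chi_mx (tpt p q u) (tcoord p q b *m Y (tpt p q u))) ->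
  smooth_on O Y -> h *m Y z0 = h ->
  h *m chi_mx z0 k = h *m derive Y z0 (hlift z0 k) + h *m chr z0 k
    - h *m chr z0 k *m Y z0 ->
  cov_tensor nabla T p v k h h =
  cov_tensor nabla oneill p v k h h + h *m chi_mx z0 (h *m chi_mx z0 k).
Proof.
move=> TY sY hY hX; rewrite (cov_tensor_chi _ _ _ TY sY) cov_oneill hY.
rewrite [in X in _ = _ + X]hX (chi_mxB _ _ Oz0) (chi_mxD _ _ Oz0).
exact: cov_tensor_algebra.
Qed.

(** The right-hand side is the curvature of nabla - chi. This connection preserves the splitting, so
    its curvature is the sum of the curvatures induced on the two parts. *)
Lemma proj_curvature_sum b e h :
  proj_curvature nabla (vpart sigma L) p v b e h
  + proj_curvature nabla (hpart sigma L) p v b e h =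
  (h *m dchr b e - h *m DX b e
   + (h *m chr z0 e - h *m chi_mx z0 e) *m (chr z0 b - chi_mx z0 b))
  - (h *m dchr e b - h *m DX e b
   + (h *m chr z0 b - h *m chi_mx z0 b) *m (chr z0 e - chi_mx z0 e)).
Proof.
have vc r w k := @vpart_chart _ _ _ _ _ _ _ _ _ _ p finsler subm vert_nondeg r w k.
have hc r w k := @hpart_chart _ _ _ _ _ _ _ _ _ _ p finsler subm vert_nondeg r w k.
rewrite (proj_curvature_chart oA conn oU0 U0p U0pp Av b e h sP vc).
rewrite (proj_curvature_chart oA conn oU0 U0p U0pp Av b e h sQ hc).
pose Y k z := h *m chr z k - h *m chi_mx z k.
have QQ z (Oz : O z) := hproj_idem finsler subm vert_nondeg Oz.
have nO : nbhs z0 O by exact: open_nbhs_nbhs.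
have YP k z : O z -> proj_cov nabla p P h k z = Y k z *m P z.
  move=> Oz; rewrite /Y -mulmxBr -!mulmxA mulmxBl.
  rewrite (proj_shape_l _ (QQ z Oz) (erefl _) (derive_hproj _ Oz)) /proj_cov.
  by rewrite -(mulmxA h (P z)) -mulmxDr mulmxA.
have YQ k z : O z -> proj_cov nabla p Q h k z = Y k z *m Q z.
  move=> Oz; rewrite /Y -mulmxBr -!mulmxA mulmxBl.
  rewrite (proj_shape_r _ (QQ z Oz) (erefl _) (derive_hproj _ Oz)) /proj_cov.
  by rewrite -(mulmxA h (Q z)) -mulmxDr mulmxA.
have sX k := smooth_chi_mx (smooth_on_cst k oO).
have sC k := smooth_chr_const oA conn oU0 (p := p) k.
have dX k : differentiable (chi_mx^~ k) z0 := smooth_on_differentiable (sX k) Oz0.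
have dC k : differentiable (chr^~ k) z0 := smooth_on_differentiable (sC k) Oz0.
have dhX k : differentiable (fun z => h *m chi_mx z k) z0.
  exact: (differentiable_mulmx (differentiable_cst h z0) (dX k)).
have dhC k : differentiable (fun z => h *m chr z k) z0.
  exact: (differentiable_mulmx (differentiable_cst h z0) (dC k)).
have dY k : differentiable (Y k) z0 := differentiableB (dhC k) (dhX k).
have DY k l : derive (Y k) z0 (hlift z0 l) = h *m dchr l k - h *m DX l k.
  apply: etrans (derive_fB _ (dhC k) (dhX k)) _.
  exact: (congr2 (fun x y => x - y) (derive_cmul h _ (dC k)) (derive_cmul h _ (dX k))).
have DW (W : Z -> 'M[R]_m) k l : differentiable W z0 ->
    (forall z, O z -> proj_cov nabla p W h k z = Y k z *m W z) ->
    derive (proj_cov nabla p W h k) z0 (hlift z0 l) + proj_cov nabla p W h k z0 *m chr z0 l =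
    (h *m dchr l k - h *m DX l k) *m W z0 +
    Y k z0 *m (derive W z0 (hlift z0 l) + W z0 *m chr z0 l).
  move=> dW WY; rewrite (WY z0 Oz0) -DY mulmxDr addrA mulmxA; congr (_ + _).
  rewrite -(derive_mulmx _ (dY k) dW); apply: near_eq_derive.
  by apply: filterS nO => z Oz; exact: WY.
have main k l :
    (derive (proj_cov nabla p P h k) z0 (hlift z0 l)
      + proj_cov nabla p P h k z0 *m chr z0 l) *m P z0
    + (derive (proj_cov nabla p Q h k) z0 (hlift z0 l)
      + proj_cov nabla p Q h k z0 *m chr z0 l) *m Q z0
    = h *m dchr l k - h *m DX l k + Y k z0 *m (chr z0 l - chi_mx z0 l).
  rewrite (DW P k l dP (YP k)) (DW Q k l dQ (YQ k)).
  exact: (proj_sum _ _ _ (QQ z0 Oz0) (erefl _) (derive_hproj _ Oz0)).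
by rewrite [X in X + _ = _]mulmxBl [X in _ + X = _]mulmxBl addrACA main -opprD main.
Qed.

(* w *m Q factors as s x *m C z, where s depends on the base point only and
   vanishes at p, so all that remains is the symmetry of the second derivatives
   of s. *)
Lemma proj_curvature_vertical b e w : vertical sigma p w ->
  proj_curvature nabla (hpart sigma L) p v b e w = 0.
Proof.
move=> wv.
have hc r u k := @hpart_chart _ _ _ _ _ _ _ _ _ _ p finsler subm vert_nondeg r u k.
rewrite (proj_curvature_chart oA conn oU0 U0p U0pp Av b e w sQ hc).
have oI : open (chart p @` (chart_dom p `&` U0)) := open_chart_image p oU0.
have Ip : (chart p @` (chart_dom p `&` U0)) (chart p p) := chart_imageI (chart_dom_self p) U0pp.
have ssr := smooth_subm_rep subm (p := p).
pose s x := derive (subm_rep sigma p) x w.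
have ss : smooth_on (chart p @` (chart_dom p `&` U0)) s := smooth_on_derive w ssr.
(* The rows of [C z] are the horizontal lifts, in direction z, of the coordinate vectors of the
   base: they are g-dual to pulled-back covectors and [C z *m S = 1]. So [w *m Q z] is the
   horizontal lift of the image [s] of w under the differential of sigma. *)
pose C z := invmx (cogram L sigma p z) *m (subm_jac sigma p z.1)^T *m invmx (gram L p z).
have nO : nbhs z0 O by exact: open_nbhs_nbhs.
have OI z : O z -> (chart p @` (chart_dom p `&` U0)) z.1 by case.
have sE z : O z -> w *m subm_jac sigma p z.1 = s z.1.
  by case=> -[q [pq Uq] <-] _; rewrite (mul_subm_jac subm w Uq).
have QE z : Q z = subm_jac sigma p z.1 *m C z by rewrite /C !mulmxA.
have wQ z : O z -> w *m Q z = s z.1 *m C z.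
  by move=> Oz; rewrite QE mulmxA sE.
have s0 : s z0.1 = 0.
  by rewrite -sE //; have := (vertical_chart subm w U0pp).1 wv; rewrite tcoord_self.
have CQ z : O z -> C z *m Q z = C z.
  move=> Oz; have K1 := cogram_unit finsler subm vert_nondeg Oz.
  have CS : C z *m subm_jac sigma p z.1 = 1%:M.
    by rewrite /C -!mulmxA [X in _ *m X]mulmxA (mulVmx K1).
  by rewrite QE mulmxA CS mul1mx.
have sC : smooth_on O C.
  have sJ := smooth_subm_jac finsler subm (p := p).
  have sG := smooth_on_invmx oO (gram_unit finsler oU0 U0p) (smooth_gram finsler oU0 (p := p)).
  have sK := smooth_on_mulmx oO (smooth_on_mulmx oO (smooth_on_tr oO sJ) sG) sJ.
  have sK1 := smooth_on_invmx oO (cogram_unit finsler subm vert_nondeg) sK.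
  exact: (smooth_on_mulmx oO (smooth_on_mulmx oO sK1 (smooth_on_tr oO sJ)) sG).
have dsf (f : 'rV[R]_m -> 'rV[R]_n) z k : O z ->
    smooth_on (chart p @` (chart_dom p `&` U0)) f ->
    differentiable (fun z : Z => f z.1) z /\
    derive (fun z : Z => f z.1) z (hlift z k) = derive f z.1 k.
  move=> Oz sf; have df := smooth_on_differentiable sf (OI z Oz).
  split; first exact: (differentiable_comp (differentiable_fst z) df).
  rewrite (derive_comp (f := f) (g := fst) _ (differentiable_fst z) df).
  rewrite (deriveE _ (differentiable_fst z)).
  have lf : continuous (fst : {linear Z -> 'rV[R]_m}) by exact: continuous_fst.
  by rewrite (diff_lin _ lf).
pose W k z := derive s z.1 k *m C z
  + s z.1 *m ((derive C z (hlift z k) + C z *m chr z k) *m Q z).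
have WE k z : O z -> proj_cov nabla p Q w k z = W k z.
  move=> Oz; have dC := smooth_on_differentiable sC Oz.
  have dQz := smooth_on_differentiable sQ Oz.
  have D : w *m derive Q z (hlift z k) =
      derive s z.1 k *m C z + s z.1 *m derive C z (hlift z k).
    have [d1 d2] := dsf s z k Oz ss.
    rewrite -(derive_cmul w _ dQz) -d2 -(derive_mulmx _ d1 dC).
    have nOz : nbhs z O by exact: open_nbhs_nbhs.
    by apply: near_eq_derive; apply: filterS nOz => y Oy; exact: wQ.
  rewrite /proj_cov D (wQ z Oz) /W -addrA mulmxDl -(mulmxA _ (C z) (Q z)) (CQ z Oz).
  by rewrite -(mulmxA _ (C z)) -mulmxDr -mulmxA.
have dC : differentiable C z0 := smooth_on_differentiable sC Oz0.
pose V k z := (derive C z (hlift z k) + C z *m chr z k) *m Q z.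
have sV k : smooth_on O (V k).
  apply: (smooth_on_mulmx oO _ sQ); apply: (smooth_on_add oO).
    exact: (smooth_derive_hlift oA conn oU0 k sC).
  exact: (smooth_on_mulmx oO sC (smooth_chr_const oA conn oU0 k)).
have main k l : (derive (proj_cov nabla p Q w k) z0 (hlift z0 l)
      + proj_cov nabla p Q w k z0 *m chr z0 l) *m Q z0
    = derive (fun x => derive s x k) z0.1 l *m C z0
      + derive s z0.1 k *m V l z0 + derive s z0.1 l *m V k z0.
  have [d1 d1'] := dsf s z0 l Oz0 ss.
  have [d2 d2'] := dsf _ z0 l Oz0 (smooth_on_derive k ss).
  have dV : differentiable (V k) z0 := smooth_on_differentiable (sV k) Oz0.
  have -> : derive (proj_cov nabla p Q w k) z0 (hlift z0 l) = derive (W k) z0 (hlift z0 l).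
    by apply: near_eq_derive; apply: filterS nO => z Oz; exact: WE.
  have -> : derive (W k) z0 (hlift z0 l) = derive (fun x => derive s x k) z0.1 l *m C z0
      + derive s z0.1 k *m derive C z0 (hlift z0 l) + derive s z0.1 l *m V k z0.
    apply: etrans (derive_fD _ (differentiable_mulmx d2 dC) (differentiable_mulmx d1 dV)) _.
    apply: etrans (congr2 +%R (derive_mulmx _ d2 dC) (derive_mulmx _ d1 dV)) _.
    by rewrite d1' d2' s0 mul0mx addr0.
  have E0 : s z0.1 *m V k z0 = 0 := etrans (congr1 (mulmx^~ (V k z0)) s0) (mul0mx _ _).
  have W0 : proj_cov nabla p Q w k z0 = derive s z0.1 k *m C z0.
    exact: (etrans (WE k z0 Oz0) (etrans (congr1 (+%R _) E0) (addr0 _))).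
  have VQ : V k z0 *m Q z0 = V k z0.
    by rewrite /V -mulmxA (hproj_idem finsler subm vert_nondeg Oz0).
  rewrite W0; exact: frame_derivative (CQ z0 Oz0) VQ.
(* The two products of a derivative of s with [V] are exchanged by swapping b and e, and cancel in
   the difference. *)
have sym := derive_schwarz_mx e b oI ss Ip.
apply: etrans (mulmxBl _ _ _) _.
apply: etrans (congr2 (fun x y => x - y) (main e b) (main b e)) _.
have gen (a a' c d : 'rV[R]_m) : a = a' -> a + c + d - (a' + d + c) = 0.
  by move=> ->; rewrite [a' + c + d]addrAC subrr.
exact: gen (congr1 (mulmx^~ (C z0)) sym).
Qed.

(** Adding chi back to nabla - chi. The symmetry [chr_sym], that is torsion-freeness, removes chi at
    nabla_b e - nabla_e b. *)
Lemma curvature_oneill b e h : curvature nabla p v b e h =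
  proj_curvature nabla (vpart sigma L) p v b e h
  + proj_curvature nabla (hpart sigma L) p v b e h
  + cov_tensor nabla oneill p v b e h - cov_tensor nabla oneill p v e b h
  - h *m chi_mx z0 e *m chi_mx z0 b + h *m chi_mx z0 b *m chi_mx z0 e.
Proof.
rewrite proj_curvature_sum.
rewrite !cov_oneill.
rewrite (curvature_chart oA conn oU0 U0p U0pp Av).
by rewrite (chr_sym e b); exact: curvature_algebra.
Qed.

(** Both formulas at once: (T, S, Y, Yc) is (T, A, P, Q) for a vertical h and (A, T, Q, P) for a
    horizontal one. That [h *m chi_mx z0 v] lies in the range of Yc turns the correction chi_(chi_v
    h) h into the S-term. *)
Lemma flag_numerator T S (Y Yc : Z -> 'M[R]_m) h :
  (forall q u b e, U0 q -> A q u -> tcoord p q (T q u b e) =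
     tcoord p q e *m chi_mx (tpt p q u) (tcoord p q b *m Y (tpt p q u))) ->
  (forall q u b e, U0 q -> A q u -> tcoord p q (S q u b e) =
     tcoord p q e *m chi_mx (tpt p q u) (tcoord p q b *m Yc (tpt p q u))) ->
  smooth_on O Y -> h *m Y z0 = h ->
  h *m chi_mx z0 v = h *m derive Y z0 (hlift z0 v) + h *m chr z0 v
    - h *m chr z0 v *m Y z0 ->
  h *m chi_mx z0 v *m Yc z0 = h *m chi_mx z0 v ->
  let g := fund_tensor L p v in
  let D := cov_tensor nabla in
  g (curvature nabla p v v h h) v =
  g (proj_curvature nabla (vpart sigma L) p v v h h
     + proj_curvature nabla (hpart sigma L) p v v h h) v
  + g (D T p v v h h - D oneill p v h v h) v
  + (- g (S p v (oneill p v v h) h) v + g (T p v h h) (oneill p v v v)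
     - g (oneill p v v h) (T p v h v)).
Proof.
move=> TY SY sY hY hX hXc g D.
have gE a b : g a b = bform G a b := fund_tensor_point a b.
have oE b e : oneill p v b e = e *m chi_mx z0 b.
  have := oneill_chart b e U0pp Av.
  by rewrite !tcoord_self.
have TE b e : T p v b e = e *m chi_mx z0 (b *m Y z0).
  by have := TY p v b e U0pp Av; rewrite !tcoord_self.
have SE b e : S p v b e = e *m chi_mx z0 (b *m Yc z0).
  by have := SY p v b e U0pp Av; rewrite !tcoord_self.
have DT := cov_tensor_fixed TY sY hY hX.
rewrite !gE /D DT curvature_oneill !oE !TE !SE hY hXc.
have skew := chi_mx_skew.
exact: bform_flag (skew _ _ _) (skew _ _ _).
Qed.

Lemma vertical_vproj w : vertical sigma p w -> w *m P z0 = w.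
Proof.
move=> /(vertical_chart subm w U0pp); rewrite tcoord_self => wS.
by rewrite mulmxBr mulmx1 /hproj !mulmxA wS !mul0mx subr0.
Qed.

(** The vector [x *m P z0] is vertical, and as the difference of the horizontal x and [x *m Q z0] it
    is also orthogonal to the vertical space, hence zero. *)
Lemma horizontal_hproj x : g_horizontal sigma L p v x -> x *m Q z0 = x.
Proof.
move=> xh; have PS := vproj_jac finsler subm vert_nondeg Oz0.
suff xP : x *m P z0 = 0 by rewrite -[LHS]addr0 -xP -mulmxDr addrC subrK mulmx1.
apply: (vert_nondeg Av) => [|h hv].
  by apply/(vertical_chart subm _ U0pp); rewrite tcoord_self -mulmxA PS mulmx0.
have hS := (vertical_chart subm h U0pp).1 hv; rewrite tcoord_self in hS.
have gE a b := fund_tensor_point a b.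
have := xh h hv; rewrite !gE => E.
rewrite mulmxBr mulmx1 bformBl E.
by rewrite (hproj_horizontal finsler subm x Oz0 hS) subrr.
Qed.

End ONeill.

Theorem corollary6 (R : realType) (m n : nat)
  (M : manifold R m) (B : manifold R n)
  (AM : tset M) (L : tfun M) (AB : tset B) (L' : tfun B)
  (sigma : M -> B) (nabla : vfield M -> vfield M -> avfield M)
  (finslerM : pseudo_finsler AM L) (finslerB : pseudo_finsler AB L')
  (subm : pseudo_finsler_submersion sigma AM L AB L')
  (vert_nondeg : forall p v, AM p v ->
     nondegenerate_on (vertical sigma p) (fund_tensor L p v))
  (lcc : levi_civita_chern nabla AM L)
  (p : M) (v : 'rV[R]_m) (adm_v : AM p v) :
  let T := oneillT sigma L nabla in
  let A := oneillA sigma L nabla in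
  let TA := fun q u b e => T q u b e + A q u b e in
  let g := fund_tensor L p v in
  let K := flag_curvature L (curvature nabla) p v in
  let Ktop := flag_curvature L (proj_curvature nabla (vpart sigma L)) p v in
  let Kbot := flag_curvature L (proj_curvature nabla (hpart sigma L)) p v in
  let D := cov_tensor nabla in
  (forall w, vertical sigma p w ->
     L p v * g w w != g v w ^+ 2 ->
     K w = Ktop w
       + g (D T p v v w w - D TA p v w v w) v
           / (L p v * g w w - g v w ^+ 2)
       + (- g (A p v (TA p v v w) w) v
          + g (T p v w w) (TA p v v v)
          - g (TA p v v w) (T p v w v))
           / (L p v * g w w - g v w ^+ 2)) /\
  (forall x, g_horizontal sigma L p v x ->
     L p v * g x x != g v x ^+ 2 ->
     K x = Ktop x + Kbot x
       + g (D A p v v x x - D TA p v x v x) v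
           / (L p v * g x x - g v x ^+ 2)
       + (- g (T p v (TA p v v x) x) v
          + g (A p v x x) (TA p v v v)
          - g (TA p v v x) (A p v x v))
           / (L p v * g x x - g v x ^+ 2)).
Proof.
move=> T A TA g K Ktop Kbot D; have Up := subm_dom_self sigma p.
have oA := adm_open finslerM; have oU := open_subm_dom p subm.
have Oz : tset_rep AM (subm_dom sigma p) p (tpt p p v).
  exact: (tset_rep_tpt (@subm_dom_chart _ _ _ _ _ sigma p) Up adm_v).
have sP := smooth_vproj finslerM subm vert_nondeg (p := p).
have sQ := smooth_hproj finslerM subm vert_nondeg (p := p).
have PP z Oz' := vproj_idem finslerM subm vert_nondeg (p := p) (z := z) Oz'.
have QQ z Oz' := hproj_idem finslerM subm vert_nondeg (p := p) (z := z) Oz'.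
have TE q u b e := @oneillT_chart _ _ _ _ _ _ _ _ _ _ p nabla
  finslerM subm vert_nondeg lcc q u b e.
have AE q u b e := @oneillA_chart _ _ _ _ _ _ _ _ _ _ p nabla
  finslerM subm vert_nondeg lcc q u b e.
split=> [w wv _|x xh _].
  have wP : w *m vproj L sigma p (tpt p p v) = w.
    by apply: vertical_vproj wv; exact: subm.
  have dP := smooth_on_differentiable sP Oz.
  have [E1 E2] := proj_shape (PP _ Oz) (hproj_point _ _ _ _)
    (derive_idem nabla finslerM subm adm_v v dP PP)
    (chi_mx_vproj nabla finslerM subm vert_nondeg adm_v v) wP.
  have N := flag_numerator finslerM subm vert_nondeg lcc adm_v TE AE sP wP E1 E2.
  rewrite (proj_curvature_vertical finslerM subm vert_nondeg lcc adm_v v w wv) addr0 in N.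
  by rewrite /K /Ktop /flag_curvature N !mulrDl.
(* The same computation with P and Q, T and A exchanged; here both projected curvatures are kept. *)
have xQ := horizontal_hproj finslerM subm vert_nondeg adm_v xh.
have dQ := smooth_on_differentiable sQ Oz.
have [E1 E2] := proj_shape (QQ _ Oz) (vproj_point _ _ _ _)
  (derive_idem nabla finslerM subm adm_v v dQ QQ)
  (chi_mx_hproj nabla finslerM subm vert_nondeg adm_v v) xQ.
have N := flag_numerator finslerM subm vert_nondeg lcc adm_v AE TE sQ xQ E1 E2.
have gE a b : g a b = bform _ a b := fund_tensor_point finslerM subm adm_v a b.
have gD a b : g (a + b) v = g a v + g b v by rewrite !gE bformDl.
have split_num (k k1 k2 a b d : R) : k = k1 + k2 ->
    (k + a + b) / d = k1 / d + k2 / d + a / d + b / d.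
  by move=> ->; rewrite !mulrDl.
rewrite /K /Ktop /Kbot /flag_curvature N; exact: split_num (gD _ _).
Qed.
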